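(* Let $p\ge2$, let $u_0\in L^2(\Omega)\cap L^p(\Omega)$, and let $u$ be the solution of $$\begin{cases}\dfrac{\partial u}{\partial t}=-\Delta_{NL}\big(|\Delta_{NL}u|^{p-2}\Delta_{NL}u\big), & x\in\Omega,\ t>0,\\ u(x,t)=0, & x\notin\Omega,\ t>0,\\ u(x,0)=u_0(x), & x\in\Omega.\end{cases}$$ Then there exist positive constants $C_1,C_2,C_3$, independent of $t$, such that for any $t>0$ $$\int_\Omega|u(x,t)|^2dx\le\begin{cases}e^{-C_1t}\displaystyle\int_\Omega|u_0(x)|^2dx, & \text{if }p=2,\\[2mm] \dfrac{1}{(C_2t+C_3)^{2/(p-2)}}, & \text{if }p>2.\end{cases}$$
   Context: Standing assumptions: $N\ge2$, $\Omega\subset\mathbb{R}^N$ is a bounded domain. The kernel $J:\mathbb{R}^N\to\mathbb{R}$ is a nonnegative continuous radial function with compact support $\mathrm{supp}(J)$, not identically zero. $\Omega_E\subset\mathbb{R}^N$ is a (sufficiently large) bounded domain with $\Omega+2\,\mathrm{supp}(J)\subset\Omega_E$. The nonlocal Laplacian is $$\Delta_{NL}v(x)=\int_{\Omega_E}J(x-y)\,(v(y)-v(x))\,dy .$$ For $u:\Omega\to\mathbb{R}$, $\widetilde u:\Omega_E\to\mathbb{R}$ is the extension of $u$ by zero (in the space variable). For $T>0$ and $Q_T=\Omega\times(0,T)$, the solution on $[0,T]$ is the (unique) function $u\in C([0,T];L^2(\Omega))$ with $\frac{\partial u}{\partial t}\in L^2(Q_T)$ such that $\frac{\partial u}{\partial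 t}=-\Delta_{NL}(|\Delta_{NL}\widetilde u|^{p-2}\Delta_{NL}\widetilde u)$ a.e. in $Q_T$ and $u(x,0)=u_0(x)$ for a.e. $x\in\Omega$. Since $T>0$ is arbitrary and solutions are unique, $u$ is understood as the function on $\Omega\times[0,\infty)$ whose restriction to $[0,T]$ is the solution for every $T>0$. *)

(* Defs.v *)
From HB Require Import structures.
From mathcomp Require Import all_boot all_order all_algebra.
From mathcomp Require Import all_classical all_reals all_analysis.

Set Implicit Arguments.
Unset Strict Implicit.
Unset Printing Implicit Defensive.
Import Order.TTheory GRing.Theory Num.Theory.
Import numFieldNormedType.Exports.
Local Open Scope classical_set_scope.
Local Open Scope ring_scope.

Section rV_measurable.
Context {R : realType} (n : nat).

(* The sigma-algebra generated by the coordinates is the Borel one, see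
   [open_measurable_rV]. *)
Definition rV_measurable : set (set 'rV[R]_n) :=
  g_sigma_preimage (fun (i : 'I_n) (x : 'rV[R]_n) => x ord0 i).

Let rV_measurable0 : rV_measurable set0.
Proof. exact: sigma_algebra0. Qed.

Let rV_measurableC A : rV_measurable A -> rV_measurable (~` A).
Proof. exact: sigma_algebraC. Qed.

Let rV_measurable_bigcup (F : _^nat) : (forall i, rV_measurable (F i)) ->
  rV_measurable (\bigcup_i (F i)).
Proof. exact: sigma_algebra_bigcup. Qed.

HB.instance Definition _ := @isMeasurable.Build default_measure_display
  'rV[R]_n rV_measurable rV_measurable0 rV_measurableC rV_measurable_bigcup.

End rV_measurable.

Section rV_measurable_theory.
Context {R : realType}.

Lemma measurable_coord n (i : 'I_n) :
  measurable_fun [set: 'rV[R]_n] (fun x : 'rV[R]_n => x ord0 i).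
Proof.
move=> _ Y mY; rewrite setTI; apply: sub_sigma_algebra => /=.
rewrite -bigcup_seq/=; exists i => /=; first by rewrite mem_index_enum.
by exists Y => //; rewrite setTI.
Qed.

Lemma measurable_fun_rVP d (T : measurableType d) n (f : T -> 'rV[R]_n) :
  (forall i, measurable_fun setT (fun t => f t ord0 i)) ->
  measurable_fun setT f.
Proof.
move=> mf _ Y mY; rewrite setTI.
have : <<s \big[setU/set0]_(i < n) preimage_set_system setT
   (fun x : 'rV[R]_n => x ord0 i) measurable >> `<=` [set A | measurable (f @^-1` A)].
  apply: smallest_sub.
    split => /=.
    - by rewrite preimage_set0.
    - by move=> A mA; rewrite setTD preimage_setC; exact: measurableC.
    - by move=> F mF; rewrite preimage_bigcup; exact: bigcup_measurable.
  move=> A; rewrite -bigcup_seq => -[i _ [B mB <-]] /=.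
  by rewrite setTI -comp_preimage -[X in measurable X]setTI; exact: mf.
exact.
Qed.

Lemma open_measurable_rV n (U : set 'rV[R]_n) : open U -> measurable U.
Proof.
move=> oU.
pose B (q : 'rV[rat]_n) (k : nat) : set 'rV[R]_n :=
  [set x | forall i, ball (ratr (q ord0 i) : R) (k.+1%:R^-1) (x ord0 i)].
have mB q k : measurable (B q k).
  have -> : B q k = \bigcap_(i in [set: 'I_n])
     ((fun x : 'rV[R]_n => x ord0 i) @^-1` ball (ratr (q ord0 i) : R) (k.+1%:R^-1)).
    by apply/seteqP; split => x /= h i; [move=> _|]; exact: h.
  rewrite -[X in measurable X]setCK setC_bigcap; apply: measurableC.
  apply: fin_bigcup_measurable => // i _; apply: measurableC.
  rewrite -[X in measurable X]setTI.
  by apply: measurable_coord => //; rewrite ball_itv; exact: measurable_itv.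
have -> : U = \bigcup_(qk in [set qk : 'rV[rat]_n * nat | B qk.1 qk.2 `<=` U])
   B qk.1 qk.2.
  apply/seteqP; split; last by move=> x [qk /= sub]; exact: sub.
  move=> x Ux.
  have /nbhs_ballP[e /= e0 eU] : nbhs x U by exact: open_nbhs_nbhs.
  have [k ke] : exists k : nat, k.+1%:R^-1 < e / 2.
    have e20 : 0 < e / 2 by rewrite divr_gt0.
    have [k _ /(_ k (leqnn k)) ?] := near_infty_natSinv_lt (PosNum e20).
    by exists k.
  have k0 : 0 < k.+1%:R^-1 :> R by rewrite invr_gt0.
  have /choice[q hq] : forall i, exists q : rat, ball (x ord0 i) (k.+1%:R^-1) (ratr q : R).
    move=> i.
    have [q /itvP qI] : exists q : rat,
       ratr q \in `]x ord0 i - k.+1%:R^-1, x ord0 i + k.+1%:R^-1[.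
      by apply: rat_in_itvoo; rewrite ltrD2l; exact: lt_trans k0; rewrite oppr_lt0.
    exists q; rewrite /ball /= ltr_distlC.
    by rewrite !qI.
  exists (\row_i q i, k).
    move=> y /= hy; apply: eU; split=> // i j; rewrite (ord1 i).
    have := hy j; rewrite mxE => h1.
    rewrite (splitr e); apply: (ball_triangle (y := (ratr (q j) : R))).
      exact: (le_ball (ltW ke)) (hq j).
    exact: (le_ball (ltW ke)) h1.
  by move=> i /=; rewrite mxE; apply: ball_sym; exact: hq.
rewrite bigcup_mkcond.
apply: countable_bigcupT_measurable => [|qk]; first exact: countableP.
by case: ifPn.
Qed.

Definition rV_cons n (z : R * 'rV[R]_n) : 'rV[R]_n.+1 :=
  \row_i oapp (z.2 ord0) z.1 (unlift ord0 i).

Lemma measurable_rV_cons n : measurable_fun setT (@rV_cons n).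
Proof.
apply: measurable_fun_rVP => i.
under eq_fun do rewrite mxE.
case: unliftP => [j _|_] /=.
  apply: (measurableT_comp (measurable_coord j)); exact: measurable_snd.
exact: measurable_fst.
Qed.

HB.instance Definition _ n :=
  @isMeasurableFun.Build _ _ _ _ (@rV_cons n) (@measurable_rV_cons n).

End rV_measurable_theory.

Section lebesgue_rV.
Local Open Scope ereal_scope.
Context {R : realType}.

Section step.
Variables (n : nat) (m : {sigma_finite_measure set 'rV[R]_n -> \bar R}).

Definition lebesgue_rV_step : set 'rV[R]_n.+1 -> \bar R :=
  pushforward (lebesgue_measure \x m) (@rV_cons R n).

Let step0 : lebesgue_rV_step set0 = 0.
Proof. by rewrite /lebesgue_rV_step /pushforward preimage_set0 measure0. Qed.

Let mpre A : measurable A -> measurable (@rV_cons R n @^-1` A).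
Proof.
by move=> mA; rewrite -[X in measurable X]setTI; exact: measurable_rV_cons.
Qed.

Let step_ge0 A : 0 <= lebesgue_rV_step A.
Proof. by rewrite /lebesgue_rV_step /pushforward; exact: measure_ge0. Qed.

Let step_sigma_additive : semi_sigma_additive lebesgue_rV_step.
Proof.
move=> F mF tF mUF; rewrite /lebesgue_rV_step /pushforward preimage_bigcup.
apply: measure_semi_sigma_additive.
- by move=> k; exact: mpre.
- apply/trivIsetP => /= i j _ _ ij; rewrite -preimage_setI.
  by move/trivIsetP : tF => /(_ _ _ _ _ ij) ->//; rewrite preimage_set0.
- by rewrite -preimage_bigcup; exact: mpre.
Qed.

HB.instance Definition _ := isMeasure.Build _ _ _
  lebesgue_rV_step step0 step_ge0 step_sigma_additive.

Let step_sigma_finite : sigma_finite setT lebesgue_rV_step.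
Proof.
have /sigma_finiteP[F [TF ndF Foo]] := sigma_finiteT (@lebesgue_measure R).
have /sigma_finiteP[G [TG ndG Goo]] := sigma_finiteT m.
pose tl (x : 'rV[R]_n.+1) : R * 'rV[R]_n :=
  (x ord0 ord0, \row_j x ord0 (lift ord0 j)).
have tlK : cancel (@rV_cons R n) tl.
  move=> [a v]; rewrite /tl /rV_cons /= mxE unlift_none /=; congr pair.
  by apply/rowP => j; rewrite !mxE liftK.
have mtl : measurable_fun setT tl.
  apply: measurable_fun_pair; first exact: measurable_coord.
  apply: measurable_fun_rVP => j /=; under eq_fun do rewrite mxE.
  exact: measurable_coord.
exists (fun k => tl @^-1` (F k `*` G k)).
  rewrite -preimage_bigcup (_ : \bigcup_k (F k `*` G k) = setT)// -setXTT TF TG.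
  apply/seteqP; split=> [[x y] [k _ []]|[x y] [/= [i _ Fx] [j _ Gy]]].
    by move=> ? ?; split; exists k.
  exists (maxn i j) => //; split.
  - by move: x Fx; exact/subsetPset/ndF/leq_maxl.
  - by move: y Gy; exact/subsetPset/ndG/leq_maxr.
move=> k; have [mF Fk] := Foo k; have [mG Gk] := Goo k; split.
  by rewrite -[X in measurable X]setTI; apply: mtl => //; exact: measurableX.
rewrite /lebesgue_rV_step /pushforward -comp_preimage.
rewrite (_ : tl \o @rV_cons R n = id); last by apply/funext => z; exact: tlK.
by rewrite preimage_id product_measure1E// lte_mul_pinfty// ge0_fin_numE.
Qed.

HB.instance Definition _ := Measure_isSigmaFinite.Build _ _ _
  lebesgue_rV_step step_sigma_finite.

End step.

(* lambda_(k+1) is the image of lambda_1 \x lambda_k under R * R^k ~ R^(k+1);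
   [lebesgue_rV_box] gives its value on boxes. *)
Fixpoint lebesgue_rV (n : nat) : {sigma_finite_measure set 'rV[R]_n -> \bar R} :=
  match n with
  | 0 => \d_(0%R : 'rV[R]_0)
  | k.+1 => lebesgue_rV_step (lebesgue_rV k)
  end.

Lemma lebesgue_rV_box n (a b : 'rV[R]_n) : (forall i, a ord0 i <= b ord0 i)%R ->
  lebesgue_rV n [set x | forall i, x ord0 i \in `]a ord0 i, b ord0 i]] =
  (\prod_(i < n) (b ord0 i - a ord0 i))%:E.
Proof.
elim: n a b => [a b _|n IH a b ab] /=.
  rewrite big_ord0 diracE mem_set//; by case.
rewrite /lebesgue_rV_step /pushforward.
pose a' : 'rV[R]_n := \row_j a ord0 (lift ord0 j).
pose b' : 'rV[R]_n := \row_j b ord0 (lift ord0 j).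
transitivity ((lebesgue_measure \x lebesgue_rV n)
    (`]a ord0 ord0, b ord0 ord0]%classic `*`
     [set x : 'rV[R]_n | forall i, x ord0 i \in `]a' ord0 i, b' ord0 i]])).
  congr product_measure1.
  apply/seteqP; split => [[x y] /= h|[x y] /= [hx hy] i].
    split; first by have := h ord0; rewrite mxE unlift_none.
    by move=> i; have := h (lift ord0 i); rewrite !mxE liftK.
  rewrite mxE; case: unliftP => [j ->|->] //=.
  by have := hy j; rewrite !mxE.
rewrite product_measure1E//; last first.
  rewrite (_ : mkset _ = \bigcap_(i in [set: 'I_n])
     ((fun x : 'rV[R]_n => x ord0 i) @^-1` `]a' ord0 i, b' ord0 i]%classic)); last first.
    by apply/seteqP; split => x /= h i; [move=> _|]; exact: h.
  rewrite -[X in measurable X]setCK setC_bigcap; apply: measurableC.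
  apply: fin_bigcup_measurable => // i _; apply: measurableC.
  rewrite -[X in measurable X]setTI.
  by apply: measurable_coord => //; exact: measurable_itv.
rewrite IH; last by move=> i; rewrite !mxE.
rewrite big_ord_recl.
have := lebesgue_measure_itv `]a ord0 ord0, b ord0 ord0].
rewrite /= lte_fin => ->.
under eq_bigr do rewrite !mxE.
rewrite EFinM; congr (_ * _).
case: ltP => // ba.
have /le_anti -> : (b ord0 ord0 <= a ord0 ord0 <= b ord0 ord0)%R by rewrite ba ab.
by rewrite subrr.
Qed.

End lebesgue_rV.

Section nonlocal_evolution.
Context {R : realType} {N : nat}.
Implicit Types (A Omega OmegaE : set 'rV[R]_N) (J v : 'rV[R]_N -> R).

Definition bounded_domain A : Prop :=
  [/\ open A, connected A, bounded_set A & A !=set0].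

Definition supp J : set 'rV[R]_N := closure [set z | J z != 0].

(* The norm of the library on ['rV[R]_N] is the sup norm, hence the explicit
   squared Euclidean norm. *)
Definition radial J : Prop :=
  forall x y : 'rV[R]_N,
    \sum_i x ord0 i ^+ 2 = \sum_i y ord0 i ^+ 2 -> J x = J y.

Definition admissible_kernel J : Prop :=
  [/\ forall z, 0 <= J z, continuous J, radial J, compact (supp J) &
      exists z, J z != 0].

Definition nonlocal_laplacian J OmegaE v (x : 'rV[R]_N) : R :=
  \int[lebesgue_rV N]_(y in OmegaE) (J (x - y) * (v y - v x)).

(* |Delta u~|^{p-2} Delta u~, where u~ is the extension of u by zero outside
   Omega; at p = 2 the first factor is 1 since 0 `^ 0 = 1. *)
Definition nonlocal_flux (p : R) J Omega OmegaE (u : 'rV[R]_N -> R) x : R :=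
  let g := nonlocal_laplacian J OmegaE (u \_ Omega) x in
  `|g| `^ (p - 2) * g.

Definition in_Lp (p : R) A v : Prop :=
  (v \_ A) \in Lfun (lebesgue_rV N) p%:E.

Definition cylinder (T : R) Omega : set (R * 'rV[R]_N) :=
  `]0, T[%classic `*` Omega.

(* u belongs to C([0, T]; L^2(Omega)); joint measurability selects a
   representative which is a function of (t, x). *)
Definition continuous_in_L2 (T : R) Omega (u : R -> 'rV[R]_N -> R) : Prop :=
  [/\ measurable_fun (`[0, T]%classic `*` Omega) (fun z => u z.1 z.2),
      forall t : R, t \in `[0, T] -> in_Lp 2 Omega (u t) &
      forall t : R, t \in `[0, T] ->
        'N[lebesgue_rV N]_2%:E[EFin \o ((u s \- u t)%R \_ Omega)]%E
          @[s --> within `[0, T] (nbhs t)] --> 0%E].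

(* eta belongs to C_c^oo(]0, T[) *)
Definition test_function (T : R) (eta : R -> R) : Prop :=
  (forall k (t : R), derivable (derive1n k eta) t 1) /\
  (exists a b : R, [/\ 0 < a, b < T & forall t : R, t \notin `[a, b] -> eta t = 0]).

(* v is the weak derivative of the L^2(Omega)-valued function u on ]0, T[:
   int eta' u dt = - int eta v dt in L^2(Omega) for every test function eta *)
Definition weak_time_derivative (T : R) Omega (u v : R -> 'rV[R]_N -> R) : Prop :=
  forall eta, test_function T eta ->
    {ae lebesgue_rV N, forall x, Omega x ->
      \int[lebesgue_measure]_(t in `]0, T[) (derive1 eta t * u t x) =
      - \int[lebesgue_measure]_(t in `]0, T[) (eta t * v t x)}.

(* The flux has to be integrable for its nonlocal Laplacian to be defined (as
   a Lebesgue integral); u t being merely in L^2(Omega) does not entail this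
   when p > 3. *)
Definition solution_on (T p : R) J Omega OmegaE (u0 : 'rV[R]_N -> R)
    (u : R -> 'rV[R]_N -> R) : Prop :=
  let flux t := nonlocal_flux p J Omega OmegaE (u t) in
  [/\ continuous_in_L2 T Omega u,
      {ae lebesgue_rV N, forall x, Omega x -> u 0 x = u0 x},
      {ae lebesgue_measure, forall t : R, t \in `]0, T[ ->
        (lebesgue_rV N).-integrable OmegaE (EFin \o flux t)} &
      exists v : R -> 'rV[R]_N -> R,
      [/\ ((fun z => v z.1 z.2) \_ (cylinder T Omega)) \in
            Lfun (lebesgue_measure \x lebesgue_rV N)%E 2%:E,
          weak_time_derivative T Omega u v &
          {ae (lebesgue_measure \x lebesgue_rV N)%E, forall z,
            cylinder T Omega z ->
            v z.1 z.2 = - nonlocal_laplacian J OmegaE (flux z.1) z.2}]].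

End nonlocal_evolution.

(* Main.v *)
Require Import Defs.
From mathcomp Require Import all_boot all_order all_algebra.
From mathcomp Require Import all_classical all_reals all_analysis.
From mathcomp Require Import measurable_realfun lra ring.

Set Implicit Arguments.
Unset Strict Implicit.
Unset Printing Implicit Defensive.
Import Order.TTheory GRing.Theory Num.Theory.
Import numFieldNormedType.Exports.
Local Open Scope classical_set_scope.
Local Open Scope ring_scope.

(* Write [g] for the nonlocal Laplacian of the extension of [u] by zero. Testing
   the equation against [u] and using the symmetry of the kernel gives
   d/dt ||u||^2 = - 2 \int |g|^p, where the flux |g|^(p-2) g, a priori only
   integrable, turns out to be square integrable on Omega because the equation
   expresses (J * 1) |g|^(p-2) g by a bounded function and du/dt. The right-hand
   side is controlled by a nonlocal Poincare inequality: for [h] in the support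
   of [J], the progression x, x - h, x - 2 h, ... leaves Omega after a bounded
   number of steps, all of them inside Omega_E, so that the zero boundary values
   bound [u x] by a sum of increments along [h]. As
   |g|^p >= th^(p-2) (g^2 - th^2) for every th > 0, choosing th^2 proportional to
   ||u||^2 yields d/dt ||u||^2 <= - c (||u||^2)^(p/2), and the decay follows by
   comparison with the corresponding ordinary differential equation. *)

(** The obstacle is regularity in time: only a weak derivative in L^2 of space-time is given, so the
    chain rule for the squared norm has to be derived. Pairing with a fixed [w] reduces the weak
    derivative to a scalar one, whose increments are integrals. The increment of ||U||^2 from s to t
    is such a pairing with the fixed function U t + U s; on a short interval, continuity in L^2 lets
    2 U r replace it for every intermediate r, up to e times the integral of a fixed integrable
    function. These local estimates are chained over the whole interval, and then e tends to 0. The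
    energy inequality is therefore obtained in integrated form, with the energy at the later time on
    its right-hand side, and the comparison with the differential equation works directly on such
    finite differences. All constants are chosen before the solution and the horizon T, so the
    solutions on the intervals [0, T] give one estimate valid for all times. *)

(** * Integrals of real-valued functions *)

Section Rintegral_extra.
Context d (T : measurableType d) {R : realType} (mu : {measure set T -> \bar R}).
Implicit Types (f g : T -> R).

Lemma integrableDS (D : set T) f g : measurable D ->
  mu.-integrable D (EFin \o f) -> mu.-integrable D (EFin \o g) ->
  mu.-integrable D (EFin \o (fun x => f x + g x)).
Proof. by move=> mD fi gi; exact: (integrableD mD fi gi). Qed.

Lemma integrableZlS (D : set T) c f : measurable D ->
  mu.-integrable D (EFin \o f) ->
  mu.-integrable D (EFin \o (fun x => c * f x)).
Proof. by move=> mD fi; exact: (integrableZl mD c fi). Qed.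

Lemma integrableDr f g : mu.-integrable setT (EFin \o f) ->
  mu.-integrable setT (EFin \o g) ->
  mu.-integrable setT (EFin \o (fun x => f x + g x)).
Proof. exact: integrableDS. Qed.

Lemma integrableBr f g : mu.-integrable setT (EFin \o f) ->
  mu.-integrable setT (EFin \o g) ->
  mu.-integrable setT (EFin \o (fun x => f x - g x)).
Proof. by move=> fi gi; exact: (integrableB measurableT fi gi). Qed.

Lemma integrableZlr c f : mu.-integrable setT (EFin \o f) ->
  mu.-integrable setT (EFin \o (fun x => c * f x)).
Proof. exact: integrableZlS. Qed.

Lemma ae_Rintegral f g :
  measurable_fun setT f -> measurable_fun setT g ->
  {ae mu, forall x, f x = g x} -> \int[mu]_x f x = \int[mu]_x g x.
Proof.
move=> mf mg fg; congr fine; apply: ae_eq_integral => //.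
- exact/measurable_EFinP.
- exact/measurable_EFinP.
- by apply: filterS fg => x -> _.
Qed.

Lemma ae_integrable f g :
  measurable_fun setT g -> {ae mu, forall x, f x = g x} ->
  mu.-integrable setT (EFin \o f) -> mu.-integrable setT (EFin \o g).
Proof.
move=> mg fg /integrableP[mf fi]; apply/integrableP; split.
  exact/measurable_EFinP.
apply: le_lt_trans fi; rewrite le_eqVlt; apply/orP; left; apply/eqP.
apply: ge0_ae_eq_integral => //.
- exact: measurableT_comp (measurableT_comp _ mg).
- exact: measurableT_comp.
- by apply: filterS fg => x /= -> _.
Qed.

Lemma integrable_le f g : measurable_fun setT f ->
  (forall x, `|f x| <= g x) ->
  mu.-integrable setT (EFin \o g) -> mu.-integrable setT (EFin \o f).
Proof.
move=> mf fg; apply: le_integrable => //; first exact/measurable_EFinP.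
by move=> x _ /=; rewrite lee_fin (le_trans (fg x))// ler_norm.
Qed.

Lemma integrable_leS (D : set T) f g : measurable D -> measurable_fun D f ->
  (forall x, D x -> `|f x| <= g x) ->
  mu.-integrable D (EFin \o g) -> mu.-integrable D (EFin \o f).
Proof.
move=> mD mf fg; apply: le_integrable => //; first exact/measurable_EFinP.
by move=> x Dx /=; rewrite lee_fin (le_trans (fg _ Dx))// ler_norm.
Qed.

Lemma ae_le_Rintegral (D : set T) f g : measurable D ->
  mu.-integrable D (EFin \o f) -> mu.-integrable D (EFin \o g) ->
  {ae mu, forall x, D x -> f x <= g x} ->
  \int[mu]_(x in D) f x <= \int[mu]_(x in D) g x.
Proof.
move=> mD fi gi fg; rewrite -subr_ge0 -RintegralB//.
have mgf : measurable_fun D (fun x => g x - f x).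
  by apply: measurable_funB; apply/measurable_EFinP; exact: (measurable_int mu).
suff -> : \int[mu]_(x in D) (g x - f x) = \int[mu]_(x in D) `|g x - f x|.
  exact: Rintegral_ge0.
congr fine; apply: ae_eq_integral => //.
- exact/measurable_EFinP.
- by apply/measurable_EFinP; exact: measurableT_comp.
- by apply: filterS fg => x h Dx; rewrite ger0_norm// subr_ge0 h.
Qed.

Lemma integrable_ae_le f g : measurable_fun setT f ->
  {ae mu, forall x, `|f x| <= g x} ->
  mu.-integrable setT (EFin \o g) -> mu.-integrable setT (EFin \o f).
Proof.
move=> mf fg /integrableP[mg gi]; apply/integrableP; split.
  exact/measurable_EFinP.
apply: le_lt_trans gi; apply: ae_ge0_le_integral => //.
- by apply: measurableT_comp => //; exact/measurable_EFinP.
- exact: measurableT_comp.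
- by apply: filterS fg => x h _ /=; rewrite lee_fin (le_trans h)// ler_norm.
Qed.

Lemma integrable_mul f g : measurable_fun setT f -> measurable_fun setT g ->
  mu.-integrable setT (EFin \o (fun x => f x ^+ 2)) ->
  mu.-integrable setT (EFin \o (fun x => g x ^+ 2)) ->
  mu.-integrable setT (EFin \o (fun x => f x * g x)).
Proof.
move=> mf mg f2 g2.
apply: (@integrable_le _ (fun x => f x ^+ 2 + g x ^+ 2)).
- exact: measurable_funM.
- move=> x; rewrite normrM.
  rewrite -(real_normK (num_real (f x))) -(real_normK (num_real (g x))).
  move: `|f x| (normr_ge0 (f x)) `|g x| (normr_ge0 (g x)) => a a0 b b0.
  by have := sqr_ge0 (a - b); rewrite sqrrB; nra.
- exact: integrableDr.
Qed.

Lemma integrable_sqrD f g : measurable_fun setT f -> measurable_fun setT g ->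
  mu.-integrable setT (EFin \o (fun x => f x ^+ 2)) ->
  mu.-integrable setT (EFin \o (fun x => g x ^+ 2)) ->
  mu.-integrable setT (EFin \o (fun x => (f x + g x) ^+ 2)).
Proof.
move=> mf mg f2 g2.
apply: (@integrable_le _ (fun x => 2 * f x ^+ 2 + 2 * g x ^+ 2)).
- exact/measurable_funX/measurable_funD.
- move=> x; rewrite ger0_norm ?sqr_ge0//.
  by have := sqr_ge0 (f x - g x); rewrite sqrrB sqrrD; nra.
- by apply: integrableDr; exact: integrableZlr.
Qed.

End Rintegral_extra.

Section finite_extra.
Context d (T : measurableType d) {R : realType} (mu : {finite_measure set T -> \bar R}).

Lemma integrable_sqr (f : T -> R) : measurable_fun setT f ->
  mu.-integrable setT (EFin \o (fun x => f x ^+ 2)) ->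
  mu.-integrable setT (EFin \o f).
Proof.
move=> mf f2.
apply: (@integrable_le _ _ _ _ _ (fun x => 1 + f x ^+ 2)) => //.
- move=> x; rewrite -(real_normK (num_real (f x))).
  by have := sqr_ge0 (`|f x| - 1); rewrite sqrrB; nra.
- by apply: integrableDr => //; exact: finite_measure_integrable_cst.
Qed.

End finite_extra.

(** * Fubini's theorem for real-valued integrals *)

Section Rintegral_Fubini.
Context d1 d2 (T1 : measurableType d1) (T2 : measurableType d2) {R : realType}.
Variables (m1 : {sigma_finite_measure set T1 -> \bar R})
          (m2 : {sigma_finite_measure set T2 -> \bar R}).
Local Notation m := (m1 \x m2)%E.

Lemma integrable_prod (f : T1 -> R) (g : T2 -> R) :
  m1.-integrable setT (EFin \o f) -> m2.-integrable setT (EFin \o g) ->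
  m.-integrable setT (EFin \o (fun z => f z.1 * g z.2)).
Proof.
move=> fi gi.
have mf : measurable_fun setT f by exact/measurable_EFinP/(measurable_int m1).
have mg : measurable_fun setT g by exact/measurable_EFinP/(measurable_int m2).
apply/integrable12ltyP => /=.
  apply/measurable_EFinP; apply: measurable_funM.
    exact: (measurableT_comp mf).
  exact: (measurableT_comp mg).
under eq_integral => x _.
  under eq_integral => y _ do rewrite normrM EFinM.
  rewrite ge0_integralZl//; last first.
    by apply/measurable_EFinP; exact: measurableT_comp.
  over.
have /integrableP[_ fy] := fi; have /integrableP[_ gy] := gi.
rewrite ge0_integralZr//.
- apply: lte_mul_pinfty => //; first exact: integral_ge0.
  by rewrite ge0_fin_numE//; exact: integral_ge0.
- by apply/measurable_EFinP; exact: measurableT_comp.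
- exact: integral_ge0.
Qed.

Lemma Rintegral_Fubini1 (F : T1 * T2 -> R) : m.-integrable setT (EFin \o F) ->
  m1.-integrable setT (EFin \o (fun x => \int[m2]_y F (x, y))) /\
  \int[m1]_x \int[m2]_y F (x, y) = \int[m]_z F z.
Proof.
move=> Fi; have Fm := measurable_fubini_F Fi.
have mR : measurable_fun setT (fun x => \int[m2]_y F (x, y)).
  exact: measurableT_comp Fm.
(* The real inner integral is [fine] of the extended one; the two agree where the section is
   integrable, hence almost everywhere. *)
have H : {ae m1, forall x,
    (\int[m2]_y F (x, y))%:E = fubini_F m2 (EFin \o F) x}.
  apply: filterS (ae_integrable1 Fi) => x xi.
  by rewrite fineK// integrable_fin_num.
split.
  have /integrableP[m i] := integrable_fubini_F Fi.
  apply/integrableP; split; first exact/measurable_EFinP.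
  apply: le_lt_trans i; rewrite le_eqVlt; apply/orP; left; apply/eqP.
  apply: ge0_ae_eq_integral => //.
  - by apply: measurableT_comp => //; exact: measurableT_comp.
  - exact: measurableT_comp.
  - apply: filterS H => x h _; congr abse; exact: h.
rewrite {3}/Rintegral -integral12_prod_meas1//; congr fine.
apply: ae_eq_integral => //; first exact/measurable_EFinP.
by apply: filterS H => x h _; exact: h.
Qed.

End Rintegral_Fubini.

Section Rintegral_Fubini2.
Context d1 d2 (T1 : measurableType d1) (T2 : measurableType d2) {R : realType}.
Variables (m1 : {sigma_finite_measure set T1 -> \bar R})
          (m2 : {sigma_finite_measure set T2 -> \bar R}).
Local Notation m := (m1 \x m2)%E.

Lemma Rintegral_Fubini2 (F : T1 * T2 -> R) : m.-integrable setT (EFin \o F) ->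
  m2.-integrable setT (EFin \o (fun y => \int[m1]_x F (x, y))) /\
  \int[m2]_y \int[m1]_x F (x, y) = \int[m]_z F z.
Proof.
move=> Fi; have mF := measurable_int _ Fi.
have mFs : measurable_fun setT (EFin \o (F \o (fun z : T2 * T1 => (z.2, z.1)))).
  apply: (measurableT_comp mF (g := fun z : T2 * T1 => (z.2, z.1))).
  exact: measurable_swap.
have Fsi : (m2 \x m1)%E.-integrable setT (EFin \o (F \o (fun z : T2 * T1 => (z.2, z.1)))).
  by apply/(integrable12ltyP _ _ mFs); exact: (integrable21ltyP _ _ mF).1 Fi.
have [h1 h2] := Rintegral_Fubini1 Fsi.
split; first exact: h1.
rewrite h2 /Rintegral; congr fine.
by rewrite -(integral12_prod_meas1 Fsi) -(integral21_prod_meas1 Fi).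
Qed.

End Rintegral_Fubini2.

(** * Restriction of a measure to a measurable set *)

Section restriction.
Context d (T : measurableType d) {R : realType} (mu : {measure set T -> \bar R}).
Variables (D : set T) (mD : measurable D).

(** Restricting the measure turns integrals over [D] into integrals over the whole space, the form
    in which the product and finite-measure lemmas are stated. *)
Lemma integral_mrestr (f : T -> \bar R) : measurable_fun setT f ->
  (\int[mrestr mu mD]_x f x = \int[mu]_(x in D) f x)%E.
Proof.
move=> mf.
transitivity (\int[mrestr mu mD]_(x in D) f x)%E.
  rewrite [RHS]integral_mkcond; apply: ae_eq_integral => //.
    by apply/measurable_restrict => //; rewrite setTI; exact: measurable_funTS.
  exists (~` D); split; first exact: measurableC.
    by rewrite /= /mrestr setICl measure0.
  move=> x /= h Dx; apply: h => _; by rewrite patchE mem_set.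
by apply: eq_measure_integral => A mA AD; rewrite /= /mrestr setIidl.
Qed.

Lemma integrable_mrestr (f : T -> \bar R) : measurable_fun setT f ->
  (mrestr mu mD).-integrable setT f <-> mu.-integrable D f.
Proof.
move=> mf; split => /integrableP[m i]; apply/integrableP; split => //.
- exact: measurable_funTS.
- by rewrite -integral_mrestr//; exact: measurableT_comp.
- by rewrite integral_mrestr//; exact: measurableT_comp.
Qed.

Lemma ae_mrestr (P : T -> Prop) :
  {ae mu, forall x, D x -> P x} -> {ae mrestr mu mD, forall x, P x}.
Proof.
(* The complement of [D] can be added to the exceptional set because the restricted measure does not
   charge it. *)
move=> [A [mA A0 sub]]; exists (A `|` ~` D); split.
- by apply: measurableU => //; exact: measurableC.
- rewrite /= /mrestr setIUl setICl setU0.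
  by apply: subset_measure0 A0 => //; exact: measurableI.
- move=> x /= nP; have [Dx|] := pselect (D x); [left|by right].
  by apply: sub => /= /(_ Dx).
Qed.

Lemma ae_mrestrW (P : T -> Prop) :
  {ae mrestr mu mD, forall x, P x} -> {ae mu, forall x, D x -> P x}.
Proof.
move=> [A [mA A0 sub]]; exists (A `&` D); split => //.
- exact: measurableI.
- by move=> x /= /not_implyP[Dx nP]; split => //; exact: sub.
Qed.

End restriction.

(** * Translations of the Lebesgue measure *)

Section rV_misc.
Context {R : realType}.

Lemma measurable_rVD d (T : measurableType d) n (f g : T -> 'rV[R]_n) :
  measurable_fun setT f -> measurable_fun setT g ->
  measurable_fun setT (fun x => f x + g x).
Proof.
move=> mf mg; apply: measurable_fun_rVP => i; under eq_fun do rewrite mxE.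
apply: measurable_funD.
  exact: (measurableT_comp (measurable_coord i)).
exact: (measurableT_comp (measurable_coord i)).
Qed.

Lemma measurable_rVZ d (T : measurableType d) n (f : T -> 'rV[R]_n) c :
  measurable_fun setT f -> measurable_fun setT (fun x => c *: f x).
Proof.
move=> mf; apply: measurable_fun_rVP => i; under eq_fun do rewrite mxE.
apply: measurable_funM => //.
exact: (measurableT_comp (measurable_coord i)).
Qed.

Lemma measurable_rV_continuous n (f : 'rV[R]_n -> R) :
  continuous f -> measurable_fun setT f.
Proof.
move=> /continuousP cf; apply: (measurability _ (RGenOpens.measurableE R)).
move=> _ [_ [a [b ->] <-]]; rewrite setTI; apply: open_measurable_rV.
exact/cf/interval_open.
Qed.

Definition shiftR (a x : R) : measurableTypeR R := x + a.

Lemma measurable_shiftR a : measurable_fun setT (shiftR a).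
Proof. by apply: measurable_funD. Qed.

(** Lebesgue measure is determined by its values on half-open intervals, whose length a translation
    preserves. *)
Lemma lebesgue_measure_shift a (A : set (measurableTypeR R)) : measurable A ->
  pushforward lebesgue_measure (shiftR a) A = lebesgue_measure A.
Proof.
move=> mA; apply/esym/lebesgue_measure_unique => //=.
  exact: measurable_shiftR.
move=> _ _ [[b c]] _ <-.
rewrite /pushforward.
have -> : shiftR a @^-1` `]b, c] = `]b - a, c - a]%classic.
  by apply/seteqP; split => x /=; rewrite /shiftR !in_itv/= ltrBlDr lerBrDr.
by rewrite !lebesgue_measure_itv/= !lte_fin ltrD2r; case: ifP => // _; congr EFin; ring.
Qed.

Definition shift_rV n (a x : 'rV[R]_n) : 'rV[R]_n := x + a.

Lemma measurable_shift_rV n (a : 'rV[R]_n) : measurable_fun setT (shift_rV a).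
Proof. by apply: measurable_rVD. Qed.

Definition shift_pair n (a : R) (b : 'rV[R]_n) (z : measurableTypeR R * 'rV[R]_n)
  : measurableTypeR R * 'rV[R]_n := (shiftR a z.1, shift_rV b z.2).

Lemma measurable_shift_pair n (a : R) (b : 'rV[R]_n) :
  measurable_fun setT (shift_pair a b).
Proof.
apply: measurable_fun_pair.
  exact: (measurableT_comp (measurable_shiftR a) measurable_fst).
exact: (measurableT_comp (measurable_shift_rV b) measurable_snd).
Qed.

(** Induction on the dimension: through [rV_cons], the translated product measure agrees with the
    product measure on rectangles, hence everywhere by uniqueness. *)
Lemma lebesgue_rV_shift n (a : 'rV[R]_n) (A : set 'rV[R]_n) : measurable A ->
  lebesgue_rV n (shift_rV a @^-1` A) = lebesgue_rV n A.
Proof.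
elim: n a A => [a A mA|n IH a A mA] /=.
  rewrite !diracE; congr (_%:R%:E); congr nat_of_bool.
  apply: asbool_equiv_eq; rewrite /shift_rV /=.
  by have -> : 0 + a = 0 by apply/rowP => -[].
rewrite /lebesgue_rV_step /pushforward.
have mB : measurable (@rV_cons R n @^-1` A).
  by rewrite -[X in measurable X]setTI; exact: measurable_rV_cons.
rewrite [RHS](@product_measure_unique _ _ _ _ _ _ _
  (pushforward (lebesgue_measure \x lebesgue_rV n)%E
    (shift_pair (a ord0 ord0) (\row_j a ord0 (lift ord0 j))))) //.
- exact: measurable_shift_pair.
- move=> mS; rewrite /= /pushforward.
  congr (product_measure1 _ _ _); apply/seteqP; split => -[x y] /=;
  (set u := (X in A X -> _); set v := (X in _ -> A X); suff -> : u = v by []);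
  apply/rowP => i; rewrite !mxE; case: unliftP => [j ->|->] //=; by rewrite !mxE.
move=> mS C D mC mD; rewrite /pushforward.
transitivity ((lebesgue_measure \x lebesgue_rV n)%E
  ((shiftR (a ord0 ord0) @^-1` C) `*` (shift_rV (\row_j a ord0 (lift ord0 j)) @^-1` D))) => //.
rewrite product_measure1E//.
- by rewrite IH//; congr (_ * _)%E; exact: lebesgue_measure_shift.
- by rewrite -[X in measurable X]setTI; exact: measurable_shiftR.
- by rewrite -[X in measurable X]setTI; exact: measurable_shift_rV.
Qed.

Lemma ge0_integral_shift n (a : 'rV[R]_n) (f : 'rV[R]_n -> \bar R) :
  measurable_fun setT f -> (forall x, 0 <= f x)%E ->
  (\int[lebesgue_rV n]_x f (x + a)%R = \int[lebesgue_rV n]_x f x)%E.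
Proof.
move=> mf f0.
rewrite -(@ge0_integral_pushforward _ _ _ _ _ (shift_rV a) (measurable_shift_rV a)
  (lebesgue_rV n) setT f)//.
apply: eq_measure_integral => [|mS A mA _]; first exact: measurable_shift_rV.
exact: lebesgue_rV_shift.
Qed.

End rV_misc.

(** * Symmetric kernel operators and dissipation *)

Section kernel_operator.
Context d (X : measurableType d) {R : realType}.
Variable nu : {finite_measure set X -> \bar R}.
Variables (k : X * X -> R) (M : R).
Hypotheses (mk : measurable_fun setT k) (k0 : forall z, 0 <= k z)
  (kM : forall z, k z <= M) (ksym : forall x y, k (x, y) = k (y, x)).
Implicit Types a b f g : X -> R.
Local Notation nn := (nu \x nu)%E.

Definition kernel_op a x := \int[nu]_y (k (x, y) * (a y - a x)).

(** The Dirichlet form of the operator, without the usual factor 1/2. *)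
Definition kernel_form a b :=
  \int[nn]_z (k z * ((a z.2 - a z.1) * (b z.2 - b z.1))).

Let meas_int a : nu.-integrable setT (EFin \o a) -> measurable_fun setT a.
Proof. by move=> ai; exact/measurable_EFinP/(measurable_int nu). Qed.

Let mkl x : measurable_fun setT (fun y => k (x, y)).
Proof. exact: (measurableT_comp mk). Qed.

Lemma kernel_integrable (h : X * X -> R) : nn.-integrable setT (EFin \o h) ->
  nn.-integrable setT (EFin \o (fun z => k z * h z)).
Proof.
move=> hi; apply: (@integrable_le _ _ _ _ _ (fun z => M * `|h z|)).
- apply: measurable_funM => //; apply/measurable_EFinP; exact: (measurable_int _ hi).
- by move=> z; rewrite normrM ger0_norm// ler_wpM2r.
- by apply: integrableZlr; exact: integrable_norm.
Qed.

Lemma kernel_integrable_section a x : nu.-integrable setT (EFin \o a) ->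
  nu.-integrable setT (EFin \o (fun y => k (x, y) * a y)).
Proof.
move=> ai; apply: (@integrable_le _ _ _ _ _ (fun z => M * `|a z|)).
- by apply: measurable_funM => //; exact: meas_int.
- by move=> z; rewrite normrM ger0_norm// ler_wpM2r.
- by apply: integrableZlr; exact: integrable_norm.
Qed.

Let cst_int (c : R) : nu.-integrable setT (EFin \o (fun=> c)).
Proof. exact: finite_measure_integrable_cst. Qed.

Lemma kernel_opE a x : nu.-integrable setT (EFin \o a) ->
  kernel_op a x = \int[nu]_y (k (x, y) * a y) - (\int[nu]_y k (x, y)) * a x.
Proof.
move=> ai; rewrite /kernel_op.
under eq_Rintegral do rewrite mulrBr.
rewrite RintegralB//; last 2 first.
- exact: kernel_integrable_section.
- exact: kernel_integrable_section (cst_int (a x)).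
congr (_ - _); rewrite RintegralZr//.
have := kernel_integrable_section x (cst_int 1).
by apply: eq_integrable => // y _ /=; rewrite mulr1.
Qed.

Lemma kernel_form_sym a b : kernel_form a b = kernel_form b a.
Proof. by apply: eq_Rintegral => z _; congr (_ * _); rewrite mulrC. Qed.

Section weak.
Variables a b : X -> R.
Hypotheses (ai : nu.-integrable setT (EFin \o a))
  (bi : nu.-integrable setT (EFin \o b))
  (abi : nu.-integrable setT (EFin \o (fun x => a x * b x))).

(** [H] is the integrand of b(x) times the operator applied to a, and [H'] is its image under the
    exchange of the two variables, so that [H + H'] is minus the integrand of the form.
    Integrability is asked of [a], [b] and their product, and not of squares, since the flux is a
    priori only integrable. *)
Let H z := k z * (a z.2 * b z.1) - k z * (a z.1 * b z.1).
Let H' z := k z * (a z.1 * b z.2) - k z * (a z.2 * b z.2).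

Let Hi : nn.-integrable setT (EFin \o H).
Proof.
apply: integrableBr; apply: kernel_integrable.
- have := integrable_prod bi ai.
  by apply: eq_integrable => // z _ /=; rewrite mulrC.
- have := integrable_prod abi (cst_int 1).
  by apply: eq_integrable => // z _ /=; rewrite mulr1.
Qed.

Let Hi' : nn.-integrable setT (EFin \o H').
Proof.
apply: integrableBr; apply: kernel_integrable.
- exact: integrable_prod.
- have := integrable_prod (cst_int 1) abi.
  by apply: eq_integrable => // z _ /=; rewrite mul1r.
Qed.

Let HE x : \int[nu]_y H (x, y) = b x * kernel_op a x.
Proof.
rewrite /kernel_op -RintegralZl//.
  by apply: eq_Rintegral => y _; rewrite /H/=; ring.
have := integrableBr (kernel_integrable_section x ai)
  (kernel_integrable_section x (cst_int (a x))).
by apply: eq_integrable => // y _ /=; rewrite mulrBr.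
Qed.

Lemma integrable_kernel_op_mul :
  nu.-integrable setT (EFin \o (fun x => b x * kernel_op a x)).
Proof.
have [+ _] := Rintegral_Fubini1 Hi.
by apply: eq_integrable => // x _ /=; rewrite HE.
Qed.

(** By Fubini and the symmetry of [k], the left-hand side is both the integral of [H] and that of
    [H'], hence half the integral of their sum. *)
Lemma kernel_op_weak :
  \int[nu]_x (b x * kernel_op a x) = - 2^-1 * kernel_form a b.
Proof.
have [_ h1] := Rintegral_Fubini1 Hi.
have [_ h2] := Rintegral_Fubini2 Hi'.
have {}h1 : \int[nu]_x (b x * kernel_op a x) = \int[nn]_z H z.
  by rewrite -h1; apply: eq_Rintegral => x _; rewrite HE.
have HE' y : \int[nu]_x H' (x, y) = b y * kernel_op a y.
  by rewrite -HE; apply: eq_Rintegral => x _; rewrite /H/H'/= ksym.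
have {}h2 : \int[nu]_x (b x * kernel_op a x) = \int[nn]_z H' z.
  by rewrite -h2; apply: eq_Rintegral => x _; rewrite HE'.
have -> : kernel_form a b = - (\int[nn]_z H z + \int[nn]_z H' z).
  rewrite -RintegralD// -mulN1r -RintegralZl//; last exact: integrableDr.
  by apply: eq_Rintegral => z _; rewrite /H /H'; ring.
by rewrite -h1 -h2; field.
Qed.

End weak.

Lemma integrable_kernel_op a : nu.-integrable setT (EFin \o a) ->
  nu.-integrable setT (EFin \o kernel_op a).
Proof.
move=> ai.
have ai1 : nu.-integrable setT (EFin \o (fun x => a x * 1)).
  by apply: eq_integrable ai => // x _ /=; rewrite mulr1.
have := integrable_kernel_op_mul ai (cst_int 1) ai1.
by apply: eq_integrable => // x _ /=; rewrite mul1r.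
Qed.

(** * Dissipation of the energy by the flux *)

Section dissipation.
Variables (p K0 : R) (O : set X) (a w : X -> R).
Hypotheses (p2 : 2 <= p) (K00 : 0 < K0) (mO : measurable O)
  (hK : forall x, O x -> K0 <= \int[nu]_y k (x, y))
  (ma : measurable_fun setT a)
  (a2 : nu.-integrable setT (EFin \o (fun x => a x ^+ 2)))
  (aO : forall x, ~ O x -> a x = 0).
Let f x := `|kernel_op a x| `^ (p - 2) * kernel_op a x.
Hypotheses (fi : nu.-integrable setT (EFin \o f))
  (mw : measurable_fun setT w)
  (w2 : nu.-integrable setT (EFin \o (fun x => w x ^+ 2)))
  (wf : {ae nu, forall x, O x -> w x = - kernel_op f x}).

Let ai : nu.-integrable setT (EFin \o a).
Proof. exact: integrable_sqr. Qed.

(* On [O] one has [(\int k(x, y) dy) f = \int k(x, y) f(y) dy + w], which is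
   square integrable although [f] is only known to be integrable. *)
Lemma integrable_flux_mul : nu.-integrable setT (EFin \o (fun x => f x * a x)).
Proof.
have mf := meas_int fi.
(* Bounds the integral of k(x, y) f(y) in y, uniformly in x. *)
pose B := M * \int[nu]_y `|f y|.
apply: (@integrable_ae_le _ _ _ _ _ (fun x => K0^-1 * (B * `|a x| + `|w x| * `|a x|))).
- exact: measurable_funM.
- apply: filterS wf => x wx.
  have [Ox|nOx] := pselect (O x); last first.
    by rewrite (aO nOx) mulr0 normr0 !mulr0 addr0 mulr0.
  rewrite ler_pdivlMl// -mulrDl normrM mulrA ler_wpM2r//.
  have KfE : (\int[nu]_y k (x, y)) * f x = \int[nu]_y (k (x, y) * f y) + w x.
    by rewrite wx// kernel_opE//; ring.
  rewrite (@le_trans _ _ `|(\int[nu]_y k (x, y)) * f x|)//.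
    by rewrite [leRHS]normrM ler_wpM2r// (le_trans (hK Ox))// ler_norm.
  rewrite KfE (le_trans (ler_normD _ _))// lerD2r.
  rewrite (le_trans (le_normr_Rintegral _ _))//.
    exact: kernel_integrable_section.
  rewrite /B -RintegralZl//; last exact: integrable_norm.
  apply: le_Rintegral => //.
  - by apply: integrable_norm; exact: kernel_integrable_section.
  - by apply: integrableZlr; exact: integrable_norm.
  - by move=> y _; rewrite normrM ger0_norm// ler_wpM2r.
- apply: integrableZlr; apply: integrableDr.
    by apply: integrableZlr; exact: integrable_norm.
  have := integrable_norm (integrable_mul mw ma w2 a2).
  by apply: eq_integrable => // x _ /=; rewrite normrM.
Qed.

Let afi : nu.-integrable setT (EFin \o (fun x => a x * f x)).
Proof. by apply: eq_integrable integrable_flux_mul => // x _ /=; rewrite mulrC. Qed.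

(** The equation for [w] holds only on [O], but [a] vanishes elsewhere; the symmetry of the form
    then moves the operator from [f] to [a]. *)
Lemma flux_duality : \int[nu]_x (w x * a x) = - \int[nu]_x (f x * kernel_op a x).
Proof.
have mf := meas_int fi.
rewrite (kernel_op_weak ai fi afi).
rewrite kernel_form_sym -(kernel_op_weak fi ai integrable_flux_mul).
have afi' := integrable_kernel_op_mul fi ai integrable_flux_mul.
transitivity (\int[nu]_x (-1 * (a x * kernel_op f x))).
  apply: ae_Rintegral.
  - exact: measurable_funM.
  - apply: measurable_funM => //; exact: (meas_int afi').
  - apply: filterS wf => x wx.
    have [Ox|nOx] := pselect (O x); first by rewrite wx//; ring.
    by rewrite (aO nOx) !(mulr0, mul0r).
by rewrite RintegralZl// mulN1r.
Qed.

Lemma flux_duality_le0 : \int[nu]_x (w x * a x) <= 0.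
Proof.
rewrite flux_duality oppr_le0; apply: Rintegral_ge0 => x _.
by rewrite /f -mulrA -expr2 mulr_ge0// ?powR_ge0// sqr_ge0.
Qed.

(** Besides the truncation at [th], the square (g + lam a)^2 >= 0 bounds g^2 below by - 2 lam a g -
    lam^2 a^2. Integrating, the coercivity hypothesis turns the first term into 2 lam^2 times the
    integral of a^2, half of which survives. *)
Lemma dissipation (th lam : R) : 0 < th -> 0 <= lam ->
  lam * (\int[nu]_x (a x ^+ 2)) <= - (\int[nu]_x (a x * kernel_op a x)) ->
  \int[nu]_x (w x * a x) <=
    - (th `^ (p - 2) * (lam ^+ 2 * (\int[nu]_x (a x ^+ 2)) - th ^+ 2 * fine (nu setT))).
Proof.
move=> th0 lam0 poin.
have aai : nu.-integrable setT (EFin \o (fun x => a x * a x)).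
  by apply: eq_integrable a2 => // x _ /=; rewrite expr2.
have agi := integrable_kernel_op_mul ai ai aai.
have fgi := integrable_kernel_op_mul ai fi afi.
rewrite flux_duality lerN2.
pose q x := th `^ (p - 2) *
  ((- (2 * lam)) * (a x * kernel_op a x) - lam ^+ 2 * a x ^+ 2 - th ^+ 2).
have qi1 : nu.-integrable setT (EFin \o
   (fun x => (- (2 * lam)) * (a x * kernel_op a x) - lam ^+ 2 * a x ^+ 2)).
  by apply: integrableBr; exact: integrableZlr.
have qi2 := integrableBr qi1 (cst_int (th ^+ 2)).
apply: (@le_trans _ _ (\int[nu]_x q x)).
  rewrite RintegralZl// ler_wpM2l ?powR_ge0//.
  rewrite RintegralB// Rintegral_cst// lerD2r.
  rewrite RintegralB//; try exact: integrableZlr.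
  rewrite !RintegralZl//.
  rewrite expr2; nra.
apply: le_Rintegral => //; first exact: integrableZlr.
move=> x _; rewrite /q /f -mulrA -expr2.
set g := kernel_op a x.
apply: (@le_trans _ _ (th `^ (p - 2) * (g ^+ 2 - th ^+ 2))).
  rewrite ler_wpM2l ?powR_ge0// lerD2r.
  by have := sqr_ge0 (g + lam * a x); rewrite sqrrD exprMn; nra.
(* Above the threshold the power is monotone; below it the left-hand side is nonpositive. *)
have [gth|gth] := leP th `|g|.
  apply: (@le_trans _ _ (th `^ (p - 2) * g ^+ 2)).
    by rewrite ler_wpM2l ?powR_ge0// gerDl oppr_le0 sqr_ge0.
  rewrite ler_wpM2r ?sqr_ge0//.
  by apply: ge0_ler_powR; rewrite ?nnegrE ?subr_ge0// ltW.
apply: (@le_trans _ _ 0).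
  rewrite mulr_ge0_le0 ?powR_ge0// subr_le0 -(real_normK (num_real g)).
  by rewrite lerXn2r ?nnegrE// ltW.
by rewrite mulr_ge0 ?powR_ge0 ?sqr_ge0.
Qed.

End dissipation.
End kernel_operator.

(** * The nonlocal Poincare inequality *)

Section lebesgue_rV_facts.
Context {R : realType} (N : nat).
Local Notation mu := (@lebesgue_rV R N).
Implicit Types x y h : 'rV[R]_N.

Lemma measurable_box (a b : 'rV[R]_N) :
  measurable [set x : 'rV[R]_N | forall i, x ord0 i \in `]a ord0 i, b ord0 i]].
Proof.
rewrite (_ : mkset _ = \bigcap_(i in [set: 'I_N])
   ((fun x : 'rV[R]_N => x ord0 i) @^-1` `]a ord0 i, b ord0 i]%classic)); last first.
  by apply/seteqP; split => x /= h i; [move=> _|]; exact: h.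
rewrite -[X in measurable X]setCK setC_bigcap; apply: measurableC.
apply: fin_bigcup_measurable => // i _; apply: measurableC.
rewrite -[X in measurable X]setTI.
by apply: measurable_coord => //; exact: measurable_itv.
Qed.

Lemma coord_le_norm x i : `|x ord0 i| <= `|x|.
Proof.
rewrite /Num.norm/= mx_normrE.
exact: (le_bigmax _ (fun ij => `|x ij.1 ij.2|) (ord0, i)).
Qed.

Lemma lebesgue_rV_bounded_lty (A : set 'rV[R]_N) : measurable A -> bounded_set A ->
  (mu A < +oo)%E.
Proof.
move=> mA [M [_ hM]].
pose c := `|M| + 1.
have c0 : 0 <= c by rewrite addr_ge0.
have Mc : M < c by rewrite (le_lt_trans (ler_norm M))// ltrDl.
(* The boxes are open on the left, hence the margin 1 in the lower corner. *)
pose a : 'rV[R]_N := const_mx (- (c + 1)); pose b : 'rV[R]_N := const_mx c.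
have sub : A `<=` [set x : 'rV[R]_N | forall i, x ord0 i \in `]a ord0 i, b ord0 i]].
  move=> x Ax i; rewrite !mxE in_itv/=.
  have := le_trans (coord_le_norm x i) (hM _ Mc x Ax).
  rewrite ler_norml => /andP[h ->]; rewrite andbT.
  by rewrite (lt_le_trans _ h)// ltrN2 ltrDl.
apply: (@le_lt_trans _ _ (mu [set x : 'rV[R]_N | forall i, x ord0 i \in `]a ord0 i, b ord0 i]])).
  by apply: le_measure => //; rewrite inE//; exact: measurable_box.
rewrite lebesgue_rV_box ?ltry// => i; rewrite !mxE; lra.
Qed.

Lemma lebesgue_rV_ball_gt0 y (r : R) : 0 < r ->
  exists2 c : R, 0 < c & (c%:E <= mu (ball y r))%E.
Proof.
move=> r0.
pose a : 'rV[R]_N := y - const_mx (r / 2); pose b : 'rV[R]_N := y + const_mx (r / 2).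
have ab i : a ord0 i <= b ord0 i by rewrite !mxE; lra.
exists (\prod_(i < N) (b ord0 i - a ord0 i)).
  by apply: prodr_gt0 => i _; rewrite !mxE; lra.
rewrite -lebesgue_rV_box//; apply: le_measure.
- by rewrite inE; exact: measurable_box.
- by rewrite inE; apply: open_measurable_rV; exact: ball_open.
move=> x /= hx; split => // i j; rewrite (ord1 i).
have := hx j; rewrite in_itv/= !mxE /ball/= => /andP[h1 h2].
by rewrite ltr_norml; apply/andP; split; lra.
Qed.

Definition sqnorm x := \sum_i x ord0 i ^+ 2.

Lemma sqnorm_ge0 x : 0 <= sqnorm x.
Proof. by apply: sumr_ge0 => i _; exact: sqr_ge0. Qed.

Lemma sqnormZ c x : sqnorm (c *: x) = c ^+ 2 * sqnorm x.
Proof. by rewrite /sqnorm mulr_sumr; apply: eq_bigr => i _; rewrite mxE exprMn. Qed.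

Lemma continuous_sqnorm : continuous sqnorm.
Proof.
suff H s : continuous (fun x : 'rV[R]_N => \sum_(i <- s) x ord0 i ^+ 2) by exact: H.
elim: s => [|i s IH] x.
  rewrite (_ : (fun _ => _) = cst (0 : R)); first exact: cst_continuous.
  by apply/funext => y; rewrite big_nil.
rewrite (_ : (fun _ => _) =
    (fun y : 'rV[R]_N => y ord0 i ^+ 2 + \sum_(j <- s) y ord0 j ^+ 2)); last first.
  by apply/funext => y; rewrite big_cons.
have h : {for x, continuous (fun y : 'rV[R]_N => y ord0 i)} by exact: coord_continuous.
exact: (continuousD (continuousM h h) (IH x)).
Qed.

Lemma sqnorm_le_norm x : sqnorm x <= N%:R * `|x| ^+ 2.
Proof.
apply: (@le_trans _ _ (\sum_(i < N) `|x| ^+ 2)).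
  apply: ler_sum => i _; rewrite -(real_normK (num_real _)) lerXn2r ?nnegrE//.
  exact: coord_le_norm.
by rewrite sumr_const card_ord mulr_natl.
Qed.

End lebesgue_rV_facts.

(** * Lower bound for the kernel mass inside the outer domain *)

Section kernel_lower_bound.
Context {R : realType} (N : nat).
Local Notation mu := (@lebesgue_rV R N).
Variables (O E : set 'rV[R]_N) (J : 'rV[R]_N -> R).
Hypotheses (N0 : (0 < N)%N) (bO : bounded_domain O) (bE : bounded_domain E)
  (aJ : admissible_kernel J) (OE : O `<=` E)
  (OJE : [set x + 2 *: z | x in O & z in supp J] `<=` E).

(** Short displacements are discarded because the number of steps that they need to leave [O] is not
    bounded. *)
Definition cut_kernel (sg : R) (h : 'rV[R]_N) : R := if sg <= sqnorm h then J h else 0.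

Let J0 z : 0 <= J z. Proof. by case: aJ. Qed.
Let cJ : continuous J. Proof. by case: aJ. Qed.
Let radJ x y : sqnorm x = sqnorm y -> J x = J y. Proof. by case: aJ => _ _ + _ _; exact. Qed.

Lemma kernel_supp z : J z != 0 -> supp J z.
Proof. by move=> Jz; apply: subset_closure. Qed.

(** If the given point where [J] is nonzero is the origin, continuity provides another one nearby,
    the dimension being positive. *)
Lemma kernel_nonzero : exists2 z0, 0 < sqnorm z0 & 0 < J z0.
Proof.
have [_ _ _ _ [z Jz]] := aJ.
have Jz0 : 0 < J z by rewrite lt_def Jz J0.
have [zs|] := ltP 0 (sqnorm z); first by exists z.
move=> z0; have {}z0 : sqnorm z = 0 by apply/eqP; rewrite eq_le z0 sqnorm_ge0.
have JE : J z = J 0.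
  by apply: radJ; rewrite z0 -(scale0r (0 : 'rV[R]_N)) sqnormZ expr0n mul0r.
have : J x @[x --> (0 : 'rV[R]_N)] --> J 0 by exact: cJ.
move/cvgrPdist_lt/(_ _ Jz0).
move=> /nbhs_ballP[e /= e0 he].
exists (const_mx (e / 2)).
  rewrite /sqnorm (eq_bigr (fun=> (e / 2) ^+ 2)); last by move=> i _; rewrite mxE.
  by rewrite sumr_const card_ord pmulrn_lgt0// exprn_gt0// divr_gt0.
have : ball (0 : 'rV[R]_N) e (const_mx (e / 2)).
  split => // i j; rewrite !mxE /ball/= sub0r normrN ger0_norm ?divr_ge0 ?(ltW e0)//.
  by rewrite ltr_pdivrMr// ltr_pMr// ltr1n.
move=> /he /=; rewrite JE => h.
have := le_lt_trans (ler_norm _) h; lra.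
Qed.

(** Intermediate values on the connected set [E]: the squared distance to [x] is small at a point of
    [O] close to [x], and close to 4 |z0|^2 at such a point translated by 2 z0. Radiality will make
    [J (y - x)] equal to [J z0]. Points of the closure are included with a view to compactness. *)
Lemma domain_meets_sphere (x : 'rV[R]_N) z0 : closure O x -> 0 < sqnorm z0 -> 0 < J z0 ->
  exists2 y, E y & sqnorm (y - x) = sqnorm z0.
Proof.
move=> cOx z00 Jz0.
have cid (y : 'rV[R]_N) : {for y, continuous (fun y : 'rV[R]_N => y)} by exact: cvg_id.
have ccst (y z : 'rV[R]_N) : {for y, continuous (fun _ : 'rV[R]_N => z)}.
  exact: cst_continuous.
have cq : continuous (fun y : 'rV[R]_N => sqnorm (y - x)).
  move=> y; apply: (@continuous_comp _ _ _ (fun y : 'rV[R]_N => y - x) (@sqnorm R N)).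
    exact: (continuousB (cid y) (ccst y x)).
  exact: continuous_sqnorm.
have cq2 : continuous (fun y : 'rV[R]_N => sqnorm (y + 2 *: z0 - x)).
  move=> y; apply: (@continuous_comp _ _ _ (fun y : 'rV[R]_N => y + 2 *: z0 - x) (@sqnorm R N)).
    exact: (continuousB (continuousD (cid y) (ccst y (2 *: z0))) (ccst y x)).
  exact: continuous_sqnorm.
have n1 : nbhs x [set y | sqnorm (y - x) < sqnorm z0].
  have : sqnorm (x - x) < sqnorm z0.
    by rewrite subrr -(scale0r (0 : 'rV[R]_N)) sqnormZ expr0n mul0r.
  by move=> h; have := cq x _ (lt_nbhsl h).
have n2 : nbhs x [set y | sqnorm z0 < sqnorm (y + 2 *: z0 - x)].
  have : sqnorm z0 < sqnorm (x + 2 *: z0 - x).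
    by rewrite addrAC subrr add0r sqnormZ; lra.
  by move=> h; have := cq2 x _ (lt_nbhsr h).
have [y1 [Oy1 q1]] := cOx _ n1.
have [y2 [Oy2 q2]] := cOx _ n2.
have Ey1 := OE Oy1.
have Ey2 : E (y2 + 2 *: z0).
  by apply: OJE; exists y2 => //; exists z0 => //; apply: kernel_supp; rewrite gt_eqF.
have [_ cE _ _] := bE.
have : connected [set sqnorm (y - x) | y in E].
  by apply: connected_continuous_connected => //; exact: continuous_subspaceT.
move/connected_intervalP/(_ (sqnorm (y1 - x)) (sqnorm (y2 + 2 *: z0 - x))).
move=> /(_ _ _ (sqnorm z0)) [|||y Ey yq]; last by exists y.
- by exists y1.
- by exists (y2 + 2 *: z0).
- by rewrite !ltW.
Qed.

Lemma measurable_cut_kernel sg : measurable_fun setT (cut_kernel sg).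
Proof.
rewrite /cut_kernel; apply: measurable_fun_ifT => //.
  apply: measurable_fun_ler => //.
  exact: measurable_rV_continuous (@continuous_sqnorm _ _).
exact: measurable_rV_continuous.
Qed.

Lemma cut_kernel_ge0 sg h : 0 <= cut_kernel sg h.
Proof. by rewrite /cut_kernel; case: ifP. Qed.

(** Around each point of the closure of [O] the bound holds locally, since a small ball of [E] sees
    that point through values of [J] above [J z0 / 2]. Compactness makes the constant uniform. *)
Lemma kernel_mass_lower_bound : exists sg k0 : R, [/\ 0 < sg, 0 < k0 &
  forall x, O x ->
    (k0%:E <= \int[mu]_h (cut_kernel sg h * \1_E (x + h))%:E)%E].
Proof.
have [z0 z00 Jz0] := kernel_nonzero.
(* Half the squared radius of the sphere, so that displacements close to the sphere survive the
   cutoff. *)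
pose sg := sqnorm z0 / 2.
have sg0 : 0 < sg by rewrite divr_gt0.
exists sg.
have [oO _ [M [Mreal hM]] _] := bO; have [oE _ _ _] := bE.
have mE : measurable E by exact: open_measurable_rV.
(* In the variable y = x + h the domain of integration no longer moves with [x]. *)
have KE x : (\int[mu]_h (cut_kernel sg h * \1_E (x + h))%:E =
    \int[mu]_y (cut_kernel sg (y - x) * \1_E y)%:E)%E.
  rewrite -(@ge0_integral_shift _ _ x (fun y => (cut_kernel sg (y - x) * \1_E y)%:E)).
  - by apply: eq_integral => h _; rewrite addrK addrC.
  - apply/measurable_EFinP; apply: measurable_funM; last exact: measurable_indic.
    apply: (measurableT_comp (measurable_cut_kernel sg)).
    exact: measurable_rVD.
  - by move=> y; rewrite lee_fin mulr_ge0 ?cut_kernel_ge0.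
have cpt : compact (closure O).
  apply: bounded_closed_compact; last exact: closed_closure.
  exists M; split => // c Mc x cOx.
  have clB : closed [set x : 'rV[R]_N | `|x| <= c].
    by apply: (closed_comp _ (@closed_le _ c)) => y _; exact: norm_continuous.
  move/closure_id : clB => clB.
  have : [set x : 'rV[R]_N | `|x| <= c] x; last by [].
  by rewrite clB; apply: closure_subset cOx => y Oy; exact: (hM _ Mc _ Oy).
(* The constant itself runs along the filter of positive reals tending to 0: a bound for all small
   [c] near each point becomes a bound for all small [c] on the whole compact set. *)
have /compact_near_coveringP/(_ R (0^'+) (fun c x =>
    (c%:E <= \int[mu]_h (cut_kernel sg h * \1_E (x + h))%:E)%E)) := cpt.
move=> [].
  move=> x cOx.
  have [y0 Ey0 yq] := domain_meets_sphere cOx z00 Jz0.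
  have JyE : J (y0 - x) = J z0 by exact: radJ.
  have n1 : nbhs (y0 - x) [set h | J z0 / 2 < J h /\ sg < sqnorm h].
    apply: filterI.
      have : J z0 / 2 < J (y0 - x) by rewrite JyE; lra.
      by move=> h; have := cJ (lt_nbhsr h).
    have : sg < sqnorm (y0 - x) by rewrite yq /sg; lra.
    by move=> h; have := continuous_sqnorm (lt_nbhsr h).
  have /nbhs_ballP[e /= e0 he] := n1.
  have /nbhs_ballP[e' /= e'0 he'] : nbhs y0 E by exact: open_nbhs_nbhs.
  (* Both [x] and [y0] get moved by less than [e / 2], so their difference moves by less than [e];
     [e'] keeps the ball in [E]. *)
  pose s := Num.min (e / 2) e'.
  have s0 : 0 < s by rewrite lt_min e'0 divr_gt0.
  have [c c0 hc] := lebesgue_rV_ball_gt0 y0 s0.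
  exists (ball x s, [set t | t < J z0 / 2 * c]).
    split; first exact: nbhsx_ballx.
    by apply: nbhs_right_lt; rewrite mulr_gt0// divr_gt0.
  move=> [x' t] /= [xx' tc].
  rewrite KE (@le_trans _ _ (\int[mu]_y ((J z0 / 2) * \1_(ball y0 s) y)%:E)%E)//.
    under eq_integral do rewrite EFinM.
    rewrite ge0_integralZl_EFin ?divr_ge0 ?(ltW Jz0)//; last first.
      by apply/measurable_EFinP; apply: measurable_indic; apply: open_measurable_rV; exact: ball_open.
    rewrite integral_indic//; last by apply: open_measurable_rV; exact: ball_open.
    rewrite setIT (@le_trans _ _ ((J z0 / 2)%:E * c%:E)%E)//.
      by rewrite -EFinM lee_fin ltW.
    by rewrite lee_wpmul2l// lee_fin divr_ge0// ltW.
  apply: ge0_le_integral => //.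
  - by move=> y _; rewrite lee_fin mulr_ge0// divr_ge0// ltW.
  - apply/measurable_EFinP; apply: measurable_funM => //.
    by apply: measurable_indic; apply: open_measurable_rV; exact: ball_open.
  - apply/measurable_EFinP; apply: measurable_funM; last exact: measurable_indic.
    apply: (measurableT_comp (measurable_cut_kernel sg)).
    exact: measurable_rVD.
  move=> y _; rewrite lee_fin !indicE.
  have [yb|nyb] := pselect (ball y0 s y); last first.
    by rewrite memNset// mulr0 mulr_ge0// cut_kernel_ge0.
  have Ey : E y by apply: he'; apply: le_ball yb; rewrite ge_min lexx orbT.
  rewrite !mem_set// !mulr1 /cut_kernel.
  have [h1 h2] : [set h | J z0 / 2 < J h /\ sg < sqnorm h] (y - x').
    apply: he; split => // i j; rewrite /ball/= !mxE.
    have [_ /(_ i j)] := yb; have [_ /(_ i j)] := xx'; rewrite /ball/= => h1 h2.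
    have -> : y0 i j - x i j - (y i j - x' i j) = (y0 i j - y i j) - (x i j - x' i j) by ring.
    rewrite (le_lt_trans (ler_normB _ _))// (splitr e) ltrD//.
      by rewrite (lt_le_trans h2)// ge_min lexx.
    by rewrite (lt_le_trans h1)// ge_min lexx.
  by rewrite (ltW h2) ltW.
move=> k1 /= k10 hk.
exists (k1 / 2); split => //; first by rewrite divr_gt0.
move=> x Ox; apply: (hk (k1 / 2)) => /=.
- by rewrite sub0r normrN ger0_norm ?divr_ge0 ?(ltW k10)//; lra.
- by rewrite divr_gt0.
- exact: subset_closure.
Qed.

End kernel_lower_bound.

(** * Chains of translates and the Poincare inequality *)

Section poincare.
Context {R : realType} (N : nat).
Local Notation mu := (@lebesgue_rV R N).
Variables (O E : set 'rV[R]_N) (J : 'rV[R]_N -> R).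
Hypotheses (N0 : (0 < N)%N) (bO : bounded_domain O) (bE : bounded_domain E)
  (aJ : admissible_kernel J) (OE : O `<=` E)
  (OJE : [set x + 2 *: z | x in O & z in supp J] `<=` E).

Let J0 z : 0 <= J z. Proof. by case: aJ. Qed.
Let cJ : continuous J. Proof. by case: aJ. Qed.

Lemma kernel_even z : J (- z) = J z.
Proof.
case: aJ => _ _ radJ _ _; apply: radJ; apply: eq_bigr => i _.
by rewrite mxE sqrrN.
Qed.

(** If [x] and [x - n h] were both in the bounded set [O], then n^2 |h|^2 would be at most a
    constant, which fails for large [n] as soon as |h|^2 >= sg. *)
Lemma bounded_exit (sg : R) : 0 < sg -> exists n : nat, forall x h,
  O x -> sg <= sqnorm h -> ~ O (x - n%:R *: h).
Proof.
move=> sg0; have [_ _ [M [Mreal hM]] _] := bO.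
pose c := `|M| + 1.
have c0 : 0 <= c by rewrite addr_ge0.
have Mc : M < c by rewrite (le_lt_trans (ler_norm M))// ltrDl.
(* Bounds the squared Euclidean distance of two points of [O]; the factor [N] comes from the
   comparison with the sup norm. *)
pose B := N%:R * (2 * c) ^+ 2.
exists (Num.bound (B / sg)).+1 => x h Ox hs Oxn.
set n := (Num.bound _).+1 in Oxn.
have nB : B / sg < n%:R.
  apply: (lt_le_trans (archi_boundP _)); last by rewrite ler_nat leqnSn.
  by rewrite divr_ge0 ?(ltW sg0)// mulr_ge0// sqr_ge0.
have h1 : sqnorm (n%:R *: h) <= B.
  rewrite (le_trans (sqnorm_le_norm _))// ler_wpM2l// lerXn2r ?nnegrE ?mulr_ge0//.
  have -> : n%:R *: h = x - (x - n%:R *: h) by rewrite opprB addrCA subrr addr0.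
  rewrite (le_trans (ler_normB _ _))// mulr_natl mulr2n lerD//.
    exact: (hM _ Mc _ Ox).
  exact: (hM _ Mc _ Oxn).
have : n%:R * sg <= B.
  rewrite (le_trans _ h1)// sqnormZ ler_pM ?(ltW sg0)//.
  by rewrite expr2 ler_peMl// ler1n.
by rewrite -ler_pdivlMr// leNgt nB.
Qed.

Variable a : 'rV[R]_N -> R.
Hypotheses (ma : measurable_fun setT a) (aO : forall x, ~ O x -> a x = 0).

(** The indicators keep exactly the pairs of points over which the quadratic form of the operator on
    [E] integrates. *)
Definition increment (x h : 'rV[R]_N) : R :=
  \1_E x * \1_E (x + h) * (a x - a (x + h)) ^+ 2.

Let inc_ge0 x h : 0 <= increment x h.
Proof. by rewrite mulr_ge0 ?sqr_ge0// mulr_ge0. Qed.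

(* If both [x] and [x + h] are in [O] then so are [x - h], [x - 2 h], ... until
   the progression exits [O], and the exit point [x - j h], which belongs to
   [O + 2 supp J], is still in [E]. *)
Let chain_inside n x h : J h != 0 -> O x -> O (x + h) -> ~ O (x - n%:R *: h) ->
  a x ^+ 2 <= 2 ^+ n * \sum_(j < n) increment (x - j.+1%:R *: h) h.
Proof.
elim: n x => [|n IH] x Jh Ox Oxh; first by rewrite scale0r subr0.
move=> nO.
(* Since x - h = (x + h) + 2 (- h) with [x + h] in [O], this is where the factor 2 in front of the
   support enters. *)
have Exh : E (x - h).
  apply: OJE; exists (x + h) => //; exists (- h).
    by apply: kernel_supp; rewrite kernel_even.
  by rewrite scalerN scaler_nat mulr2n; apply/rowP => i; rewrite !mxE; ring.
have E1 : increment (x - 1%:R *: h) h = (a (x - h) - a x) ^+ 2.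
  by rewrite /increment scale1r subrK !indicE !mem_set ?mul1r//; exact: OE.
rewrite big_ord_recl /= E1.
under eq_bigr do rewrite /bump/= add1n.
set S := \sum_(j < n) _.
have S0 : 0 <= S by apply: sumr_ge0.
have [Oxh'|nOxh'] := pselect (O (x - h)); last first.
  rewrite (aO nOxh') sub0r sqrrN.
  rewrite (@le_trans _ _ (a x ^+ 2 + S)) ?lerDl//.
  by rewrite ler_peMl ?addr_ge0 ?sqr_ge0// exprn_ege1// ler1n.
have nO' : ~ O (x - h - n%:R *: h).
  suff -> : x - h - n%:R *: h = x - n.+1%:R *: h by [].
  by apply/rowP => i; rewrite !mxE -natr1; ring.
have Ox' : O (x - h + h) by rewrite subrK.
have := IH (x - h) Jh Oxh' Ox' nO'.
have -> : \sum_(j < n) increment (x - h - j.+1%:R *: h) h = S.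
  apply: eq_bigr => j _; congr increment.
  by apply/rowP => i; rewrite !mxE -[j.+2%:R]natr1; ring.
move=> h1.
(* Each step of the chain costs a factor 2, whence [2 ^+ n]. *)
have h2 : a x ^+ 2 <= 2 * (a (x - h) - a x) ^+ 2 + 2 * a (x - h) ^+ 2.
  have := sqr_ge0 (a x - 2 * a (x - h)); rewrite !sqrrB exprMn; nra.
rewrite (le_trans h2)// [2 ^+ n.+1]exprS -mulrA -mulrDr ler_pM2l//.
by rewrite mulrDr lerD// ler_peMl ?sqr_ge0// exprn_ege1// ler1n.
Qed.

(** When [x + h] has already left [O], the increment from [x] to [x + h] alone equals a(x)^2;
    otherwise the chain is followed backwards. Hence the extra term j = 0. *)
Let chain n x h : J h != 0 -> O x -> E (x + h) -> ~ O (x - n%:R *: h) ->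
  a x ^+ 2 <= 2 ^+ n * \sum_(j < n.+1) increment (x - j%:R *: h) h.
Proof.
move=> Jh Ox Exh nO; rewrite big_ord_recl /= scale0r subr0.
have p1 : 1 <= 2 ^+ n :> R by rewrite exprn_ege1// ler1n.
have [Oxh|nOxh] := pselect (O (x + h)).
  rewrite (le_trans (chain_inside Jh Ox Oxh nO))// ler_wpM2l ?exprn_ge0//.
  by rewrite lerDr.
have -> : increment x h = a x ^+ 2.
  by rewrite /increment (aO nOxh) subr0 !indicE !mem_set ?mul1r//; exact: OE.
rewrite (@le_trans _ _ (a x ^+ 2 + \sum_(j < n) increment (x - (bump 0 j)%:R *: h) h))//.
  by rewrite lerDl sumr_ge0.
by rewrite ler_peMl// addr_ge0 ?sqr_ge0// sumr_ge0.
Qed.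

Let mE : measurable E.
Proof. by have [oE _ _ _] := bE; exact: open_measurable_rV. Qed.

Let mJ : measurable_fun setT J.
Proof. exact: measurable_rV_continuous. Qed.

Let m1 : measurable_fun setT (fun z : 'rV[R]_N * 'rV[R]_N => z.1).
Proof. exact: measurable_fst. Qed.

Let m2 : measurable_fun setT (fun z : 'rV[R]_N * 'rV[R]_N => z.2).
Proof. exact: measurable_snd. Qed.

Let m1E : measurable_fun setT (\1_E : 'rV[R]_N -> R).
Proof. exact: measurable_indic. Qed.

Let minc : measurable_fun setT (fun z : 'rV[R]_N * 'rV[R]_N => increment z.1 z.2).
Proof.
apply: measurable_funM.
  apply: measurable_funM; first exact: (measurableT_comp m1E).
  by apply: (measurableT_comp m1E); exact: measurable_rVD.
apply: measurable_funX; apply: measurable_funB; first exact: (measurableT_comp ma).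
by apply: (measurableT_comp ma); exact: measurable_rVD.
Qed.

Let minc_shift (c : R) : measurable_fun setT
  (fun z : 'rV[R]_N * 'rV[R]_N => increment (z.1 - c *: z.2) z.2).
Proof.
apply: (measurableT_comp minc (g := fun z : 'rV[R]_N * 'rV[R]_N => (z.1 - c *: z.2, z.2))).
apply: measurable_fun_pair => //.
have -> : (fun z : 'rV[R]_N * 'rV[R]_N => z.1 - c *: z.2) = (fun z => z.1 + (- c) *: z.2).
  by apply/funext => z; rewrite scaleNr.
by apply: measurable_rVD => //; exact: measurable_rVZ.
Qed.

Let mG (c : R) : measurable_fun setT
  (fun z : 'rV[R]_N * 'rV[R]_N => J z.2 * increment (z.1 - c *: z.2) z.2).
Proof.
by apply: measurable_funM; [exact: (measurableT_comp mJ)|exact: minc_shift].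
Qed.

Let G0 (c : R) z : 0 <= J z.2 * increment (z.1 - c *: z.2) z.2.
Proof. exact: mulr_ge0. Qed.

(** For fixed [h], translation invariance in [x] removes the shift, so every link of the chain has
    the same integral; y = x + h and the evenness of [J] give its final form. *)
Let integral_shift_increment (c : R) :
  (\int[mu \x mu]_z (J z.2 * increment (z.1 - c *: z.2) z.2)%:E =
   \int[mu]_x \int[mu]_y (J (x - y) * (\1_E x * \1_E y * (a x - a y) ^+ 2))%:E)%E.
Proof.
pose F (z : 'rV[R]_N * 'rV[R]_N) := (J z.2 * increment z.1 z.2)%:E.
have mF : measurable_fun setT F.
  apply/measurable_EFinP; apply: measurable_funM; last exact: minc.
  exact: (measurableT_comp mJ).
have F0 z : (0 <= F z)%E by rewrite lee_fin mulr_ge0.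
pose H (z : 'rV[R]_N * 'rV[R]_N) := (J z.2 * increment (z.1 - c *: z.2) z.2)%:E.
have mH : measurable_fun setT H by apply/measurable_EFinP; exact: mG.
have H0 z : (0 <= H z)%E by rewrite lee_fin; exact: G0.
transitivity (\int[mu]_h \int[mu]_x H (x, h))%E; first exact: (fubini_tonelli2 H mH H0).
transitivity (\int[mu]_h \int[mu]_x F (x, h))%E.
  apply: eq_integral => h _.
  rewrite -(@ge0_integral_shift _ _ (- (c *: h)) (fun x => F (x, h)))//.
  exact: (measurableT_comp mF).
transitivity (\int[mu]_x \int[mu]_h F (x, h))%E; first exact: esym (fubini_tonelli F mF F0).
apply: eq_integral => x _.
rewrite -(@ge0_integral_shift _ _ x (fun y =>
  (J (x - y) * (\1_E x * \1_E y * (a x - a y) ^+ 2))%:E)).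
- apply: eq_integral => h _; rewrite /F /increment /= (addrC h) opprD addNKr.
  by rewrite kernel_even.
- apply/measurable_EFinP; apply: measurable_funM.
    apply: (measurableT_comp mJ).
    have -> : (fun y => x - y) = (fun y => cst x y + (-1) *: y).
      by apply/funext => y; rewrite scaleN1r.
    by apply: measurable_rVD => //; exact: measurable_rVZ.
  apply: measurable_funM; first exact: measurable_funM.
  by apply: measurable_funX; exact: measurable_funB.
- by move=> y; rewrite lee_fin mulr_ge0// mulr_ge0 ?sqr_ge0// mulr_ge0.
Qed.

(** The chain inequality is weighted by the cut kernel and integrated over x and h. On the left the
    kernel mass is at least [k0]; on the right the n + 1 links have equal integrals. *)
Lemma poincare_of_mass (sg k0 : R) (n : nat) : 0 < k0 ->
  (forall x, O x ->
    (k0%:E <= \int[mu]_h (cut_kernel J sg h * \1_E (x + h))%:E)%E) ->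
  (forall x h, O x -> sg <= sqnorm h -> ~ O (x - n%:R *: h)) ->
  ((k0 / (2 ^+ n * n.+1%:R))%:E * \int[mu]_x (a x ^+ 2)%:E <=
  \int[mu]_x \int[mu]_y (J (x - y) * (\1_E x * \1_E y * (a x - a y) ^+ 2))%:E)%E.
Proof.
move=> k00 hk hn.
set I := integral mu setT (fun x => integral mu setT _).
pose G (j : nat) z := J z.2 * increment (z.1 - j%:R *: z.2) z.2.
have pointwise z : cut_kernel J sg z.2 * \1_E (z.1 + z.2) * a z.1 ^+ 2 <=
    2 ^+ n * \sum_(j < n.+1) G j z.
  case: z => x h /=.
  have R0 : 0 <= 2 ^+ n * \sum_(j < n.+1) G j (x, h).
    by rewrite mulr_ge0 ?exprn_ge0// sumr_ge0// => j _; exact: G0.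
  have [Ox|nOx] := pselect (O x); last by rewrite (aO nOx) expr0n mulr0.
  have [Exh|nExh] := pselect (E (x + h)); last first.
    by rewrite indicE memNset// mulr0 mul0r.
  rewrite /cut_kernel; case: ifPn => [hs|_]; last by rewrite !mul0r.
  have [Jh|Jh] := eqVneq (J h) 0; first by rewrite Jh !mul0r.
  rewrite indicE mem_set// mulr1 /G /= -mulr_sumr [leRHS]mulrCA ler_wpM2l//.
  by apply: chain => //; exact: hn.
have C0 : 0 < 2 ^+ n * n.+1%:R :> R by rewrite mulr_gt0// exprn_gt0.
suff H : (k0%:E * \int[mu]_x (a x ^+ 2)%:E <= (2 ^+ n * n.+1%:R)%:E * I)%E.
  rewrite mulrC EFinM -muleA.
  apply: le_trans (lee_wpmul2l _ H) _; first by rewrite lee_fin invr_ge0 ltW.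
  by rewrite muleA -EFinM mulVf ?gt_eqF// mul1e.
have mL : measurable_fun setT (fun z : 'rV[R]_N * 'rV[R]_N =>
    cut_kernel J sg z.2 * \1_E (z.1 + z.2) * a z.1 ^+ 2).
  apply: measurable_funM; last by apply: measurable_funX; exact: (measurableT_comp ma).
  apply: measurable_funM.
    exact: (measurableT_comp (measurable_cut_kernel aJ sg)).
  by apply: (measurableT_comp m1E); exact: measurable_rVD.
have L0 z : 0 <= cut_kernel J sg z.2 * \1_E (z.1 + z.2) * a z.1 ^+ 2.
  by rewrite mulr_ge0 ?sqr_ge0// mulr_ge0// (cut_kernel_ge0 aJ).
apply: (@le_trans _ _ (\int[mu \x mu]_z
    (cut_kernel J sg z.2 * \1_E (z.1 + z.2) * a z.1 ^+ 2)%:E)%E).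
  rewrite fubini_tonelli1//=; last exact/measurable_EFinP.
  rewrite -ge0_integralZl_EFin ?(ltW k00)//; last first.
    by apply/measurable_EFinP; exact: measurable_funX.
  by move=> x _; rewrite lee_fin sqr_ge0.
  apply: ge0_le_integral => //.
  - by move=> x _; rewrite -EFinM lee_fin mulr_ge0 ?sqr_ge0// ltW.
  - by apply/measurable_EFinP; apply: measurable_funM => //; exact: measurable_funX.
  - apply: measurable_fun_fubini_tonelli_F; first exact/measurable_EFinP.
    by move=> z; rewrite lee_fin.
  move=> x _; rewrite /fubini_F /=.
  under eq_integral do rewrite EFinM.
  rewrite ge0_integralZr//; last 3 first.
  - apply/measurable_EFinP; apply: measurable_funM.
      exact: measurable_cut_kernel.
    apply: (measurableT_comp m1E); exact: measurable_rVD.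
  - by move=> h _; rewrite lee_fin mulr_ge0// (cut_kernel_ge0 aJ).
  - by rewrite lee_fin sqr_ge0.
  have [Ox|nOx] := pselect (O x); last by rewrite (aO nOx) expr0n !mule0.
  by rewrite lee_wpmul2r ?lee_fin ?sqr_ge0// hk.
apply: (@le_trans _ _ (\int[mu \x mu]_z (2 ^+ n * \sum_(j < n.+1) G j z)%:E)%E).
  apply: ge0_le_integral => //.
  - by move=> z _; rewrite lee_fin.
  - exact/measurable_EFinP.
  - apply/measurable_EFinP; apply: measurable_funM => //.
    by apply: measurable_sum => j; exact: mG.
  - by move=> z _; rewrite lee_fin.
under eq_integral do rewrite EFinM -sumEFin.
rewrite ge0_integralZl_EFin ?exprn_ge0//; last 2 first.
- by move=> z _; apply: sume_ge0 => j _; rewrite lee_fin; exact: G0.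
- by apply: emeasurable_sum => j; apply/measurable_EFinP; exact: mG.
rewrite ge0_integral_sum//; last 2 first.
- by move=> j; apply/measurable_EFinP; exact: mG.
- by move=> j z _; rewrite lee_fin; exact: G0.
rewrite (eq_bigr (fun=> I)); last by move=> j _; exact: integral_shift_increment.
rewrite sumr_const card_ord EFinM -muleA.
by rewrite lee_wpmul2l ?lee_fin ?exprn_ge0// mule_natl.
Qed.

End poincare.

Lemma poincare (R : realType) (N : nat) (O E : set 'rV[R]_N) (J : 'rV[R]_N -> R) :
  (0 < N)%N -> bounded_domain O -> bounded_domain E ->
  admissible_kernel J -> O `<=` E ->
  [set x + 2 *: z | x in O & z in supp J] `<=` E ->
  exists2 c : R, 0 < c & forall a : 'rV[R]_N -> R, measurable_fun setT a ->
    (forall x, ~ O x -> a x = 0) ->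
    (c%:E * \int[lebesgue_rV N]_x (a x ^+ 2)%:E <=
    \int[lebesgue_rV N]_x \int[lebesgue_rV N]_y
      (J (x - y) * (\1_E x * \1_E y * (a x - a y) ^+ 2))%:E)%E.
Proof.
move=> N0 bO bE aJ OE OJE.
have [sg [k0 [sg0 k00 hk]]] := kernel_mass_lower_bound N0 bO bE aJ OE OJE.
have [n hn] := bounded_exit bO sg0.
exists (k0 / (2 ^+ n * n.+1%:R)).
  by rewrite divr_gt0// mulr_gt0// exprn_gt0.
by move=> a ma aO; apply: poincare_of_mass hk hn.
Qed.

(** * Weak derivatives in time *)

Section smooth.
Context {R : realType}.
Implicit Types f g : R -> R.

(** Recursion on the derivative of [f] makes closure under sums, products, inverses and affine
    changes of variable an induction on [n]; [Ck_derive1n] converts it into the form used by test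
    functions. *)
Fixpoint Ck n f : Prop :=
  if n is n'.+1 then (forall x, derivable f x 1) /\ Ck n' (derive1 f) else True.

Lemma CkS n f (df : R -> R) : (forall x : R, is_derive x 1 f (df x)) -> Ck n df -> Ck n.+1 f.
Proof.
move=> fdf; have -> : df = (derive1 f).
  by apply/funext => x; rewrite derive1E; apply/esym; case: (fdf x).
by split => // x; case: (fdf x).
Qed.

Lemma CkW n f : Ck n.+1 f -> Ck n f.
Proof. by elim: n f => // n IH f [df /IH]. Qed.

Lemma is_derive_Ck n f (x : R) : Ck n.+1 f -> is_derive x 1 f ((derive1 f) x).
Proof. by move=> [df _]; apply: DeriveDef => //; rewrite derive1E. Qed.

Lemma Ck_derive1n f : (forall n, Ck n f) -> forall k (x : R), derivable (derive1n k f) x 1.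
Proof.
move=> sf k; elim: k f sf => [|k IH] f sf x; first by have [] := sf 1.
by rewrite derive1Sn; apply: IH => n; have [] := sf n.+1.
Qed.

Lemma Ck_cst n (c : R) : Ck n (fun=> c).
Proof.
by elim: n c => // n IH c; apply: (@CkS _ _ (fun=> 0)).
Qed.

Lemma CkD n f g : Ck n f -> Ck n g -> Ck n (fun x => f x + g x).
Proof.
elim: n f g => // n IH f g sf sg.
apply: (@CkS _ _ (fun x => (derive1 f) x + (derive1 g) x)).
  by move=> x; exact: (is_deriveD (is_derive_Ck x sf) (is_derive_Ck x sg)).
by apply: IH; [case: sf|case: sg].
Qed.

Lemma CkM n f g : Ck n f -> Ck n g -> Ck n (fun x => f x * g x).
Proof.
elim: n f g => // n IH f g sf sg.
apply: (@CkS _ _ (fun x => f x * (derive1 g) x + g x * (derive1 f) x)).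
  by move=> x; exact: (is_deriveM (is_derive_Ck x sf) (is_derive_Ck x sg)).
by apply: CkD; apply: IH; do ?[exact: CkW]; [case: sg|case: sf].
Qed.

Lemma Ck_affine n f c e : Ck n f -> Ck n (fun x => f (c * x + e)).
Proof.
elim: n f => // n IH f sf.
apply: (@CkS _ _ (fun x => (derive1 f) (c * x + e) * c)).
  move=> x; apply: (@is_derive1_comp _ f (fun x => c * x + e)).
    exact: (is_derive_Ck _ sf).
  have h := is_deriveD (is_deriveM (is_derive_cst c x 1) (is_derive_id x 1))
    (is_derive_cst e x 1).
  by apply: (is_derive_eq h); rewrite scaler0 !addr0 [_ *: 1]mulr1.
by apply: CkM; [apply: IH; case: sf|exact: Ck_cst].
Qed.

Lemma CkV n f : (forall x, f x != 0) -> Ck n f -> Ck n (fun x => (f x)^-1).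
Proof.
move=> f0; elim: n => // n IH sf.
apply: (@CkS _ _ (fun x => -1 * ((f x)^-1 * (f x)^-1) * (derive1 f) x)).
  move=> x; have h := is_deriveV (f0 x) (is_derive_Ck x sf).
  by apply: (is_derive_eq h); rewrite -exprVn expr2 mulN1r.
have sV : Ck n (fun x => (f x)^-1) by apply: IH; exact: CkW.
apply: CkM; last by case: sf.
by apply: CkM; [exact: Ck_cst|exact: CkM].
Qed.

(* The exponent [k] makes the family closed under differentiation, up to
   coefficients, see [is_derive_flat]. *)
Definition flat k (x : R) : R := if 0 < x then x^-1 ^+ k * expR (- x^-1) else 0.

(** With y = 1/x this is exp(y) >= (1 + y/(k+1))^(k+1) >= (y/(k+1))^(k+1). A bound linear in |x| is
    what the derivative at 0 requires. *)
Lemma flat_bound k (x : R) : `|flat k x| <= (k.+1%:R ^+ k.+1) * `|x|.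
Proof.
rewrite /flat; case: ifPn => [x0|_]; last by rewrite normr0 mulr_ge0// exprn_ge0.
rewrite ger0_norm ?mulr_ge0 ?exprn_ge0 ?invr_ge0 ?expR_ge0 ?(ltW x0)//.
rewrite (gtr0_norm x0) expRN.
have y0 : 0 < x^-1 by rewrite invr_gt0.
rewrite -[X in _ <= _ * X]invrK; move: (x^-1) y0 => y y0.
rewrite ler_pdivrMr ?expR_gt0// mulrAC ler_pdivlMr// -exprSr.
have := expR_ge1Dx (k.+1%:R^-1 * y).
rewrite -[X in expR X]mulrC => h.
have h2 : (k.+1%:R^-1 * y) ^+ k.+1 <= expR (y * k.+1%:R^-1) ^+ k.+1.
  rewrite lerXn2r ?nnegrE ?expR_ge0 ?mulr_ge0 ?invr_ge0 ?(ltW y0)//.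
  by rewrite (le_trans _ h)// lerDr.
move: h2; rewrite -expRM_natl mulrCA divff// mulr1 exprMn exprVn.
by rewrite ler_pdivrMl ?exprn_gt0.
Qed.

Lemma is_derive_flat k (x : R) :
  is_derive x 1 (flat k) (flat k.+2 x + - k%:R * flat k.+1 x).
Proof.
have [x0|x0|<-] := ltgtP 0 x.
- pose F := ((fun y : R => y^-1) ^+ k) * (expR \o (fun y => - y^-1)).
  apply: (@near_eq_is_derive _ _ _ F).
    near=> y; have y0 : 0 < y by near: y; exact: lt_nbhsr.
    by rewrite /F /flat y0 /= exprfctE.
  have hV : is_derive x 1 (fun y : R => y^-1) (- x ^- 2 *: 1).
    by apply: is_deriveV; rewrite gt_eqF.
  have hN := is_deriveN hV.
  have hX := @is_deriveX _ _ (fun y : R => y^-1) k _ _ _ hV.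
  have hE := @is_derive1_comp _ expR (- (fun y : R => y^-1)) x _ _
    (is_derive_expR (- x^-1)) hN.
  have h := is_deriveM hX hE.
  apply: (is_derive_eq h).
  rewrite /flat x0 /= exprfctE /GRing.scale/= mulr1.
  have y0 : x^-1 != 0 by rewrite invr_eq0 gt_eqF.
  rewrite -exprVn; case: k {F hX h} => [|k]; rewrite /= ?expr0 ?exprS; ring.
- apply: (@near_eq_is_derive _ _ _ (cst 0)).
    near=> y; have y0 : y < 0 by near: y; exact: lt_nbhsl.
    by rewrite /flat ltNge (ltW y0).
  rewrite /flat ltNge (ltW x0) /= mulr0 addr0; exact: is_derive_cst.
rewrite /flat ltxx mulr0 addr0.
(* At 0 the difference quotient of [flat k] is [flat k.+1] itself, which tends to 0 by
   [flat_bound]. *)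
have H : (fun h : R => h^-1 *: ((flat k \o shift 0) (h *: 1) - flat k 0)) @ 0^' --> (0 : R).
  apply: (@cvg_trans _ (flat k.+1 @ 0^')).
    apply: near_eq_cvg; near=> h.
    rewrite /= addr0 [h *: 1]mulr1 /flat ltxx subr0.
    by case: ifP => _; rewrite ?scaler0// [_ *: _]mulrA exprS.
  apply: cvg_within_filter.
  apply/cvgr0Pnorm_le => e e0.
  have c0 : 0 < (k.+2%:R : R) ^+ k.+2 by rewrite exprn_gt0.
  near=> y; rewrite (le_trans (flat_bound _ _))// -ler_pdivlMl//.
  near: y; have h0 : 0 < k.+2%:R ^- k.+2 * e by rewrite mulr_gt0// invr_gt0.
  exists (k.+2%:R ^- k.+2 * e) => // z; rewrite /ball_ /ball/= sub0r normrN; exact: ltW.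
apply: DeriveDef; first by apply/cvg_ex; exists 0.
by apply/cvg_lim.
Unshelve. all: by end_near. Qed.

Lemma Ck_flat n k : Ck n (flat k).
Proof.
elim: n k => // n IH k; apply: CkS; first exact: is_derive_flat.
apply: CkD; first exact: IH.
by apply: CkM; [exact: Ck_cst|exact: IH].
Qed.

Lemma flat_ge0 k x : 0 <= flat k x.
Proof.
rewrite /flat; case: ifP => // x0.
by rewrite mulr_ge0 ?expR_ge0// exprn_ge0// invr_ge0 ltW.
Qed.

Lemma flat0_gt0 x : 0 < x -> 0 < flat 0 x.
Proof. by move=> x0; rewrite /flat x0 mul1r expR_gt0. Qed.

Lemma flat0_eq0 x : x <= 0 -> flat 0 x = 0.
Proof. by rewrite /flat leNgt; case: ltP. Qed.

(** The classical smooth transition from 0 to 1 over [0, 1]; [x] and [1 - x] are never both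
    nonpositive, so the denominator is positive. *)
Definition step (x : R) := flat 0 x / (flat 0 x + flat 0 (1 - x)).

Let step_den x : 0 < flat 0 x + flat 0 (1 - x).
Proof.
have [x0|x0] := ltP 0 x; first by rewrite ltr_pwDl ?flat0_gt0 ?flat_ge0.
by rewrite ltr_wpDl ?flat_ge0 ?flat0_gt0// subr_gt0 (le_lt_trans x0).
Qed.

Lemma Ck_step n : Ck n step.
Proof.
apply: CkM; first exact: Ck_flat.
apply: CkV; first by move=> x; rewrite gt_eqF.
apply: CkD; first exact: Ck_flat.
have := Ck_affine (-1) 1 (Ck_flat n 0).
by congr Ck; apply/funext => x; congr flat; ring.
Qed.

Lemma step_le0 x : x <= 0 -> step x = 0.
Proof. by move=> x0; rewrite /step flat0_eq0// mul0r. Qed.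

Lemma step_ge1 x : 1 <= x -> step x = 1.
Proof.
move=> x1; rewrite /step [X in _ + X]flat0_eq0 ?subr_le0// addr0 divff// gt_eqF//.
by rewrite flat0_gt0// (lt_le_trans _ x1).
Qed.

Lemma step_bound x : 0 <= step x <= 1.
Proof.
rewrite /step divr_ge0 ?flat_ge0 ?(ltW (step_den _))//=.
by rewrite ler_pdivrMr// mul1r lerDl flat_ge0.
Qed.

End smooth.

(** * Smooth approximations of a jump *)

Section mollified_step.
Context {R : realType}.
Local Notation leb := (@lebesgue_measure R).
Implicit Types (s e x T : R).

Lemma continuous_Ck n (f : R -> R) : Ck n.+1 f -> continuous f.
Proof.
move=> [df _] x; apply: differentiable_continuous; exact/derivable1_diffP.
Qed.

Lemma continuous_derive1_step : continuous (derive1 (@step R)).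
Proof. by have [_ h] := Ck_step (R := R) 2; exact: (@continuous_Ck 0 _ h). Qed.

Lemma derive1_step_out x : x < 0 \/ 1 < x -> derive1 (@step R) x = 0.
Proof.
move=> x01; rewrite derive1E.
case: x01 => [x0|x1].
- rewrite (@near_eq_derive _ _ _ _ (cst 0)) ?derive_cst//.
  by near=> y; rewrite step_le0// ltW//; near: y; exact: lt_nbhsl.
- rewrite (@near_eq_derive _ _ _ _ (cst (1 : R))) ?derive_cst//.
  by near=> y; rewrite step_ge1// ltW//; near: y; exact: lt_nbhsr.
Unshelve. all: by end_near. Qed.

Lemma derive1_step_bounded : exists2 C : R, 0 < C & forall x, `|derive1 (@step R) x| <= C.
Proof.
have [|c _ hc] := @EVT_max R (fun x => `|derive1 (@step R) x|) 0 1 ler01.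
  apply: continuous_subspaceT => x; apply: continuous_comp.
    exact: continuous_derive1_step.
  exact: norm_continuous.
exists (`|derive1 (@step R) c| + 1); first by rewrite ltr_wpDl.
move=> x; have [x0|x0] := ltP x 0.
  by rewrite derive1_step_out ?normr0 ?addr_ge0//; left.
have [x1|x1] := ltP 1 x.
  by rewrite derive1_step_out ?normr0 ?addr_ge0//; right.
rewrite (le_trans (hc _ _)) ?lerDl//.
by rewrite in_itv/= x0.
Qed.

(* As [e] tends to [0], [mstep s e] tends to the indicator function of ]s, +oo[
   and its derivative to the Dirac mass at [s]. *)
Definition mstep s e x := step (e^-1 * x + - (s / e)).

Lemma Ck_mstep n s e : Ck n (mstep s e).
Proof. exact: (Ck_affine _ _ (Ck_step n)). Qed.

Lemma mstep_argE s e x : e^-1 * x + - (s / e) = (x - s) / e.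
Proof. by rewrite mulrBl mulrC. Qed.

Lemma mstep_le s e x : 0 < e -> x <= s -> mstep s e x = 0.
Proof.
move=> e0 xs; rewrite /mstep mstep_argE step_le0//.
by rewrite mulr_le0_ge0 ?invr_ge0 ?(ltW e0)// subr_le0.
Qed.

Lemma mstep_ge s e x : 0 < e -> s + e <= x -> mstep s e x = 1.
Proof.
move=> e0 xs; rewrite /mstep mstep_argE step_ge1//.
by rewrite ler_pdivlMr// mul1r lerBrDl.
Qed.

Lemma mstep_bound s e x : 0 <= mstep s e x <= 1.
Proof. exact: step_bound. Qed.

Lemma derive1_mstep s e x :
  derive1 (mstep s e) x = derive1 (@step R) (e^-1 * x + - (s / e)) * e^-1.
Proof.
rewrite derive1E.
have h := is_deriveD (is_deriveM (is_derive_cst (e^-1) x 1) (is_derive_id x 1))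
    (is_derive_cst (- (s / e)) x 1).
have hs := is_derive_Ck (e^-1 * x + - (s / e)) (Ck_step 1).
have h2 := @is_derive1_comp _ step _ x _ _ hs h.
case: h2 => _ ->; by rewrite scaler0 !addr0 [_ *: 1]mulr1.
Qed.

Lemma continuous_derive1_mstep s e : continuous (derive1 (mstep s e)).
Proof. by have [_ h] := Ck_mstep 2 s e; exact: (@continuous_Ck 0 _ h). Qed.

Lemma derive1_mstep_out s e x : 0 < e -> ~~ (s <= x <= s + e) ->
  derive1 (mstep s e) x = 0.
Proof.
move=> e0; rewrite negb_and -!ltNge => h.
rewrite derive1_mstep mstep_argE derive1_step_out ?mul0r//.
case/orP: h => h; [left|right].
  by rewrite pmulr_llt0 ?invr_gt0// subr_lt0.
by rewrite ltr_pdivlMr// mul1r ltrBrDl.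
Qed.

Lemma derive1_mstep_bound C s e : 0 < e -> (forall x, `|derive1 (@step R) x| <= C) ->
  forall x, `|derive1 (mstep s e) x| <= C / e.
Proof.
move=> e0 hC x; rewrite derive1_mstep normrM (gtr0_norm (x := e^-1)) ?invr_gt0//.
by rewrite ler_wpM2r// invr_ge0 ltW.
Qed.

Lemma measurable_derive1_mstep s e D : measurable_fun D (derive1 (mstep s e)).
Proof.
apply: measurable_funTS; apply: continuous_measurable_fun.
exact: continuous_derive1_mstep.
Qed.

Lemma integrable_mul_derive1_mstep T s e (a : R -> R) : 0 < e ->
  leb.-integrable `]0, T[ (EFin \o a) ->
  leb.-integrable `]0, T[ (EFin \o (fun x => derive1 (mstep s e) x * a x)).
Proof.
move=> e0 ai.
have [C C0 hC] := derive1_step_bounded.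
have ma : measurable_fun `]0, T[ a by apply/measurable_EFinP; exact: (measurable_int _ ai).
refine (@integrable_leS _ _ R leb _ _ (fun x => (C / e) * `|a x|) _ _ _ _) => //.
- apply: measurable_funM => //; exact: measurable_derive1_mstep.
- move=> x _ /=; rewrite normrM ler_wpM2r//.
  exact: (derive1_mstep_bound _ e0 hC _).
- exact: (integrableZl _ (C / e) (integrable_norm ai)).
Qed.

Lemma integrable_cst_itv T (c : R) :
  leb.-integrable `]0, T[ (EFin \o (fun=> c)).
Proof.
apply: measurable_bounded_integrable => //.
  rewrite /= lebesgue_measure_itv/=; case: ifP => _; rewrite ?ltry//.
exact: bounded_cst.
Qed.

Lemma integral_derive1_mstep T s e : 0 < s -> 0 < e -> s + e < T ->
  \int[leb]_(x in `]0, T[) derive1 (mstep s e) x = 1.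
Proof.
move=> s0 e0 seT.
have T0 : 0 < T by rewrite (lt_trans _ seT)// addr_gt0.
have ci := integrable_cst_itv T 1.
have := integrable_mul_derive1_mstep s e0 ci.
under [X in EFin \o X]eq_fun do rewrite mulr1.
move=> di.
rewrite /Rintegral.
rewrite integral_itv_obnd_cbnd; last by apply/measurable_EFinP; exact: measurable_derive1_mstep.
rewrite integral_itv_bndo_bndc; last by apply/measurable_EFinP; exact: measurable_derive1_mstep.
rewrite (@continuous_FTC2 _ _ (mstep s e))//.
- by rewrite (@mstep_le s e 0) ?(ltW s0)// (@mstep_ge s e T) ?(ltW seT)//= subr0.
- apply: continuous_subspaceT; exact: continuous_derive1_mstep.
- have cm : continuous (mstep s e) by apply: (@continuous_Ck 0); exact: Ck_mstep.
  split.
  + by move=> x _; have [] := Ck_mstep 1 s e.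
  + exact/cvg_at_right_filter/cm.
  + exact/cvg_at_left_filter/cm.
Qed.

(** The derivative of [mstep] has integral 1, so the difference is the integral of a(x) - a(s)
    against a weight of size at most C/e carried by an interval of length e. *)
Lemma mstep_average C T s e (dl : R) (a : R -> R) :
  0 < s -> 0 < e -> s + e < T -> 0 <= dl ->
  (forall x, `|derive1 (@step R) x| <= C) ->
  leb.-integrable `]0, T[ (EFin \o a) ->
  (forall x, s <= x <= s + e -> `|a x - a s| <= dl) ->
  `|\int[leb]_(x in `]0, T[) (derive1 (mstep s e) x * a x) - a s| <= C * dl.
Proof.
move=> s0 e0 seT dl0 hC ai has.
have ci := integrable_cst_itv T (a s).
have C0 : 0 <= C by exact: le_trans (hC 0).
rewrite -[X in _ - X]mul1r -(integral_derive1_mstep s0 e0 seT).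
have d1 : leb.-integrable `]0, T[ (EFin \o derive1 (mstep s e)).
  have := integrable_mul_derive1_mstep s e0 (integrable_cst_itv T 1).
  by under [X in EFin \o X]eq_fun do rewrite mulr1.
rewrite -RintegralZr// -RintegralB//; last 2 first.
- exact: integrable_mul_derive1_mstep.
- exact: integrable_mul_derive1_mstep.
have bi : leb.-integrable `]0, T[
    (EFin \o (fun x => derive1 (mstep s e) x * a x - derive1 (mstep s e) x * a s)).
  apply: (integrableB _ (integrable_mul_derive1_mstep s e0 ai)
    (integrable_mul_derive1_mstep s e0 ci)) => //.
have sub : `[s, s + e]%classic `<=` `]0, T[%classic.
  move=> x /=; rewrite !in_itv/= => /andP[sx xs].
  by rewrite (lt_le_trans s0 sx) (le_lt_trans xs seT).
rewrite (le_trans (le_normr_Rintegral _ bi))//.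
apply: (@le_trans _ _ (\int[leb]_(x in `]0, T[) ((cst (C / e * dl)) \_ `[s, s + e]) x)).
  apply: le_Rintegral => //.
  - have := integrable_norm bi; apply: eq_integrable => // x _ /=.
  - rewrite -restrict_EFin; apply/integrable_restrict => //.
    apply: integrableS (integrable_cst_itv T (C / e * dl)) => //.
    exact: measurableI.
  - move=> x _; rewrite -mulrBr patchE; case: ifPn.
      rewrite inE/= in_itv/= => xs.
      rewrite normrM ler_pM// ?has//; exact: derive1_mstep_bound.
    move=> /negP; rewrite inE/= in_itv/= => /negP xs.
    by rewrite derive1_mstep_out// mul0r normr0.
rewrite -Rintegral_mkcondr Rintegral_cst; last exact: measurableI.
rewrite setIidr// /= lebesgue_measure_itv/= lte_fin ltrDl e0/=.
by rewrite addrAC subrr add0r mulrAC divfK ?gt_eqF.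
Qed.

End mollified_step.

(** * Increments from weak derivatives *)

Section weak_FTC.
Context {R : realType}.
Local Notation leb := (@lebesgue_measure R).

Lemma mstep_test_function (T s t e : R) : 0 < e -> 0 < s -> s <= t -> t + e < T ->
  test_function T (fun x => mstep s e x - mstep t e x).
Proof.
move=> e0 s0 st teT; split.
  apply: Ck_derive1n => n.
  have h : Ck n (fun x => -1 * mstep t e x).
    by apply: CkM; [exact: Ck_cst|exact: Ck_mstep].
  have := CkD (Ck_mstep n s e) h.
  by congr Ck; apply/funext => x; rewrite mulN1r.
exists s, (t + e); split => // x; rewrite in_itv/= negb_and -!ltNge => /orP[xs|tx].
  by rewrite !mstep_le ?subrr// ?(ltW xs)// (le_trans (ltW xs)).
rewrite !mstep_ge ?subrr//; first exact: ltW.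
by rewrite (le_trans _ (ltW tx))// lerD2r.
Qed.

Variables (T : R) (a b : R -> R).
Hypotheses (ca : forall s, 0 < s -> s < T -> {for s, continuous a})
  (ai : leb.-integrable `]0, T[ (EFin \o a))
  (bi : leb.-integrable `]0, T[ (EFin \o b))
  (ab : forall eta, test_function T eta ->
    \int[leb]_(x in `]0, T[) (derive1 eta x * a x) =
    - (\int[leb]_(x in `]0, T[) (eta x * b x))).

Let cvg_left (s : R) (e_ : R^nat) : 0 < s -> s < T ->
  (forall n, 0 < e_ n) -> (forall n, s + e_ n < T) -> e_ n @[n --> \oo] --> 0 ->
  \int[leb]_(x in `]0, T[) (derive1 (mstep s (e_ n)) x * a x) @[n --> \oo] --> a s.
Proof.
move=> s0 sT e0 eT ecvg; have [C C0 hC] := derive1_step_bounded (R := R).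
apply/cvgrPdist_le => eps eps0.
have d0 : 0 < eps / C by rewrite divr_gt0.
have /cvgrPdist_le/(_ _ d0) [r /= r0 hr] := ca s0 sT.
have /cvgr0Pnorm_lt/(_ _ r0) := ecvg.
apply: filterS => n en.
rewrite distrC (le_trans (mstep_average s0 (e0 n) (eT n) (ltW d0) hC ai _))//.
  move=> x /andP[sx xs]; rewrite distrC; apply: hr => /=.
  rewrite distrC ger0_norm ?subr_ge0// ltrBlDl (le_lt_trans xs)// ltrD2l.
  by rewrite (le_lt_trans _ en)// ler_norm.
by rewrite mulrC divfK// gt_eqF.
Qed.

(** At x = s the limit is 0, since [mstep] vanishes up to [s] included; this is why the interval ]s,
    t] appears below. *)
Let cvg_mstep (s x : R) (e_ : R^nat) : (forall n, 0 < e_ n) ->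
  e_ n @[n --> \oo] --> 0 ->
  mstep s (e_ n) x @[n --> \oo] --> ((s < x)%R%:R : R).
Proof.
move=> e0 ecvg; have [sx|xs] := ltP s x; last first.
  under eq_fun do rewrite mstep_le//; exact: cvg_cst.
have xs0 : 0 < x - s by rewrite subr_gt0.
have /cvgr0Pnorm_lt/(_ _ xs0) h := ecvg.
apply: (@cvg_trans _ (cst 1 @ \oo)); last exact: cvg_cst.
apply: near_eq_cvg; apply: filterS h => n en.
by rewrite /= mstep_ge// -lerBrDl (le_trans _ (ltW en))// ler_norm.
Qed.

(** The test functions are differences of smoothed jumps at [s] and [t]. Continuity of [a] gives the
    limit of one side, dominated convergence that of the other. *)
Lemma weak_derivative_FTC (s t : R) : 0 < s -> s <= t -> t < T ->
  a t - a s = \int[leb]_(x in `]s, t]) b x.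
Proof.
move=> s0 st tT.
have sT := le_lt_trans st tT; have t0 := lt_le_trans s0 st.
(* The denominator starts at 2 so that [t + e_ n < T] is strict already for n = 0. *)
pose e_ n : R := (T - t) / n.+2%:R.
have e0 n : 0 < e_ n by rewrite divr_gt0// subr_gt0.
have etT n : t + e_ n < T.
  rewrite -ltrBrDl ltr_pdivrMr// ltr_pMr ?subr_gt0//.
  by rewrite ltr1n.
have esT n : s + e_ n < T by rewrite (le_lt_trans _ (etT n))// lerD2r.
have ecvg : e_ n @[n --> \oo] --> 0.
  rewrite -[X in _ --> X](mulr0 (T - t)); apply: cvgMr => //.
  have := @cvg_harmonic R; rewrite -(cvg_shiftn 1).
  by apply: cvg_trans; apply: near_eq_cvg; near=> n; rewrite /harmonic/= addn1.
pose eta n x := mstep s (e_ n) x - mstep t (e_ n) x.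
have et n : test_function T (eta n) by exact: mstep_test_function.
have L n : \int[leb]_(x in `]0, T[) (derive1 (eta n) x * a x) =
   \int[leb]_(x in `]0, T[) (derive1 (mstep s (e_ n)) x * a x) -
   \int[leb]_(x in `]0, T[) (derive1 (mstep t (e_ n)) x * a x).
  rewrite -RintegralB//; last 2 first.
  - exact: integrable_mul_derive1_mstep.
  - exact: integrable_mul_derive1_mstep.
  apply: eq_Rintegral => x _; rewrite -mulrBl; congr (_ * _).
  rewrite derive1E.
  have h1 := is_derive_Ck x (Ck_mstep 1 s (e_ n)).
  have h2 := is_derive_Ck x (Ck_mstep 1 t (e_ n)).
  by have [_ ->] := is_deriveB h1 h2.
have cL : \int[leb]_(x in `]0, T[) (derive1 (eta n) x * a x) @[n --> \oo] --> a s - a t.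
  under eq_fun do rewrite L.
  by apply: cvgB; exact: cvg_left.
have cR : \int[leb]_(x in `]0, T[) (eta n x * b x) @[n --> \oo] -->
    \int[leb]_(x in `]s, t]) b x.
  have subst : `]s, t]%classic `<=` `]0, T[%classic.
    move=> x /=; rewrite !in_itv/= => /andP[sx xt].
    by rewrite (lt_trans s0 sx) (le_lt_trans xt tT).
  have -> : \int[leb]_(x in `]s, t]) b x = \int[leb]_(x in `]0, T[) ((b \_ `]s, t]) x).
    by rewrite -Rintegral_mkcondr setIidr.
  have bi' : leb.-integrable `]s, t] (EFin \o b) by apply: integrableS bi.
  have bri : leb.-integrable `]0, T[ (EFin \o (b \_ `]s, t])).
    by rewrite -restrict_EFin; apply/integrable_restrict; rewrite ?setIidr.
  apply: fine_cvg; rewrite fineK; last exact: integrable_fin_num.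
  have mb : measurable_fun `]0, T[ b.
    by apply/measurable_EFinP; exact: (measurable_int _ bi).
  apply: (@dominated_cvg _ _ _ leb _ _ (fun n x => (eta n x * b x)%:E) _
    (fun x => (`|b x|)%:E)) => //.
  - move=> n; apply/measurable_EFinP; apply: measurable_funM => //.
    apply: measurable_funTS; apply: continuous_measurable_fun => x.
    by apply: cvgB; apply: (@continuous_Ck _ 0); exact: Ck_mstep.
  - move=> x _; apply: cvg_EFin; first by near=> n.
    rewrite patchE (_ : (if _ then _ else _) = ((s < x)%R%:R - (t < x)%R%:R) * b x); last first.
      case: ifPn; rewrite ?inE ?notin_setE/= in_itv/=.
        by move=> /andP[-> /le_gtF ->]; rewrite subr0 mul1r.
      move=> /negP; rewrite negb_and -leNgt -ltNge => /orP[xs|tx].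
        by rewrite le_gtF// le_gtF ?subrr ?mul0r// (le_trans xs).
      by rewrite tx (le_lt_trans st tx) subrr mul0r.
    apply: cvgMl => //; apply: cvgB; exact: cvg_mstep.
  - exact: integrable_norm.
  - move=> n x _; rewrite lee_fin normrM ler_piMl//.
    have /andP[h1 h2] := mstep_bound s (e_ n) x.
    have /andP[h3 h4] := mstep_bound t (e_ n) x.
    by rewrite ler_norml /eta; apply/andP; split; lra.
have cR' : \int[leb]_(x in `]0, T[) (derive1 (eta n) x * a x) @[n --> \oo] -->
    - \int[leb]_(x in `]s, t]) b x.
  under eq_fun do rewrite ab//; exact: cvgN.
have := cvg_unique _ cL cR'.
by move=> /(_ (@Rhausdorff R)) h; rewrite -[RHS]opprK -h opprB.
Unshelve. all: by end_near. Qed.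

End weak_FTC.

(** In place of continuity, the condition at [x] compares points on both sides of [x]: a good time
    slightly before the supremum of the good times makes times beyond it good, unless the supremum
    is [t0]. *)
Lemma local_nonincreasing (R : realType) (F : R -> R) (s0 t0 : R) : s0 <= t0 ->
  (forall x, s0 <= x <= t0 -> exists2 r, 0 < r & forall s t,
    s0 <= s -> s <= t -> t <= t0 -> `|s - x| < r -> `|t - x| < r -> F t <= F s) ->
  F t0 <= F s0.
Proof.
move=> st0 loc.
pose S := [set t | s0 <= t <= t0 /\ F t <= F s0].
have S0 : S s0 by split; rewrite ?lexx.
have ubS : ubound S t0 by move=> t [/andP[_ ->]].
have hsS : has_sup S by split; [exists s0|exists t0].
pose x := sup S.
have s0x : s0 <= x by exact: (ub_le_sup hsS.2).
have xt0 : x <= t0 by apply: (ge_sup hsS.1).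
have [|r r0 hr] := loc x; first by rewrite s0x xt0.
have [t [/andP[s0t tt0] Ft] xrt] := sup_adherent r0 hsS.
have tx : t <= x by apply: (ub_le_sup hsS.2); split => //; rewrite s0t tt0.
have tr : `|t - x| < r.
  by rewrite distrC ger0_norm ?subr_ge0// ltrBlDr -ltrBlDl.
have key y : x <= y -> y <= t0 -> `|y - x| < r -> F y <= F s0.
  by move=> xy yt0 yr; rewrite (le_trans _ Ft)// hr// (le_trans tx).
have [->|xt] := eqVneq t0 x; first by rewrite key// subrr normr0.
have {xt}xt : x < t0 by rewrite lt_neqAle eq_sym xt.
pose y := Num.min t0 (x + r / 2).
have xy : x < y by rewrite lt_min xt ltrDl divr_gt0.
have : y <= x.
  apply: (ub_le_sup hsS.2); split; first by rewrite (le_trans s0x (ltW xy)) ge_min lexx.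
  apply: key; rewrite ?ge_min ?lexx ?(ltW xy)//.
  rewrite gtr0_norm ?subr_gt0// ltrBlDl gt_min; apply/orP; right.
  by rewrite ltrD2l ltr_pdivrMr// ltr_pMr// ltr1n.
by rewrite leNgt xy.
Qed.

Section test_function_facts.
Context {R : realType} (T : R) (eta : R -> R).
Hypotheses (T0 : 0 < T) (et : test_function T eta).

Lemma continuous_test : continuous eta.
Proof.
move=> x; apply: differentiable_continuous; apply/derivable1_diffP.
exact: (et.1 0%N).
Qed.

Lemma continuous_derive1_test : continuous (derive1 eta).
Proof.
move=> x; apply: differentiable_continuous; apply/derivable1_diffP.
by have := et.1 1%N x; rewrite derive1n1.
Qed.

Let bounded_of (f : R -> R) : continuous f -> (forall x, x < 0 \/ T < x -> f x = 0) ->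
  exists C, forall x, `|f x| <= C.
Proof.
move=> cf f0; have [|c _ hc] := @EVT_max R (fun x => `|f x|) 0 T (ltW T0).
  apply: continuous_subspaceT => x; apply: continuous_comp; first exact: cf.
  exact: norm_continuous.
exists (`|f c|) => x; have [x0|x0] := ltP x 0.
  by rewrite f0 ?normr0//; left.
have [x1|x1] := ltP T x; first by rewrite f0 ?normr0//; right.
by rewrite hc// in_itv/= x0.
Qed.

Lemma bounded_test : exists C, forall x, `|eta x| <= C.
Proof.
apply: bounded_of; first exact: continuous_test.
move=> x; have [_ [a [b [a0 bT h]]]] := et => x0T; apply: h; rewrite in_itv/= negb_and -!ltNge.
by case: x0T => x0; apply/orP; [left|right]; exact: lt_trans x0 _ || exact: lt_trans _ x0.
Qed.

Lemma bounded_derive1_test : exists C, forall x, `|derive1 eta x| <= C.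
Proof.
apply: bounded_of; first exact: continuous_derive1_test.
have [_ [a [b [a0 bT h]]]] := et => x x0T.
rewrite derive1E (@near_eq_derive _ _ _ _ (cst (0 : R))) ?derive_cst//.
case: x0T => x0.
- near=> y; rewrite h//= in_itv/= negb_and -!ltNge; apply/orP; left.
  by near: y; apply: lt_nbhsl; exact: lt_trans a0.
- near=> y; rewrite h//= in_itv/= negb_and -!ltNge; apply/orP; right.
  by near: y; apply: lt_nbhsr; exact: lt_trans x0.
Unshelve. all: by end_near. Qed.

End test_function_facts.

(** * The energy along a weakly differentiable curve *)

Section L2.
Context d (X : measurableType d) {R : realType} (nu : {measure set X -> \bar R}).
Implicit Types f g : X -> R.
Local Notation L2 f := (nu.-integrable setT (EFin \o (fun x => f x ^+ 2))).

Lemma integrable_sqrB f g : measurable_fun setT f -> measurable_fun setT g ->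
  L2 f -> L2 g -> L2 (fun x => f x - g x).
Proof.
move=> mf mg f2 g2; apply: integrable_sqrD => //.
  exact: measurableT_comp.
by apply: eq_integrable g2 => // x _ /=; rewrite sqrrN.
Qed.

(** Young's form of the Cauchy-Schwarz inequality: the free weight [c] is tuned at each use. *)
Lemma le_Rintegral_mul f g (c : R) : 0 < c ->
  measurable_fun setT f -> measurable_fun setT g -> L2 f -> L2 g ->
  `|\int[nu]_x (f x * g x)| <=
    (c * (\int[nu]_x (f x ^+ 2)) + c^-1 * (\int[nu]_x (g x ^+ 2))) / 2.
Proof.
move=> c0 mf mg f2 g2.
have fg := integrable_mul mf mg f2 g2.
rewrite (le_trans (le_normr_Rintegral _ fg))// mulrDl.
have i1 : nu.-integrable setT (EFin \o (fun x => (c / 2) * f x ^+ 2)).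
  exact: integrableZlr.
have i2 : nu.-integrable setT (EFin \o (fun x => (c^-1 / 2) * g x ^+ 2)).
  exact: integrableZlr.
rewrite mulrAC [X in _ + X]mulrAC -!RintegralZl// -RintegralD//.
apply: le_Rintegral => //.
- exact: integrable_norm.
- exact: integrableDr.
move=> x _; rewrite normrM -(real_normK (num_real (f x))) -(real_normK (num_real (g x))).
move: `|f x| (normr_ge0 (f x)) `|g x| (normr_ge0 (g x)) => a a0 b b0.
have -> : c / 2 * a ^+ 2 + c^-1 / 2 * b ^+ 2 = (c^-1 / 2) * ((c * a - b) ^+ 2) + a * b.
  by field; rewrite gt_eqF.
by rewrite lerDr mulr_ge0 ?sqr_ge0// divr_ge0// invr_ge0 ltW.
Qed.

Lemma Rintegral_sqrD_le f g : measurable_fun setT f -> measurable_fun setT g ->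
  L2 f -> L2 g ->
  \int[nu]_x ((f x + g x) ^+ 2) <=
    2 * (\int[nu]_x (f x ^+ 2)) + 2 * (\int[nu]_x (g x ^+ 2)).
Proof.
move=> mf mg f2 g2.
rewrite -!RintegralZl// -RintegralD//; try exact: integrableZlr.
apply: le_Rintegral => //.
- exact: integrable_sqrD.
- by apply: integrableDr; exact: integrableZlr.
- by move=> x _; have := sqr_ge0 (f x - g x); rewrite sqrrB sqrrD; nra.
Qed.

End L2.

Section energy.
Context d (X : measurableType d) {R : realType}.
Variables (nu : {finite_measure set X -> \bar R}) (T : R).
Hypothesis T0 : 0 < T.
Local Notation leb := (@lebesgue_measure R).

Let itv_fin : (leb `]0%R, T[%classic < +oo)%E.
Proof. by rewrite /= lebesgue_measure_itv/=; case: ifP => _; rewrite ?ltry. Qed.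

Let mitv : measurable (`]0, T[%classic : set (measurableTypeR R)).
Proof. exact: measurable_itv. Qed.

(** Bundled as a finite measure, so that constants are integrable and square integrable functions of
    (t, x) are integrable. *)
Definition time_measure : {finite_measure set (measurableTypeR R) -> \bar R} :=
  mfrestr mitv itv_fin.
Local Notation lamT := time_measure.

Lemma Rintegral_time (f : R -> R) : measurable_fun setT f ->
  \int[lamT]_x f x = \int[leb]_(x in `]0, T[) f x.
Proof.
move=> mf; rewrite /Rintegral; congr fine.
by apply: integral_mrestr; exact/measurable_EFinP.
Qed.

Lemma integrable_time (f : R -> R) : lamT.-integrable setT (EFin \o f) ->
  leb.-integrable `]0, T[ (EFin \o f).
Proof.
by move=> fi; apply/(integrable_mrestr leb mitv) => //; exact: (measurable_int _ fi).
Qed.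

Lemma ae_time (P : R -> Prop) : {ae leb, forall t, t \in `]0, T[ -> P t} ->
  {ae lamT, forall t, P t}.
Proof. exact: (@ae_mrestr _ _ _ leb _ mitv). Qed.

Variables (U V : R -> X -> R).
Implicit Types (w : X -> R).
Local Notation L2 f := (nu.-integrable setT (EFin \o (fun x => f x ^+ 2))).
Hypotheses
  (mU : measurable_fun setT (fun z : measurableTypeR R * X => U z.1 z.2))
  (U2 : forall t, L2 (U t))
  (U0 : forall t, ~~ (0 <= t <= T) -> U t = fun=> 0)
  (Uc : forall t e, 0 <= t <= T -> 0 < e -> exists2 r, 0 < r &
     forall s, 0 <= s <= T -> `|s - t| < r -> \int[nu]_x ((U s x - U t x) ^+ 2) <= e)
  (mV : measurable_fun setT (fun z : measurableTypeR R * X => V z.1 z.2))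
  (V2 : (lamT \x nu)%E.-integrable setT (EFin \o (fun z => V z.1 z.2 ^+ 2)))
  (UV : forall eta, test_function T eta -> {ae nu, forall x,
      \int[leb]_(t in `]0, T[) (derive1 eta t * U t x) =
      - (\int[leb]_(t in `]0, T[) (eta t * V t x))}).

Definition energy t := \int[nu]_x (U t x ^+ 2).

Let mUt t : measurable_fun setT (U t).
Proof. exact: (measurableT_comp mU (measurable_pair1 t)). Qed.

Let mVt t : measurable_fun setT (V t).
Proof. exact: (measurableT_comp mV (measurable_pair1 t)). Qed.

Let mVx x : measurable_fun setT (V ^~ x).
Proof. exact: (measurableT_comp mV (measurable_pair2 x)). Qed.

Lemma energy_cvg t e : 0 <= t <= T -> 0 < e -> exists2 r, 0 < r &
  forall s, 0 <= s <= T -> `|s - t| < r -> `|energy s - energy t| <= e.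
Proof.
move=> tT e0.
have Et : 0 <= energy t by apply: Rintegral_ge0 => x _; exact: sqr_ge0.
(* Twice the cross term is at most c ||U t||^2 + c^-1 ||U s - U t||^2: [c] makes the first summand
   at most e/2, and [e'] makes the rest at most e/2. The added 1 covers a vanishing energy. *)
pose c : R := e / (2 * (energy t + 1)).
have c0 : 0 < c by rewrite divr_gt0// mulr_gt0// ltr_wpDl.
pose e' := (e / 2) / (1 + c^-1).
have c1 : 0 < 1 + c^-1 by rewrite addr_gt0// invr_gt0.
have e'0 : 0 < e' by rewrite !divr_gt0.
have [r r0 hr] := Uc tT e'0; exists r => // s sT st.
have D2 : L2 (fun x => U s x - U t x) by exact: integrable_sqrB.
have mD : measurable_fun setT (fun x => U s x - U t x) by exact: measurable_funB.
have i2 := integrable_mul (mUt t) mD (U2 t) D2.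
have -> : energy s - energy t = \int[nu]_x ((U s x - U t x) ^+ 2) +
     2 * (\int[nu]_x (U t x * (U s x - U t x))).
  rewrite -RintegralZl// -RintegralD//; last exact: integrableZlr.
  rewrite /energy -RintegralB//; apply: eq_Rintegral => x _; ring.
set I := \int[nu]_x ((U s x - U t x) ^+ 2).
have I0 : 0 <= I by apply: Rintegral_ge0 => x _; exact: sqr_ge0.
have Ie : I <= e' by exact: hr.
have := le_Rintegral_mul c0 (mUt t) mD (U2 t) D2.
rewrite -/(energy t) -/I => h.
rewrite (le_trans (ler_normD _ _))// (ger0_norm I0) normrM ger0_norm//.
have ce : c * energy t <= e / 2.
  rewrite /c invfM mulrA mulrAC ler_pdivrMr ?ltr_wpDl//.
  by rewrite ler_wpM2l ?lerDl// divr_ge0// ltW.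
have Ie2 : I * (1 + c^-1) <= e / 2 by rewrite -ler_pdivlMr.
move: h; rewrite ler_pdivlMr//; lra.
Qed.

(** A bound uniform in time is what makes [U] square integrable over space-time. *)
Lemma energy_bounded : exists B, forall t, energy t <= B.
Proof.
have [|c _ hc] := @EVT_max R energy 0 T (ltW T0).
  apply/subspace_continuousP => t; rewrite /= in_itv/= => tT.
  apply/cvgrPdist_le => e e0; have [r r0 hr] := energy_cvg tT e0.
  exists r => // s /= str; rewrite in_itv/= => sT.
  by rewrite distrC hr// distrC.
exists (Num.max (energy c) 0) => t; rewrite le_max.
have [tT|tT] := boolP (0 <= t <= T); first by rewrite hc// in_itv/= tT.
rewrite /energy U0//; apply/orP; right.
rewrite (@eq_Rintegral _ _ _ nu setT (fun=> 0)) ?Rintegral_cst ?mul0r// => x _.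
by rewrite expr0n.
Qed.

Let U2i : (lamT \x nu)%E.-integrable setT (EFin \o (fun z => U z.1 z.2 ^+ 2)).
Proof.
have [B hB] := energy_bounded.
apply/integrable12ltyP.
  by apply/measurable_EFinP; exact: measurable_funX.
apply: (@le_lt_trans _ _ (\int[lamT]_x (cst B%:E x))%E).
  apply: ge0_le_integral => //.
  - by move=> t _; exact: integral_ge0.
  - apply: (measurable_fun_fubini_tonelli_F (fun z => `|(U z.1 z.2 ^+ 2)%:E|%E)) => //.
    apply: measurableT_comp => //; apply/measurable_EFinP; exact: measurable_funX.
  - move=> t _.
    rewrite (eq_integral (fun x => (U t x ^+ 2)%:E)); last first.
      by move=> x _; rewrite /= ger0_norm ?sqr_ge0.
    by rewrite -[leLHS]fineK ?lee_fin ?hB//; exact: integrable_fin_num (U2 t).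
rewrite integral_cst// lte_mul_pinfty//.
- rewrite lee_fin; apply: le_trans (hB 0).
  by apply: Rintegral_ge0 => x _; exact: sqr_ge0.
- exact: fin_num_fun_lty.
Qed.

Let integrable_sqr2 (F : measurableTypeR R * X -> R) : measurable_fun setT F ->
  (lamT \x nu)%E.-integrable setT (EFin \o (fun z => F z ^+ 2)) ->
  (lamT \x nu)%E.-integrable setT (EFin \o F).
Proof.
move=> mF F2.
have h := @integrable_prod _ _ _ _ _ lamT nu (fun=> 1) (fun=> 1)
  (finite_measure_integrable_cst _ 1 measurableT)
  (finite_measure_integrable_cst _ 1 measurableT).
have h2 : (lamT \x nu)%E.-integrable setT (EFin \o (fun z => (fun=> 1 : R) z ^+ 2)).
  by apply: eq_integrable h => // z _ /=; rewrite mulr1 expr1n.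
have := @integrable_mul _ _ _ _ F (fun=> 1) mF (measurable_cst _) F2 h2.
by apply: eq_integrable => // z _ /=; rewrite mulr1.
Qed.

(** * Pairing with a fixed square integrable function *)

Section pairing.
Variable w : X -> R.
Hypotheses (mw : measurable_fun setT w) (w2 : L2 w).

Let w2i : (lamT \x nu)%E.-integrable setT (EFin \o (fun z => w z.2 ^+ 2)).
Proof.
have h := @integrable_prod _ _ _ _ _ lamT nu (fun=> 1) (fun x => w x ^+ 2)
  (finite_measure_integrable_cst _ 1 measurableT) w2.
by apply: eq_integrable h => // z _ /=; rewrite mul1r.
Qed.

Let mw' : measurable_fun setT (fun z : measurableTypeR R * X => w z.2).
Proof. exact: (measurableT_comp mw). Qed.

Let Uwi : (lamT \x nu)%E.-integrable setT (EFin \o (fun z => U z.1 z.2 * w z.2)).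
Proof. exact: integrable_mul. Qed.

Let Vwi : (lamT \x nu)%E.-integrable setT (EFin \o (fun z => V z.1 z.2 * w z.2)).
Proof. exact: integrable_mul. Qed.

Let mul_bounded (h : R -> R) (F : measurableTypeR R * X -> R) :
  continuous h -> (exists C, forall x, `|h x| <= C) ->
  (lamT \x nu)%E.-integrable setT (EFin \o F) ->
  (lamT \x nu)%E.-integrable setT (EFin \o (fun z => h z.1 * F z)).
Proof.
move=> ch [C hC] Fi; apply: (@integrable_le _ _ _ _ _ (fun z => C * `|F z|)).
- apply: measurable_funM; last by apply/measurable_EFinP; exact: (measurable_int _ Fi).
  apply: (measurableT_comp (f := h)) => //; exact: continuous_measurable_fun.
- by move=> z; rewrite normrM ler_wpM2r.
- by apply: integrableZlr; exact: integrable_norm.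
Qed.

(** Moves the time integral inside the pairing, where the weak derivative is known for almost every
    x. Measurability is part of the conclusion because that almost everywhere identity is then
    integrated. *)
Let Fubini_pairing (h : R -> R) (F : R -> X -> R) :
  continuous h -> (exists C, forall x, `|h x| <= C) ->
  measurable_fun setT (fun z : measurableTypeR R * X => F z.1 z.2) ->
  (lamT \x nu)%E.-integrable setT (EFin \o (fun z => F z.1 z.2 ^+ 2)) ->
  \int[leb]_(t in `]0, T[) (h t * (\int[nu]_x (F t x * w x))) =
  \int[nu]_x (w x * (\int[leb]_(t in `]0, T[) (h t * F t x))) /\
  measurable_fun setT (fun x => w x * (\int[leb]_(t in `]0, T[) (h t * F t x))).
Proof.
move=> ch bh mF F2.
have Fwi : (lamT \x nu)%E.-integrable setT (EFin \o (fun z => F z.1 z.2 * w z.2)).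
  exact: integrable_mul.
have Fi : (lamT \x nu)%E.-integrable setT (EFin \o (fun z => F z.1 z.2)).
  exact: integrable_sqr2.
have hFi := mul_bounded ch bh Fi.
have hFwi := mul_bounded ch bh Fwi.
have mFt t : measurable_fun setT (F t) by exact: (measurableT_comp mF (measurable_pair1 t)).
have mFx x : measurable_fun setT (F ^~ x) by exact: (measurableT_comp mF (measurable_pair2 x)).
have mh : measurable_fun setT h by exact: continuous_measurable_fun.
have Fw1 := (Rintegral_Fubini1 Fwi).1.
have mFw : measurable_fun setT (fun t => \int[nu]_x (F t x * w x)).
  by apply/measurable_EFinP; exact: (measurable_int _ Fw1).
have hF2 := (Rintegral_Fubini2 hFi).1.
have mhF : measurable_fun setT (fun x => \int[leb]_(t in `]0, T[) (h t * F t x)).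
  have : measurable_fun setT (fun x => \int[lamT]_t (h t * F t x)).
    by apply/measurable_EFinP; exact: (measurable_int _ hF2).
  apply: eq_measurable_fun => x _; apply: Rintegral_time.
  exact: measurable_funM.
split; last exact: measurable_funM.
rewrite -Rintegral_time; last exact: measurable_funM.
have h1 : {ae lamT, forall t, h t * (\int[nu]_x (F t x * w x)) =
     \int[nu]_x (h t * (F t x * w x))}.
  apply: filterS (ae_integrable1 Fwi) => t ti.
  by rewrite RintegralZl.
transitivity (\int[lamT]_t \int[nu]_x (h t * (F t x * w x))).
  apply: ae_Rintegral h1; first exact: measurable_funM.
  by apply/measurable_EFinP; exact: (measurable_int _ (Rintegral_Fubini1 hFwi).1).
rewrite (Rintegral_Fubini1 hFwi).2 -(Rintegral_Fubini2 hFwi).2.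
apply: ae_Rintegral.
- by apply/measurable_EFinP; exact: (measurable_int _ (Rintegral_Fubini2 hFwi).1).
- exact: measurable_funM.
- apply: filterS (ae_integrable2 hFi) => x xi.
  rewrite -Rintegral_time; last exact: measurable_funM.
  rewrite -RintegralZl//; apply: eq_Rintegral => t _ /=; ring.
Qed.

Lemma integrable_pairing :
  leb.-integrable `]0, T[ (EFin \o (fun t => \int[nu]_x (V t x * w x))).
Proof. by apply: integrable_time; exact: (Rintegral_Fubini1 Vwi).1. Qed.

(** The pairing is continuous in time by continuity in L^2, and Fubini shows that it has the pairing
    of [V] with [w] as scalar weak derivative. *)
Lemma pairing_increment s t : 0 < s -> s <= t -> t < T ->
  \int[nu]_x (U t x * w x) - \int[nu]_x (U s x * w x) =
  \int[leb]_(r in `]s, t]) \int[nu]_x (V r x * w x).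
Proof.
move=> s0 st tT.
apply: (@weak_derivative_FTC _ T (fun t => \int[nu]_x (U t x * w x))) => //.
- move=> {st tT}{}t t0 tT; apply/cvgrPdist_le => e e0.
  pose W := \int[nu]_x (w x ^+ 2).
  have W0 : 0 <= W by apply: Rintegral_ge0 => x _; exact: sqr_ge0.
  (* Makes both terms of Young's inequality at most [e] as soon as the squared distance is at most
     [e / c]. *)
  pose c := (W + 1) / e.
  have c0 : 0 < c by rewrite divr_gt0// ltr_wpDl.
  have tT' : 0 <= t <= T by rewrite !ltW.
  have ec : 0 < e / c by rewrite divr_gt0.
  have [r r0 hr] := Uc tT' ec.
  near=> y.
  have yT : 0 <= y <= T.
    rewrite !ltW//; near: y; [exact: lt_nbhsl|exact: lt_nbhsr].
  have yt : `|y - t| < r.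
    near: y; apply/nbhs_ballP; exists r => // y; rewrite /ball/= distrC//.
  have D2 : L2 (fun x => U y x - U t x) by exact: integrable_sqrB.
  have mD : measurable_fun setT (fun x => U y x - U t x) by exact: measurable_funB.
  rewrite distrC -RintegralB//; [|exact: integrable_mul..].
  under eq_Rintegral do rewrite -mulrBl.
  rewrite (le_trans (le_Rintegral_mul c0 mD mw D2 w2))// ler_pdivrMr//.
  have h1 : c * (\int[nu]_x ((U y x - U t x) ^+ 2)) <= e.
    by rewrite mulrC -ler_pdivlMr// hr.
  have h2 : c^-1 * W <= e.
    by rewrite invf_div mulrAC ler_pdivrMr ?ltr_wpDl// ler_wpM2l ?lerDl// ltW.
  by rewrite -/W; lra.
- by apply: integrable_time; exact: (Rintegral_Fubini1 Uwi).1.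
- exact: integrable_pairing.
- move=> eta et.
  have [-> m1] := Fubini_pairing (continuous_derive1_test et)
    (bounded_derive1_test T0 et) mU U2i.
  have [-> m2] := Fubini_pairing (continuous_test et) (bounded_test T0 et) mV V2.
  rewrite -mulN1r -RintegralZl//; last first.
    have i := mul_bounded (continuous_test et) (bounded_test T0 et) Vwi.
    apply: ae_integrable (Rintegral_Fubini2 i).1 => //.
    have Vi : (lamT \x nu)%E.-integrable setT (EFin \o (fun z => V z.1 z.2)).
      exact: integrable_sqr2.
    have hVi := mul_bounded (continuous_test et) (bounded_test T0 et) Vi.
    apply: filterS (ae_integrable2 hVi) => x xi.
    rewrite -Rintegral_time; last first.
      apply: measurable_funM => //; apply: continuous_measurable_fun.
      exact: continuous_test et.
    rewrite -RintegralZl//; apply: eq_Rintegral => r _ /=; ring.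
  apply: ae_Rintegral => //; first exact: measurable_funM.
  apply: filterS (UV et) => x ->; ring.
Unshelve. all: by end_near. Qed.

End pairing.

Let W t := \int[nu]_x (V t x ^+ 2).

Let Wi : leb.-integrable `]0, T[ (EFin \o W).
Proof. by apply: integrable_time; exact: (Rintegral_Fubini1 V2).1. Qed.

Let V2t : {ae lamT, forall t, L2 (V t)}.
Proof. exact: (ae_integrable1 V2). Qed.

Let ae_itv s t (P : R -> Prop) : 0 < s -> t < T ->
  {ae lamT, forall r, r \in `]s, t] -> P r} ->
  {ae leb, forall r, r \in `]s, t] -> P r}.
Proof.
move=> s0 tT /(@ae_mrestrW _ _ _ leb _ mitv) [A [mA A0 sub]]; exists A; split => // r /=.
move=> /not_implyP[rst nP]; apply: sub => /= h; apply: nP; apply: h => //.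
move: rst; rewrite !in_itv/= => /andP[sr rt].
by rewrite (lt_trans s0 sr) (le_lt_trans rt tT).
Qed.

Let sub_itv s t : 0 < s -> t < T -> `]s, t]%classic `<=` `]0, T[%classic.
Proof.
move=> s0 tT r /=; rewrite !in_itv/= => /andP[sr rt].
by rewrite (lt_trans s0 sr) (le_lt_trans rt tT).
Qed.

(** A chain rule with error: if [U] oscillates by at most [e] in L^2 on [s, t], replacing U t + U s
    by 2 U r costs at most e (||V r||^2 / 2 + 2) at time r, the weight in Young's inequality being
    [e] itself. *)
Let energy_increment_le C e s t : 0 < s -> s <= t -> t < T -> 0 < e ->
  {ae lamT, forall r, s < r <= t -> \int[nu]_x (V r x * U r x) <= - C} ->
  (forall y z, s <= y <= t -> s <= z <= t ->
    \int[nu]_x ((U y x - U z x) ^+ 2) <= e ^+ 2) ->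
  energy t - energy s <= \int[leb]_(r in `]s, t]) (- (2 * C) + e * (W r / 2 + 2)).
Proof.
move=> s0 st tT e0 hC osc.
(* ||U t||^2 - ||U s||^2 is the pairing of [U t - U s] with [U t + U s]. *)
pose w x := U t x + U s x.
have mw : measurable_fun setT w by exact: measurable_funD.
have w2 : L2 w by exact: integrable_sqrD.
have -> : energy t - energy s =
    \int[nu]_x (U t x * w x) - \int[nu]_x (U s x * w x).
  rewrite /energy -!RintegralB//; [|exact: integrable_mul..].
  by apply: eq_Rintegral => x _; rewrite /w; ring.
rewrite (pairing_increment mw w2)//.
have i1 : leb.-integrable `]s, t] (EFin \o (fun r => \int[nu]_x (V r x * w x))).
  by apply: integrableS (integrable_pairing mw w2) => //; exact: sub_itv.
have Wi' : leb.-integrable `]s, t] (EFin \o W).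
  by apply: integrableS Wi => //; exact: sub_itv.
have ci (c : R) : leb.-integrable `]s, t] (EFin \o (fun=> c)).
  by apply: integrableS (integrable_cst_itv T c) => //; exact: sub_itv.
have i2 : leb.-integrable `]s, t]
    (EFin \o (fun r => - (2 * C) + e * (W r / 2 + 2))).
  apply: integrableDS => //.
  apply: integrableZlS => //.
  apply: integrableDS => //.
  have : leb.-integrable `]s, t] (EFin \o (fun r => 2^-1 * W r)).
    exact: integrableZlS.
  by apply: eq_integrable => // r _ /=; rewrite mulrC.
apply: ae_le_Rintegral => //.
apply: (ae_itv s0 tT).
have FF : Filter (almost_everywhere lamT) by exact: ae_filter_ringOfSetsType.
apply: (@filterS _ _ FF _ _ _ (@filterI _ _ FF _ _ hC V2t)) => r [h1 Vr2] rst /=.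
have rst' : s < r <= t by move: rst; rewrite in_itv.
have {}h1 := h1 rst'.
have srt : s <= r <= t by case/andP: rst' => /ltW -> ->.
have sst : s <= s <= t by rewrite lexx.
have tst : s <= t <= t by rewrite st lexx.
(* The defect U t + U s - 2 U r, of squared norm at most 4 e^2. *)
pose dd x := (U t x - U r x) + (U s x - U r x).
have mB y : measurable_fun setT (fun x => U y x - U r x) by exact: measurable_funB.
have B2 y : L2 (fun x => U y x - U r x) by exact: integrable_sqrB.
have md : measurable_fun setT dd by exact: measurable_funD.
have d2 : L2 dd by exact: integrable_sqrD.
have dle : \int[nu]_x (dd x ^+ 2) <= 4 * e ^+ 2.
  rewrite (le_trans (Rintegral_sqrD_le (mB t) (mB s) (B2 t) (B2 s)))//.
  by have := osc _ _ tst srt; have := osc _ _ sst srt; lra.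
have -> : \int[nu]_x (V r x * w x) =
   2 * (\int[nu]_x (V r x * U r x)) + \int[nu]_x (V r x * dd x).
  have j1 := integrable_mul (mVt r) (mUt r) Vr2 (U2 r).
  have j2 := integrable_mul (mVt r) md Vr2 d2.
  rewrite -RintegralZl// -RintegralD//; last exact: integrableZlr.
  by apply: eq_Rintegral => x _; rewrite /w /dd; ring.
have := le_Rintegral_mul e0 (mVt r) md Vr2 d2.
rewrite -/(W r) => /(le_trans (ler_norm _)) h2.
have h3 : e^-1 * (\int[nu]_x (dd x ^+ 2)) <= 4 * e.
  rewrite mulrC ler_pdivrMr//; apply: le_trans dle _; rewrite -mulrA -expr2//.
by move: h2; rewrite ler_pdivlMr//; lra.
Qed.

Let osc_local t e : 0 < t < T -> 0 < e -> exists2 r, 0 < r & forall y z,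
  `|y - t| < r -> `|z - t| < r -> \int[nu]_x ((U y x - U z x) ^+ 2) <= e ^+ 2.
Proof.
move=> /andP[t0 tT] e0.
have tT' : 0 <= t <= T by rewrite !ltW.
have e40 : 0 < e ^+ 2 / 4 by rewrite divr_gt0// exprn_gt0.
have [r r0 hr] := Uc tT' e40.
exists (Num.min r (Num.min t (T - t))).
  by rewrite !lt_min r0 t0 subr_gt0.
move=> y z; rewrite !lt_min => /andP[yr /andP[yt1 yt2]] /andP[zr /andP[zt1 zt2]].
have yT : 0 <= y <= T.
  by move: yt1 yt2; rewrite !ltr_norml => /andP[? ?] /andP[? ?]; apply/andP; split; lra.
have zT : 0 <= z <= T.
  by move: zt1 zt2; rewrite !ltr_norml => /andP[? ?] /andP[? ?]; apply/andP; split; lra.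
have mB a : measurable_fun setT (fun x => U a x - U t x) by exact: measurable_funB.
have B2 a : L2 (fun x => U a x - U t x) by exact: integrable_sqrB.
have mB' : measurable_fun setT (fun x => - (U z x - U t x)) by exact: measurableT_comp.
have B2' : L2 (fun x => - (U z x - U t x)).
  by apply: eq_integrable (B2 z) => // x _ /=; rewrite sqrrN.
have := Rintegral_sqrD_le (mB y) mB' (B2 y) B2'.
rewrite (@eq_Rintegral _ _ _ nu setT (fun x => (U y x - U z x) ^+ 2)); last first.
  by move=> x _; congr (_ ^+ 2); ring.
move=> /le_trans; apply.
rewrite [X in _ + 2 * X](@eq_Rintegral _ _ _ nu setT (fun x => (U z x - U t x) ^+ 2)); last first.
  by move=> x _; rewrite sqrrN.
by have := hr y yT yr; have := hr z zT zr; lra.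
Qed.

(** The accumulated error is [e * G], with [G] independent of [e]. It suffices to prove the
    inequality with this error and to let [e] tend to 0. *)
Lemma energy_le C s t : 0 < s -> s <= t -> t < T ->
  {ae lamT, forall r, s < r <= t -> \int[nu]_x (V r x * U r x) <= - C} ->
  energy t - energy s <= - (2 * C) * (t - s).
Proof.
move=> s0 st tT hC.
pose G y := \int[leb]_(r in `]s, y]) (W r / 2 + 2).
have Gi : leb.-integrable `]0, T[ (EFin \o (fun r => W r / 2 + 2)).
  apply: integrableDS => //.
    have : leb.-integrable `]0, T[ (EFin \o (fun r => 2^-1 * W r)).
      exact: integrableZlS.
    by apply: eq_integrable => // r _ /=; rewrite mulrC.
  exact: integrable_cst_itv.
suff H e : 0 < e -> energy t - energy s <= - (2 * C) * (t - s) + e * G t.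
  apply/ler_addgt0Pr => e e0.
  have G0 : 0 <= G t.
    by apply: Rintegral_ge0 => r _; rewrite addr_ge0// divr_ge0//;
      apply: Rintegral_ge0 => x _; exact: sqr_ge0.
  have e'0 : 0 < e / (G t + 1) by rewrite divr_gt0// ltr_wpDl.
  rewrite (le_trans (H _ e'0))// lerD2l mulrAC ler_pdivrMr ?ltr_wpDl//.
  by rewrite ler_wpM2l ?lerDl// ltW.
move=> e0.
(* With the error term subtracted, the estimate on short intervals says that [F] is locally
   nonincreasing. *)
pose F y := energy y + 2 * C * (y - s) - e * G y.
suff : F t <= F s.
  have Gs : G s = 0 by rewrite /G set_itv_ge ?Rintegral_set0// bnd_simp ltxx.
  by rewrite /F Gs; lra.
apply: local_nonincreasing => // x /andP[sx xt].
have [|r r0 hr] := @osc_local x e _ e0.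
  by rewrite (lt_le_trans s0 sx) (le_lt_trans xt tT).
exists r => // y z sy yz zt yr zr.
have y0 := lt_le_trans s0 sy; have zT := le_lt_trans zt tT.
have inc : energy z - energy y <=
    \int[leb]_(r in `]y, z]) (- (2 * C) + e * (W r / 2 + 2)).
  apply: energy_increment_le => //.
    apply: (@filterS _ _ (@ae_filter_ringOfSetsType _ _ _ lamT) _ _ _ hC) => q h /andP[yq qz].
    apply: h.
    by rewrite (le_lt_trans sy yq) (le_trans qz zt).
  have near q : y <= q <= z -> `|q - x| < r.
    move=> /andP[yq qz]; move: yr zr; rewrite !ltr_norml => /andP[? ?] /andP[? ?].
    by apply/andP; split; lra.
  by move=> q q' hq hq'; apply: hr; exact: near.
have Gyz : leb.-integrable `]y, z] (EFin \o (fun r => W r / 2 + 2)).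
  by apply: integrableS Gi => //; exact: sub_itv.
have Gsz : leb.-integrable `]s, z] (EFin \o (fun r => W r / 2 + 2)).
  by apply: integrableS Gi => //; exact: sub_itv.
have GE : G z - G y = \int[leb]_(r in `]y, z]) (W r / 2 + 2).
  by rewrite /G Rintegral_itvB// bnd_simp.
have ci : leb.-integrable `]y, z] (EFin \o (fun=> - (2 * C))).
  by apply: integrableS (integrable_cst_itv T _) => //; exact: sub_itv.
rewrite RintegralD// in inc; last exact: (integrableZl _ e Gyz).
rewrite RintegralZl// -GE Rintegral_cst// /= lebesgue_measure_itv/= lte_fin in inc.
have [yz'|yz'] := ltP y z.
  by rewrite yz' /= in inc; rewrite /F; lra.
have <- // : y = z by apply/eqP; rewrite eq_le yz.
Qed.

End energy.

(** * Decay from a differential inequality *)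

Section decay.
Context {R : realType} (E : R -> R) (c q : R).
Hypotheses (c0 : 0 < c) (q0 : 0 <= q) (E0 : forall t, 0 <= E t)
  (dE : forall s t, 0 <= s -> s <= t ->
     E t - E s <= - (c * (E t `^ q * E t)) * (t - s)).

Let E_nonincreasing s t : 0 <= s -> s <= t -> E t <= E s.
Proof.
move=> s0 st; rewrite -subr_le0 (le_trans (dE s0 st))//.
by rewrite mulNr oppr_le0 !mulr_ge0 ?powR_ge0 ?subr_ge0// ltW.
Qed.

(** A short step of the inequality reads E r (1 + x) <= E s; this bound turns the factor 1 + x into
    an exponential, at the price of half the rate. *)
Let expR_half_le (x : R) : 0 <= x <= 1 -> expR (x / 2) <= 1 + x.
Proof.
move=> /andP[x0 x1].
rewrite -[leLHS]invrK -expRN.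
have h := expR_ge1Dx (- (x / 2)).
have h0 : 0 < 1 + - (x / 2) by lra.
apply: (@le_trans _ _ (1 + - (x / 2))^-1).
  by rewrite lef_pV2 ?posrE// expR_gt0.
rewrite -[leLHS]mul1r ler_pdivrMr//; nra.
Qed.

Let small_step (B : R) : 0 <= B -> exists2 h : R, 0 < h & forall s t,
  s <= t -> t - s < h -> 0 <= c * B * (t - s) <= 1.
Proof.
move=> B0; exists (c * (B + 1))^-1.
  by rewrite invr_gt0 mulr_gt0// ltr_wpDl.
move=> s t st; rewrite -[_^-1]mul1r ltr_pdivlMr; last by rewrite mulr_gt0// ltr_wpDl.
move=> h; have ts : 0 <= t - s by rewrite subr_ge0.
have cB : 0 <= c * B * (t - s) by rewrite !mulr_ge0// ltW.
have ct : 0 <= c * (t - s) by rewrite mulr_ge0// ltW.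
by rewrite cB /=; nra.
Qed.

Lemma exponential_decay t : q = 0 -> 0 <= t -> E t <= expR (- (c / 2) * t) * E 0.
Proof.
move=> q00 t0.
have [h h0 hh] := small_step (ler01 : 0 <= 1 :> R).
suff : E t * expR (c / 2 * t) <= E 0 * expR (c / 2 * 0).
  rewrite mulr0 expR0 mulr1 mulNr expRN mulrC => H.
  by rewrite ler_pdivlMl ?expR_gt0.
apply: (@local_nonincreasing _ (fun t => E t * expR (c / 2 * t))) => // x x0.
exists (h / 2); first by rewrite divr_gt0.
move=> s r s0 sr _ sx rx.
have rs : r - s < h.
  by move: sx rx; rewrite !ltr_norml => /andP[? ?] /andP[? ?]; lra.
have := hh s r sr rs; rewrite mulr1 => hcr.
(* A power with exponent 0 is 1 even at a vanishing energy. *)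
have := dE s0 sr; rewrite q00 powRr0 mul1r => hd.
have h1 : E r * (1 + c * (r - s)) <= E s by lra.
have h2 := expR_half_le hcr.
have -> : c / 2 * r = c * (r - s) / 2 + c / 2 * s by field.
rewrite expRD mulrA ler_wpM2r ?expR_ge0//.
by rewrite (le_trans _ h1)// ler_wpM2l.
Qed.

(** The slope, up to sign, of the chord of 1 / (1 + q x / 2) over [0, 1]; by convexity 1 / (1 + q x
    / 2) <= 1 - kap x there. *)
Let kap := q / 2 / (1 + q / 2).

(** Bernoulli's substitution: E^(- q) grows at least linearly with slope [c * kap], as a local
    comparison shows. The initial value E 0 + 1 keeps the constant term positive even when E 0 =
    0. *)
Lemma polynomial_decay t : 0 < q -> 0 <= t ->
  E t <= 1 / ((c * kap) * t + (E 0 + 1) `^ (- q)) `^ (q^-1).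
Proof.
move=> qp t0.
set B := _ * t + _.
have kap0 : 0 < kap by rewrite divr_gt0 ?divr_gt0//; lra.
have B0 : 0 < B.
  apply: ltr_wpDl; last by rewrite powR_gt0// ltr_wpDl.
  by apply: mulr_ge0 => //; apply: mulr_ge0; exact: ltW.
(* Negative powers of the energy require it to be positive; if it is positive at [t], monotonicity
   makes it so at all earlier times. *)
have [Et0|Et0] := eqVneq (E t) 0.
  by rewrite Et0 divr_ge0// powR_ge0.
have {}Et0 : 0 < E t by rewrite lt_def Et0 E0.
have Es0 s : 0 <= s -> s <= t -> 0 < E s.
  by move=> s0 st; exact: lt_le_trans Et0 (E_nonincreasing s0 st).
have [h h0 hh] := small_step (powR_ge0 (E 0) q).
suff H : B <= E t `^ (- q).
  have : B `^ (q^-1) <= (E t `^ (- q)) `^ (q^-1).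
    by apply: ge0_ler_powR; rewrite ?nnegrE ?invr_ge0 ?powR_ge0// ltW.
  rewrite -powRrM mulNr divff ?gt_eqF// powR_inv1// => H1.
  rewrite div1r -[leLHS]invrK lef_pV2 ?posrE ?invr_gt0//.
  exact: powR_gt0.
suff : c * kap * t - E t `^ (- q) <= c * kap * 0 - E 0 `^ (- q).
  have : (E 0 + 1) `^ (- q) <= E 0 `^ (- q).
    rewrite !powRN lef_pV2 ?posrE ?powR_gt0 ?ltr_wpDl//; last exact: Es0.
    by apply: ge0_ler_powR; rewrite ?nnegrE ?addr_ge0// lerDl.
  rewrite /B; lra.
apply: (@local_nonincreasing _ (fun t => c * kap * t - E t `^ (- q))) => // x x0.
exists (h / 2); first by rewrite divr_gt0.
move=> s r s0 sr rt sx rx.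
have rs : r - s < h.
  by move: sx rx; rewrite !ltr_norml => /andP[? ?] /andP[? ?]; lra.
have r0 : 0 <= r by exact: le_trans sr.
have Er0 := Es0 r r0 rt; have Es0' := Es0 s s0 (le_trans sr rt).
pose X := c * E r `^ q * (r - s).
have ErE0 : E r `^ q <= E 0 `^ q.
  by apply: ge0_ler_powR; rewrite ?nnegrE// E_nonincreasing.
have X0 : 0 <= X by rewrite !mulr_ge0 ?powR_ge0 ?subr_ge0// ltW.
have X1 : X <= 1.
  have /andP[_] := hh s r sr rs; apply: le_trans.
  by rewrite ler_wpM2r ?subr_ge0// ler_wpM2l// ltW.
have h1 : E r * (1 + X) <= E s.
  by have := dE s0 sr; rewrite /X; lra.
have h2 : E r * expR (X / 2) <= E s.
  by rewrite (le_trans _ h1)// ler_wpM2l// expR_half_le// X0.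
have h3 : E s `^ (- q) <= E r `^ (- q) * expR (- (q * X / 2)).
  apply: (@le_trans _ _ ((E r * expR (X / 2)) `^ (- q))).
    rewrite !powRN lef_pV2 ?posrE ?powR_gt0 ?mulr_gt0 ?expR_gt0//.
    by apply: ge0_ler_powR; rewrite ?nnegrE ?mulr_ge0 ?expR_ge0.
  rewrite powRM ?expR_ge0// -expRM.
  by have -> : X / 2 * - q = - (q * X / 2) by field.
have h4 : expR (- (q * X / 2)) <= 1 - kap * X.
  rewrite expRN.
  have y0 : 0 <= q * X / 2 by apply: divr_ge0 => //; exact: mulr_ge0.
  apply: (@le_trans _ _ (1 + q * X / 2)^-1).
    by rewrite lef_pV2 ?posrE ?expR_gt0 ?expR_ge1Dx// ltr_pwDl.
  rewrite -[leLHS]mul1r ler_pdivrMr ?ltr_pwDl//.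
  have kE : kap * (1 + q / 2) = q / 2 by rewrite /kap divfK// gt_eqF//; lra.
  have k1 : kap * (q * X) * X <= kap * (q * X).
    by rewrite ler_piMr//; apply: mulr_ge0; [exact: ltW|exact: mulr_ge0].
  have kX : kap * X + kap * (q * X) / 2 = q * X / 2.
    by rewrite -[RHS]mulrAC -kE; field.
  lra.
have h5 : E r `^ (- q) * (kap * X) = c * kap * (r - s).
  rewrite /X powRN; field.
  by rewrite gt_eqF// powR_gt0.
have : E s `^ (- q) <= E r `^ (- q) * (1 - kap * X).
  by rewrite (le_trans h3)// ler_wpM2l// powR_ge0.
rewrite mulrBr mulr1 h5; lra.
Qed.

End decay.

(** The measures of the sections of a product-null set integrate to 0, so almost all of them
    vanish. *)
Lemma ae_prod d1 d2 (T1 : measurableType d1) (T2 : measurableType d2) (R : realType)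
  (m1 : {sigma_finite_measure set T1 -> \bar R})
  (m2 : {sigma_finite_measure set T2 -> \bar R}) (P : T1 * T2 -> Prop) :
  {ae (m1 \x m2)%E, forall z, P z} ->
  {ae m1, forall x, {ae m2, forall y, P (x, y)}}.
Proof.
move=> [A [mA A0 sub]].
have h : (\int[m1]_x `|(m2 \o xsection A) x| = 0)%E.
  rewrite -[RHS]A0; apply: eq_integral => x _.
  by rewrite gee0_abs.
have /(ae_eq_integral_abs m1 measurableT) := h.
move=> /(_ (measurable_fun_xsection m2 mA)).
apply: filterS => x /(_ I) /= hx.
exists (xsection A x); split => //; first exact: measurable_xsection.
by move=> y /= nP; rewrite /xsection/= inE; apply: sub.
Qed.

(** * The nonlocal Laplacian on bounded domains *)

Section spatial.
Context {R : realType} (N : nat).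
Local Notation mu := (@lebesgue_rV R N).
Variables (O E : set 'rV[R]_N) (J : 'rV[R]_N -> R).
Hypotheses (N0 : (0 < N)%N) (bO : bounded_domain O) (bE : bounded_domain E)
  (aJ : admissible_kernel J) (OE : O `<=` E)
  (OJE : [set x + 2 *: z | x in O & z in supp J] `<=` E).

Lemma measurable_domain (D : set 'rV[R]_N) : bounded_domain D -> measurable D.
Proof. by move=> [oD _ _ _]; exact: open_measurable_rV. Qed.

Lemma lebesgue_domain_lty (D : set 'rV[R]_N) : bounded_domain D -> (mu D < +oo)%E.
Proof.
move=> bD; have [_ _ ? _] := bD.
by apply: lebesgue_rV_bounded_lty => //; exact: measurable_domain.
Qed.

Definition domain_measure : {finite_measure set 'rV[R]_N -> \bar R} :=
  mfrestr (measurable_domain bE) (lebesgue_domain_lty bE).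
Local Notation nu := domain_measure.

Lemma integral_domain (f : 'rV[R]_N -> \bar R) : measurable_fun setT f ->
  (\int[nu]_x f x = \int[mu]_(x in E) f x)%E.
Proof. exact: (integral_mrestr mu (measurable_domain bE)). Qed.

Lemma integrable_domain (f : 'rV[R]_N -> \bar R) : measurable_fun setT f ->
  nu.-integrable setT f <-> mu.-integrable E f.
Proof. exact: (integrable_mrestr mu (measurable_domain bE)). Qed.

Lemma ae_domain (P : 'rV[R]_N -> Prop) :
  {ae mu, forall x, P x} -> {ae nu, forall x, P x}.
Proof.
move=> h; apply: (@ae_mrestr _ _ _ mu _ (measurable_domain bE)).
by apply: filterS h => x.
Qed.

Lemma Rintegral_domain (f : 'rV[R]_N -> R) : measurable_fun setT f ->
  \int[nu]_x f x = \int[mu]_(x in E) f x.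
Proof.
by move=> mf; rewrite /Rintegral integral_domain//; exact/measurable_EFinP.
Qed.

Lemma Rintegral_domain_sub (f : 'rV[R]_N -> R) : measurable_fun setT f ->
  (forall x, ~ O x -> f x = 0) -> \int[nu]_x f x = \int[mu]_(x in O) f x.
Proof.
move=> mf f0; rewrite Rintegral_domain// Rintegral_mkcond [RHS]Rintegral_mkcond.
apply: eq_Rintegral => x _; rewrite !patchE.
have [Ox|nOx] := pselect (O x).
  by rewrite !mem_set//; exact: OE.
by rewrite (memNset nOx) f0// if_same.
Qed.

Let k (z : 'rV[R]_N * 'rV[R]_N) := J (z.1 - z.2).

Let J0 z : 0 <= J z. Proof. by case: aJ. Qed.
Let cJ : continuous J. Proof. by case: aJ. Qed.

Lemma kernel_bounded : exists M, forall z, J z <= M.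
Proof.
have [_ _ _ cs [z0 Jz0]] := aJ.
have [||c _ hc] := @compact_EVT_max _ _ J (supp J) _ cs.
- by exists z0; exact: kernel_supp.
- exact: continuous_subspaceT.
exists (J c) => z; have [->|Jz] := eqVneq (J z) 0; first exact: J0.
by apply: hc; rewrite inE; exact: kernel_supp.
Qed.

Let mJ : measurable_fun setT J.
Proof. exact: measurable_rV_continuous. Qed.

Let msub d (T : measurableType d) (f g : T -> 'rV[R]_N) :
  measurable_fun setT f -> measurable_fun setT g ->
  measurable_fun setT (fun x => f x - g x).
Proof.
move=> mf mg; have -> : (fun x => f x - g x) = (fun x => f x + (-1) *: g x).
  by apply/funext => x; rewrite scaleN1r.
by apply: measurable_rVD => //; exact: measurable_rVZ.
Qed.

Let mk : measurable_fun setT k.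
Proof. by apply: (measurableT_comp mJ); exact: msub. Qed.

Let mkx (x : 'rV[R]_N) : measurable_fun setT (fun y : 'rV[R]_N => J (x - y)).
Proof. by apply: (measurableT_comp mJ); exact: msub. Qed.

Let k_ge0 z : 0 <= k z. Proof. exact: J0. Qed.

Let ksym x y : k (x, y) = k (y, x).
Proof. by rewrite /k /= -(kernel_even aJ) opprB. Qed.

Lemma nonlocal_laplacianE v : measurable_fun setT v ->
  nonlocal_laplacian J E v = kernel_op nu k v.
Proof.
move=> mv; apply/funext => x; rewrite /nonlocal_laplacian /kernel_op.
rewrite Rintegral_domain//; apply: measurable_funM; first exact: mkx.
exact: measurable_funB.
Qed.

Lemma kernel_mass : exists2 K0 : R, 0 < K0 & forall x, O x ->
  K0 <= \int[nu]_y J (x - y).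
Proof.
have [sg [K0 [sg0 K00 hK]]] := kernel_mass_lower_bound N0 bO bE aJ OE OJE.
have [M hM] := kernel_bounded.
exists K0 => // x Ox.
have ki : nu.-integrable setT (EFin \o (fun y => J (x - y))).
  apply: (@integrable_le _ _ _ _ _ (fun=> M)) => //.
    by move=> y; rewrite ger0_norm.
  exact: finite_measure_integrable_cst.
rewrite -lee_fin fineK; last exact: integrable_fin_num.
apply: (le_trans (hK x Ox)).
rewrite integral_domain; last exact/measurable_EFinP.
rewrite [leRHS]integral_mkcond.
pose F y := (J (x - y) * \1_E y)%:E.
have mF : measurable_fun setT F.
  apply/measurable_EFinP; apply: measurable_funM => //; apply: measurable_indic.
  exact: measurable_domain.
rewrite [leRHS](eq_integral F); last first.
  by move=> y _; rewrite patchE /F indicE; case: (y \in E); rewrite ?mulr1 ?mulr0.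
rewrite -(@ge0_integral_shift _ _ x F)//; last by move=> y; rewrite lee_fin mulr_ge0.
apply: ge0_le_integral => //.
- by move=> h _; rewrite lee_fin mulr_ge0// (cut_kernel_ge0 aJ).
- apply/measurable_EFinP; apply: measurable_funM; first exact: measurable_cut_kernel.
  apply: (measurableT_comp (measurable_indic (measurable_domain bE))).
  exact: measurable_rVD.
- by apply: (measurableT_comp mF); exact: measurable_rVD.
move=> h _; rewrite /F lee_fin (addrC h) opprD addNKr (kernel_even aJ).
by rewrite ler_wpM2r// /cut_kernel; case: ifP.
Qed.

(** The right-hand side is half the quadratic form which the Poincare inequality bounds below by
    [c], hence [c / 2]. *)
Lemma kernel_op_coercive : exists2 lam : R, 0 < lam & forall a : 'rV[R]_N -> R,
  measurable_fun setT a -> (forall x, ~ O x -> a x = 0) ->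
  nu.-integrable setT (EFin \o (fun x => a x ^+ 2)) ->
  lam * (\int[nu]_x (a x ^+ 2)) <= - (\int[nu]_x (a x * kernel_op nu k a x)).
Proof.
have [c c0 hc] := poincare N0 bO bE aJ OE OJE.
have [M hM] := kernel_bounded.
exists (c / 2); first by rewrite divr_gt0.
move=> a ma aO a2.
have ai := integrable_sqr ma a2.
have aai : nu.-integrable setT (EFin \o (fun x => a x * a x)).
  by apply: eq_integrable a2 => // x _ /=; rewrite expr2.
rewrite (@kernel_op_weak _ _ _ nu k M mk k_ge0 (fun z => hM _) ksym _ _ ai ai aai).
rewrite mulNr opprK mulrAC -[X in _ <= X]mulrC ler_wpM2r//.
pose F (z : 'rV[R]_N * 'rV[R]_N) := k z * ((a z.2 - a z.1) * (a z.2 - a z.1)).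
have mF : measurable_fun setT F.
  apply: measurable_funM => //.
  by apply: measurable_funM; apply: measurable_funB;
    exact: (measurableT_comp ma).
have F0 z : 0 <= F z by rewrite mulr_ge0// -expr2 sqr_ge0.
have mFx x : measurable_fun setT (fun y => F (x, y)) by exact: (measurableT_comp mF).
have FE : (\int[nu \x nu]_z (F z)%:E = \int[mu]_x \int[mu]_y
     (J (x - y) * (\1_E x * \1_E y * (a x - a y) ^+ 2))%:E)%E.
  rewrite (@fubini_tonelli1 _ _ _ _ _ nu nu (EFin \o F)); last 2 first.
  - exact/measurable_EFinP.
  - by move=> z; rewrite lee_fin.
  rewrite integral_domain; last first.
    apply: (@measurable_fun_fubini_tonelli_F _ _ _ _ _ nu (EFin \o F)).
      exact/measurable_EFinP.
    by move=> z; rewrite lee_fin.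
  rewrite integral_mkcond; apply: eq_integral => x _.
  rewrite patchE; case: ifPn => Ex; last first.
    rewrite integral0_eq// => y _.
    by rewrite [\1_E x]indicE (negbTE Ex) !mul0r mulr0.
  rewrite /fubini_F integral_domain; last exact/measurable_EFinP.
  rewrite integral_mkcond; apply: eq_integral => y _.
  rewrite patchE [\1_E x]indicE Ex [\1_E y]indicE; case: (y \in E); last first.
    by rewrite mulr0 mul0r mulr0.
  by rewrite !mul1r /F /k /=; congr EFin; ring.
have aE : (\int[mu]_x (a x ^+ 2)%:E = \int[nu]_x (a x ^+ 2)%:E)%E.
  rewrite integral_domain; last by apply/measurable_EFinP; exact: measurable_funX.
  rewrite [RHS]integral_mkcond; apply: eq_integral => x _; rewrite patchE.
  case: ifPn => // nEx; rewrite aO ?expr0n// => Ox.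
  by move/negP : nEx; apply; rewrite inE; exact: OE.
have := hc a ma aO; rewrite -FE aE.
(* Finiteness of the form allows passing from the extended inequality to real numbers. *)
have Fi : (nu \x nu)%E.-integrable setT (EFin \o F).
  apply: (@kernel_integrable _ _ _ nu k M mk k_ge0 (fun z => hM _)).
  have i1 : (nu \x nu)%E.-integrable setT (EFin \o (fun z => a z.2 ^+ 2)).
    have := integrable_prod (finite_measure_integrable_cst nu 1 measurableT) a2.
    by apply: eq_integrable => // z _ /=; rewrite mul1r.
  have i2 : (nu \x nu)%E.-integrable setT (EFin \o (fun z => a z.1 ^+ 2)).
    have := integrable_prod a2 (finite_measure_integrable_cst nu 1 measurableT).
    by apply: eq_integrable => // z _ /=; rewrite mulr1.
  have mz2 : measurable_fun setT (fun z : 'rV[R]_N * 'rV[R]_N => a z.2).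
    exact: (measurableT_comp ma).
  have mz1 : measurable_fun setT (fun z : 'rV[R]_N * 'rV[R]_N => - a z.1).
    by apply: measurableT_comp => //; exact: (measurableT_comp ma).
  have := integrable_sqrD mz2 mz1 i1 _.
  move=> /(_ _) h; have {}h := h ltac:(by apply: eq_integrable i2 => // z _ /=; rewrite sqrrN).
  by apply: eq_integrable h => // z _ /=; rewrite expr2.
rewrite -[X in (_ * X)%E]fineK; last exact: (integrable_fin_num measurableT a2).
rewrite -[X in (_ <= X)%E]fineK; last exact: (integrable_fin_num measurableT Fi).
by rewrite -EFinM lee_fin.
Qed.

(** The rate is stated for any [e] below the squared norm, because it will be applied with one [e]
    on a whole time interval: the energy at its end. *)
Lemma dissipation_rate : exists2 c1 : R -> R, (forall p, 0 < c1 p) &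
  forall (p : R) (a w : 'rV[R]_N -> R),
  let f x := `|nonlocal_laplacian J E a x| `^ (p - 2) * nonlocal_laplacian J E a x in
  2 <= p ->
  measurable_fun setT a -> (forall x, ~ O x -> a x = 0) ->
  nu.-integrable setT (EFin \o (fun x => a x ^+ 2)) ->
  mu.-integrable E (EFin \o f) ->
  measurable_fun setT w -> nu.-integrable setT (EFin \o (fun x => w x ^+ 2)) ->
  {ae nu, forall x, O x -> w x = - nonlocal_laplacian J E f x} ->
  \int[nu]_x (w x * a x) <= 0 /\
  forall e, 0 < e -> e <= \int[nu]_x (a x ^+ 2) ->
    \int[nu]_x (w x * a x) <= - (c1 p * (e `^ ((p - 2) / 2) * e)).
Proof.
have [lam lam0 hlam] := kernel_op_coercive.
have [K0 K00 hK] := kernel_mass.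
have [M hM] := kernel_bounded.
pose Vol := fine (nu setT) + 1.
have Vol0 : 0 < Vol by rewrite ltr_wpDl// fine_ge0.
exists (fun p => (lam ^+ 2 / (2 * Vol)) `^ ((p - 2) / 2) * (lam ^+ 2 / 2)).
  by move=> p; rewrite mulr_gt0 ?powR_gt0// divr_gt0// ?mulr_gt0// exprn_gt0.
move=> p a w f p2 ma aO a2 fi mw w2 wf.
have ai := integrable_sqr ma a2.
have mg : measurable_fun setT (kernel_op nu k a).
  apply/measurable_EFinP; apply: (measurable_int nu).
  exact: (@integrable_kernel_op _ _ _ nu k M mk k_ge0 (fun z => hM _)).
have LE := nonlocal_laplacianE ma.
pose f' x := `|kernel_op nu k a x| `^ (p - 2) * kernel_op nu k a x.
have ff' : f = f' by apply/funext => x; rewrite /f /f' LE.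
have mf : measurable_fun setT f.
  rewrite ff'; apply: measurable_funM => //.
  apply: (@measurableT_comp _ _ _ _ _ _ (fun x : R => x `^ (p - 2))) => //.
  exact: measurableT_comp.
have fi' : nu.-integrable setT (EFin \o f').
  by rewrite -ff'; apply/integrable_domain => //; exact/measurable_EFinP.
have wf' : {ae nu, forall x, O x -> w x = - kernel_op nu k f' x}.
  apply: filterS wf => x h Ox.
  by rewrite h// nonlocal_laplacianE// ff'.
have mO := measurable_domain bO.
split.
  exact: (@flux_duality_le0 _ _ _ nu k M mk k_ge0 (fun z => hM _) ksym
    p K0 O a w K00 hK ma a2 aO fi' mw w2 wf').
move=> e e0 ea.
(* With this threshold the loss th^2 |E| is at most lam^2 e / 2, half of the main term. *)
pose th := Num.sqrt (lam ^+ 2 * e / (2 * Vol)).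
have th20 : 0 < lam ^+ 2 * e / (2 * Vol).
  by rewrite divr_gt0 ?mulr_gt0// exprn_gt0.
have th0 : 0 < th by rewrite sqrtr_gt0.
have th2 : th ^+ 2 = lam ^+ 2 * e / (2 * Vol) by rewrite sqr_sqrtr// ltW.
apply: le_trans (@dissipation _ _ _ nu k M mk k_ge0 (fun z => hM _) ksym
    p K0 O a w p2 K00 hK ma a2 aO fi' mw w2 wf' th lam th0 (ltW lam0) (hlam a ma aO a2)) _.
rewrite lerN2.
have thE : th `^ (p - 2) = (lam ^+ 2 / (2 * Vol)) `^ ((p - 2) / 2) * e `^ ((p - 2) / 2).
  rewrite -powRM ?(ltW e0)//; last by rewrite divr_ge0 ?sqr_ge0// mulr_ge0// ltW.
  have -> : lam ^+ 2 / (2 * Vol) * e = th `^ 2.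
    by rewrite -[2]/(2%:R) powR_mulrn ?(ltW th0)// th2 mulrAC.
  by rewrite -powRrM; congr (_ `^ _); field.
rewrite thE.
set A := (_ `^ _); set B := (e `^ _).
rewrite [leLHS](_ : _ = A * B * (lam ^+ 2 / 2 * e)); last by ring.
rewrite ler_wpM2l ?mulr_ge0 ?powR_ge0//.
rewrite th2.
have h1 : lam ^+ 2 * e <= lam ^+ 2 * (\int[nu]_x (a x ^+ 2)).
  by rewrite ler_wpM2l// sqr_ge0.
have h2 : lam ^+ 2 * e / (2 * Vol) * fine (nu setT) <= lam ^+ 2 * e / 2.
  rewrite invfM mulrA -mulrA ler_piMr//.
    by rewrite divr_ge0// mulr_ge0 ?sqr_ge0// ltW.
  by rewrite mulrC ler_pdivrMr// mul1r lerDl.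
lra.
Qed.

End spatial.

Lemma Lfun_measurable d (T : measurableType d) (R : realType)
  (mu : {measure set T -> \bar R}) (p : \bar R) (f : T -> R) :
  f \in Lfun mu p -> measurable_fun setT f.
Proof. by rewrite inE => /andP[/[!inE]]. Qed.

Lemma Lnorm2_lt_integral d (T : measurableType d) (R : realType)
  (mu : {measure set T -> \bar R}) (f : T -> R) (e : R) : 0 < e ->
  ('N[mu]_2%:E[EFin \o f] < e%:E)%E ->
  (\int[mu]_x (f x ^+ 2)%:E <= (e ^+ 2)%:E)%E.
Proof.
move=> e0 fe.
have -> : (\int[mu]_x (f x ^+ 2)%:E = 'N[mu]_2%:E[EFin \o f] `^ 2)%E.
  rewrite poweR_Lnorm//; apply: eq_integral => x _.
  by rewrite /= powR_mulrn// real_normK ?num_real.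
have -> : (e ^+ 2)%:E = (e%:E `^ 2)%E by rewrite /= powR_mulrn// ltW.
apply: gt0_ler_poweR => //.
- by rewrite in_itv/= leey Lnorm_ge0.
- by rewrite in_itv/= leey andbT lee_fin ltW.
- exact: ltW.
Qed.

(** * Extension of a solution by zero in space and time *)

Section solution.
Context {R : realType} (N : nat).
Local Notation mu := (@lebesgue_rV R N).
Local Notation leb := (@lebesgue_measure R).
Variables (O E : set 'rV[R]_N) (J : 'rV[R]_N -> R).
Hypotheses (bO : bounded_domain O) (bE : bounded_domain E) (OE : O `<=` E).
Local Notation nu := (domain_measure bE).
Variables (T p : R) (u0 : 'rV[R]_N -> R) (u : R -> 'rV[R]_N -> R).
Hypotheses (T0 : 0 < T) (hu : solution_on T p J O E u0 u).

Let mO : measurable O. Proof. exact: measurable_domain. Qed.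
Let mE : measurable E. Proof. exact: measurable_domain. Qed.

(** Total in (t, x) and zero off [0, T] x O, so that the energy lemmas, stated on the whole product
    space, apply to it. *)
Definition ext_solution (t : R) x : R := if 0 <= t <= T then (u t \_ O) x else 0.
Local Notation U := ext_solution.

Lemma ge0_integral_domain_le (f : 'rV[R]_N -> \bar R) : measurable_fun setT f ->
  (forall x, 0 <= f x)%E -> (\int[nu]_x f x <= \int[mu]_x f x)%E.
Proof.
by move=> mf f0; rewrite integral_domain//; apply: ge0_subset_integral.
Qed.

Lemma integrable_domainW (f : 'rV[R]_N -> \bar R) :
  mu.-integrable setT f -> nu.-integrable setT f.
Proof.
move=> fi; apply/integrable_domain; first exact: (measurable_int _ fi).
exact: integrableS fi.
Qed.

Lemma ext_solutionE t : 0 <= t <= T -> U t = u t \_ O.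
Proof. by move=> tT; apply/funext => x; rewrite /U tT. Qed.

Lemma ext_solution_out t x : ~ O x -> U t x = 0.
Proof. by move=> nOx; rewrite /U patchE memNset//; case: ifP. Qed.

Lemma measurable_ext_solution :
  measurable_fun setT (fun z : measurableTypeR R * 'rV[R]_N => U z.1 z.2).
Proof.
have [[mu_ _ _] _ _ _] := hu.
have mC : measurable (`[0, T]%classic `*` O : set (measurableTypeR R * 'rV[R]_N)).
  by apply: measurableX => //; exact: measurable_itv.
have := (measurable_restrictT _ mC).1 mu_.
congr measurable_fun; apply/funext => -[t x].
rewrite !patchE /U /= patchE; case: ifPn => [|].
  by rewrite inE /= in_itv/= => -[-> Ox]; rewrite mem_set.
move=> /negP; rewrite inE /= in_itv/= => h.
case: ifPn => // tT; case: ifPn => //; rewrite inE => Ox.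
by exfalso; apply: h.
Qed.

Lemma measurable_ext_solution_t t : measurable_fun setT (U t).
Proof. exact: (measurableT_comp measurable_ext_solution (measurable_pair1 t)). Qed.

Lemma integrable_ext_solution t : nu.-integrable setT (EFin \o (fun x => U t x ^+ 2)).
Proof.
have [[_ uL2 _] _ _ _] := hu.
have [tT|tT] := boolP (0 <= t <= T).
  rewrite (ext_solutionE tT); apply: integrable_domainW.
  by apply: Lfun2_integrable_sqr; apply: uL2; rewrite in_itv.
have := finite_measure_integrable_cst nu 0 measurableT.
by apply: eq_integrable => // x _ /=; rewrite /U (negbTE tT) expr0n.
Qed.

Lemma ext_solution_continuous t e : 0 <= t <= T -> 0 < e -> exists2 r, 0 < r &
  forall s, 0 <= s <= T -> `|s - t| < r -> \int[nu]_x ((U s x - U t x) ^+ 2) <= e.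
Proof.
move=> tT e0; have [[_ uL2 uC] _ _ _] := hu.
have t01 : t \in `[0, T] by rewrite in_itv.
have se0 : 0 < Num.sqrt e by rewrite sqrtr_gt0.
have lt0 : (0%:E < (Num.sqrt e)%:E)%E by rewrite lte_fin.
have := uC t t01 _ (open_ereal_lt' lt0).
move=> /nbhs_ballP[r /= r0 hr]; exists r => // s sT st.
have := hr s; rewrite /= in_itv/= => /(_ _ sT) h.
have {h} := h ltac:(by rewrite /ball/= distrC).
move=> /(Lnorm2_lt_integral se0); rewrite sqr_sqrtr ?(ltW e0)// => h.
have dE : (fun x => U s x - U t x) = ((u s \- u t) \_ O).
  rewrite (ext_solutionE sT) (ext_solutionE tT).
  by apply/funext => x; rewrite !patchE; case: ifP => //; rewrite subrr.
have mD : measurable_fun setT (fun x => (U s x - U t x) ^+ 2).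
  apply: measurable_funX; apply: measurable_funB; exact: measurable_ext_solution_t.
rewrite -lee_fin /Rintegral fineK; last first.
  apply: integrable_fin_num => //.
  apply: integrable_sqrB;
    [exact: measurable_ext_solution_t|exact: measurable_ext_solution_t|
     exact: integrable_ext_solution|exact: integrable_ext_solution].
apply: (le_trans (ge0_integral_domain_le _ _)).
- exact/measurable_EFinP.
- by move=> x; rewrite lee_fin sqr_ge0.
- by apply: le_trans h; rewrite -dE.
Qed.

Lemma energy_extE t : 0 <= t <= T ->
  energy nu U t = \int[mu]_(x in O) `|u t x| ^+ 2.
Proof.
move=> tT; rewrite /energy (Rintegral_domain_sub _ OE).
- apply: eq_Rintegral => x xO.
  by rewrite (ext_solutionE tT) patchE xO real_normK ?num_real.
- by apply: measurable_funX; exact: measurable_ext_solution_t.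
- by move=> x nOx; rewrite ext_solution_out// expr0n.
Qed.

Variable v : R -> 'rV[R]_N -> R.
Hypotheses
  (vL2 : ((fun z => v z.1 z.2) \_ (cylinder T O)) \in Lfun (leb \x mu)%E 2%:E)
  (vweak : weak_time_derivative T O u v)
  (veq : {ae (leb \x mu)%E, forall z, cylinder T O z ->
     v z.1 z.2 = - nonlocal_laplacian J E (nonlocal_flux p J O E (u z.1)) z.2}).

Definition ext_derivative (t : R) x : R := if 0 < t < T then (v t \_ O) x else 0.
Local Notation V := ext_derivative.

Let VE : (fun z : measurableTypeR R * 'rV[R]_N => V z.1 z.2) =
  (fun z => v z.1 z.2) \_ (cylinder T O).
Proof.
apply/funext => -[t x]; rewrite /V patchE /= patchE /cylinder.
case: (boolP ((t, x) \in _)) => [|].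
  by rewrite inE /= in_itv/= => -[-> Ox]; rewrite mem_set.
move=> /negP; rewrite inE /= in_itv/= => h.
case: ifPn => // tT; case: ifPn => //; rewrite inE => Ox.
by exfalso; apply: h.
Qed.

Lemma measurable_ext_derivative :
  measurable_fun setT (fun z : measurableTypeR R * 'rV[R]_N => V z.1 z.2).
Proof. by rewrite VE; exact: Lfun_measurable vL2. Qed.

Let V2leb : (leb \x mu)%E.-integrable setT
  (EFin \o (fun z : measurableTypeR R * 'rV[R]_N => V z.1 z.2 ^+ 2)).
Proof.
have := Lfun2_integrable_sqr vL2.
by apply: eq_integrable => // z _ /=; rewrite -VE.
Qed.

Lemma integrable_ext_derivative : (time_measure T \x nu)%E.-integrable setT
  (EFin \o (fun z => V z.1 z.2 ^+ 2)).
Proof.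
have mV2 : measurable_fun setT
    (EFin \o (fun z : measurableTypeR R * 'rV[R]_N => V z.1 z.2 ^+ 2)).
  by apply/measurable_EFinP; apply: measurable_funX; exact: measurable_ext_derivative.
apply/integrable12ltyP => //.
have := (integrable12ltyP leb mu mV2).1 V2leb.
apply: le_lt_trans.
pose F (z : measurableTypeR R * 'rV[R]_N) := `|(V z.1 z.2 ^+ 2)%:E|%E.
have mF : measurable_fun setT F by exact: (measurableT_comp _ mV2).
have F0 z : (0 <= F z)%E by exact: abse_ge0.
apply: (@le_trans _ _ (\int[time_measure T]_t \int[mu]_x F (t, x))%E).
  apply: ge0_le_integral => //.
  - by move=> t _; exact: integral_ge0.
  - exact: (measurable_fun_fubini_tonelli_F F mF F0).
  - exact: (measurable_fun_fubini_tonelli_F F mF F0).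
  move=> t _; apply: ge0_integral_domain_le => //.
  exact: (measurableT_comp mF (measurable_pair1 t)).
rewrite (integral_mrestr leb); last exact: (measurable_fun_fubini_tonelli_F F mF F0).
apply: ge0_subset_integral => //.
- exact: (measurable_fun_fubini_tonelli_F F mF F0).
- by move=> t _; exact: integral_ge0.
Qed.

Lemma ext_weak_derivative eta : test_function T eta -> {ae nu, forall x,
  \int[leb]_(t in `]0, T[) (derive1 eta t * U t x) =
  - (\int[leb]_(t in `]0, T[) (eta t * V t x))}.
Proof.
move=> et; apply: ae_domain; apply: filterS (vweak et) => x hx.
have [Ox|nOx] := pselect (O x).
  have -> : \int[leb]_(t in `]0, T[) (derive1 eta t * U t x) =
      \int[leb]_(t in `]0, T[) (derive1 eta t * u t x).
    apply: eq_Rintegral => t; rewrite inE/= in_itv/= => /andP[t0 tT].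
    by rewrite ext_solutionE ?patchE ?mem_set// !ltW.
  rewrite (hx Ox); congr (- _); apply: eq_Rintegral => t.
  by rewrite inE/= in_itv/= /V => ->; rewrite patchE mem_set.
have z (f g : R -> R) : (forall t, g t = 0) ->
    \int[leb]_(t in `]0, T[) (f t * g t) = 0.
  move=> g0; rewrite (@eq_Rintegral _ _ _ leb _ (fun=> 0)); last first.
    by move=> t _; rewrite g0 mulr0.
  by rewrite Rintegral_cst// mul0r.
rewrite (z (derive1 eta)) ?(z eta) ?oppr0// => t.
  by rewrite /V patchE memNset// if_same.
exact: ext_solution_out.
Qed.

(** Slicing the space-time equation gives, at almost every time, an equation for almost every x, to
    which the spatial estimates apply. *)
Lemma ae_ext_equation : {ae time_measure T, forall t, 0 < t < T /\
  {ae nu, forall x, O x ->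
    V t x = - nonlocal_laplacian J E (nonlocal_flux p J O E (u t)) x}}.
Proof.
apply: ae_time; have := ae_prod veq.
case=> A [mA A0 sub]; exists A; split => // t /= /not_implyP[tT nP].
apply: sub => /= h; apply: nP; move: tT; rewrite in_itv/= => tT; split => //.
apply: ae_domain; apply: filterS h => x h Ox.
have := h _; rewrite /V tT patchE mem_set//; apply.
by split => //=; rewrite in_itv.
Qed.

End solution.

(** * Energy inequality for solutions, and the decay *)

Lemma energy_decrease (R : realType) (N : nat) (Omega OmegaE : set 'rV[R]_N)
  (J : 'rV[R]_N -> R) (p : R) : (0 < N)%N ->
  bounded_domain Omega -> bounded_domain OmegaE -> admissible_kernel J ->
  Omega `<=` OmegaE ->
  [set x + 2 *: z | x in Omega & z in supp J] `<=` OmegaE -> 2 <= p ->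
  exists2 c : R, 0 < c & forall (T : R) u0 u, 0 < T ->
    solution_on T p J Omega OmegaE u0 u ->
    let En t := \int[lebesgue_rV N]_(x in Omega) `|u t x| ^+ 2 in
    forall s t, 0 <= s -> s <= t -> t < T ->
    En t - En s <= - (c * (En t `^ ((p - 2) / 2) * En t)) * (t - s).
Proof.
move=> N0 bO bE aJ OE OJE p2.
have [c1 c10 hc1] := dissipation_rate N0 bO bE aJ OE OJE.
exists (2 * c1 p); first by rewrite mulr_gt0.
move=> T u0 u T0 hu En.
have [_ _ fluxi [v [vL2 vweak veq]]] := hu.
pose nu := domain_measure bE; pose U := ext_solution Omega T u.
pose V := ext_derivative Omega T v.
have mU := measurable_ext_solution bO hu.
have U2 := integrable_ext_solution bE hu.
have Uc := ext_solution_continuous bO bE hu.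
have U0 t : ~~ (0 <= t <= T) -> U t = fun=> 0.
  by move=> /negbTE tT; apply/funext => x; rewrite /U /ext_solution tT.
have mV := measurable_ext_derivative vL2.
have V2 := integrable_ext_derivative bE vL2.
have UV := ext_weak_derivative bE vweak.
have EnE t : 0 <= t <= T -> En t = energy nu U t.
  by move=> tT; rewrite (energy_extE bO bE OE hu tT).
have E0 t : 0 <= energy nu U t by apply: Rintegral_ge0 => x _; exact: sqr_ge0.
have diss : {ae time_measure T, forall t, \int[nu]_x (V t x * U t x) <= 0 /\
    forall e, 0 < e -> e <= energy nu U t ->
      \int[nu]_x (V t x * U t x) <= - (c1 p * (e `^ ((p - 2) / 2) * e))}.
  have FF : Filter (almost_everywhere (time_measure T)).
    exact: ae_filter_ringOfSetsType.
  have ae1 := ae_integrable1 V2; have ae2 := ae_ext_equation bE veq.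
  have ae3 := ae_time fluxi.
  apply: (@filterS _ _ FF _ _ _ (@filterI _ _ FF _ _ ae1 (@filterI _ _ FF _ _ ae2 ae3))).
  move=> t [Vt2 [[/andP[t0 tT] eqt] ft]].
  have tT' : 0 <= t <= T by rewrite !ltW.
  have UE := ext_solutionE Omega u tT'.
  apply: (hc1 p (U t) (V t) p2).
  - exact: (measurable_ext_solution_t bO hu).
  - by move=> x nOx; exact: ext_solution_out.
  - exact: U2.
  - by rewrite /U UE; exact: ft.
  - exact: (measurableT_comp mV (measurable_pair1 t)).
  - exact: Vt2.
  - by rewrite /U UE; exact: eqt.
have EL C s t : 0 < s -> s <= t -> t < T ->
    {ae time_measure T, forall r, s < r <= t -> \int[nu]_x (V r x * U r x) <= - C} ->
    energy nu U t - energy nu U s <= - (2 * C) * (t - s).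
  exact: (energy_le T0 mU U2 U0 Uc mV V2 UV).
(* The sign of the dissipation alone gives monotonicity, which the rate needs in turn. *)
have mono s t : 0 < s -> s <= t -> t < T -> energy nu U t <= energy nu U s.
  move=> s0 st tT; rewrite -subr_le0 (le_trans (EL 0 s t s0 st tT _))//.
    apply: (@filterS _ _ (@ae_filter_ringOfSetsType _ _ _ (time_measure T)) _ _ _ diss).
    by move=> r [h _] _; rewrite oppr0.
  by rewrite mulr0 oppr0 mul0r.
pose D t := 2 * c1 p * (energy nu U t `^ ((p - 2) / 2) * energy nu U t).
have D0 t : 0 <= D t by rewrite mulr_ge0 ?mulr_ge0 ?powR_ge0// ltW.
have dec s t : 0 < s -> s <= t -> t < T ->
    energy nu U t - energy nu U s <= - D t * (t - s).
  move=> s0 st tT; have [e0|e0] := eqVneq (energy nu U t) 0.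
    by rewrite /D e0 !mulr0 oppr0 mul0r sub0r oppr_le0.
  have {}e0 : 0 < energy nu U t by rewrite lt_def e0 E0.
  (* By monotonicity the energy at [t] is a lower bound on all of ]s, t], which gives a constant
     rate there. *)
  rewrite /D -mulrA; apply: EL => //.
  apply: (@filterS _ _ (@ae_filter_ringOfSetsType _ _ _ (time_measure T)) _ _ _ diss).
  move=> r [_ h] /andP[sr rt]; apply: h => //.
  exact: mono (lt_trans s0 sr) rt tT.
move=> s t s0 st tT.
have t0 := le_trans s0 st.
have tT' : 0 <= t <= T by rewrite t0 ltW.
have sT' : 0 <= s <= T by rewrite s0 (le_trans st)// ltW.
rewrite (EnE t tT') (EnE s sT') -/(D t).
move: s0; rewrite le_eqVlt => /predU1P[s0|s0]; last exact: dec.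
(* The weak derivative only sees positive times; s = 0 is reached by continuity of the energy at
   0. *)
rewrite -{}s0 in st sT' *.
move: t0; rewrite le_eqVlt => /predU1P[<-|t0]; first by rewrite !subrr mulr0.
rewrite subr0; apply/ler_addgt0Pr => e e0.
have e20 : 0 < e / 2 by rewrite divr_gt0.
have [r r0 hr] := energy_cvg mU U2 Uc sT' e20.
(* Small enough for the energy to change by at most e/2 on [0, s'] and for the missing decrease
   [D t * s'] to be at most e/2. *)
pose s' := Num.min (Num.min (r / 2) t) (e / 2 / (D t + 1)).
have s'0 : 0 < s' by rewrite !lt_min t0 !divr_gt0// ltr_wpDl.
have s't : s' <= t by rewrite /s' !ge_min lexx orbT.
have s'r : `|s' - 0| < r.
  rewrite subr0 gtr0_norm// /s' !gt_min; apply/orP; left; apply/orP; left.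
  by rewrite ltr_pdivrMr// ltr_pMr// ltr1n.
have s'e : D t * s' <= e / 2.
  apply: (@le_trans _ _ ((D t + 1) * s')); first by rewrite ler_wpM2r ?lerDl// ltW.
  rewrite mulrC -ler_pdivlMr ?ltr_wpDl//; by rewrite /s' ge_min lexx orbT.
have s'T : 0 <= s' <= T by rewrite (ltW s'0) (le_trans s't)// ltW.
have h1 := dec s' t s'0 s't tT.
have := hr s' s'T s'r; rewrite ler_norml => /andP[_ h2].
by rewrite -/U -/nu in h2; lra.
Qed.

Theorem theorem2p5 (R : realType) (N : nat) (hN : (2 <= N)%N)
  (Omega OmegaE : set 'rV[R]_N) (J : 'rV[R]_N -> R)
  (hOmega : bounded_domain Omega) (hOmegaE : bounded_domain OmegaE)
  (hJ : admissible_kernel J)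
  (hsub : Omega `<=` OmegaE)
  (hsupp : [set x + 2 *: z | x in Omega & z in supp J] `<=` OmegaE)
  (p : R) (hp : 2 <= p)
  (u0 : 'rV[R]_N -> R) (hu02 : in_Lp 2 Omega u0) (hu0p : in_Lp p Omega u0)
  (u : R -> 'rV[R]_N -> R)
  (hu : forall T : R, 0 < T -> solution_on T p J Omega OmegaE u0 u) :
  exists C1 C2 C3 : R, [/\ 0 < C1, 0 < C2, 0 < C3 &
    forall t : R, 0 < t ->
      (p = 2 ->
        \int[lebesgue_rV N]_(x in Omega) `|u t x| ^+ 2 <=
        expR (- C1 * t) * \int[lebesgue_rV N]_(x in Omega) `|u0 x| ^+ 2) /\
      (2 < p ->
        \int[lebesgue_rV N]_(x in Omega) `|u t x| ^+ 2 <=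
        1 / (C2 * t + C3) `^ (2 / (p - 2)))].
Proof.
have N0 : (0 < N)%N by exact: ltnW.
have [c c0 hc] := energy_decrease N0 hOmega hOmegaE hJ hsub hsupp hp.
pose En t := \int[lebesgue_rV N]_(x in Omega) `|u t x| ^+ 2.
pose q := (p - 2) / 2.
have q0 : 0 <= q by rewrite divr_ge0 ?subr_ge0.
have En0 t : 0 <= En t by apply: Rintegral_ge0 => x _; exact: exprn_ge0.
have dEn s t : 0 <= s -> s <= t ->
    En t - En s <= - (c * (En t `^ q * En t)) * (t - s).
  move=> s0 st; have t0 := le_trans s0 st.
  (* The horizon t + 1 leaves [t] strictly inside; [c] does not depend on it. *)
  have T0 : 0 < t + 1 by rewrite ltr_wpDl.
  by apply: (hc (t + 1) u0 u T0 (hu _ T0) s t s0 st); rewrite ltrDl.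
have En00 : En 0 = \int[lebesgue_rV N]_(x in Omega) `|u0 x| ^+ 2.
  have [[_ uL2 _] init _ _] := hu 1 ltr01.
  rewrite /En [LHS]Rintegral_mkcond [RHS]Rintegral_mkcond.
  have mO := measurable_domain hOmega.
  (* Measurability is available for the restrictions to [Omega], so squares are taken after
     restriction. *)
  have sqE (f : 'rV[R]_N -> R) :
      (fun x => `|f x| ^+ 2) \_ Omega = (fun x => (f \_ Omega) x ^+ 2).
    apply/funext => x; rewrite !patchE; case: ifP => _.
      by rewrite real_normK ?num_real.
    by rewrite expr0n.
  rewrite !sqE; apply: ae_Rintegral.
  - apply: measurable_funX; apply: Lfun_measurable (uL2 0 _).
    by rewrite in_itv/= lexx ler01.
  - by apply: measurable_funX; exact: Lfun_measurable hu02.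
  - apply: filterS init => x h; rewrite !patchE; case: ifPn => //.
    by rewrite inE => /h ->.
exists (c / 2).
(* The formula vanishes at q = 0, that is p = 2, where any positive value will do. *)
exists (if q == 0 then 1 else c * (q / 2 / (1 + q / 2))).
exists ((En 0 + 1) `^ (- q)); split.
- by rewrite divr_gt0.
- case: ifPn => // qn0; have qp : 0 < q by rewrite lt_def qn0.
  have q2 : 0 < q / 2 by rewrite divr_gt0.
  by rewrite mulr_gt0// divr_gt0// addr_gt0.
- by rewrite powR_gt0// ltr_wpDl.
move=> t t0; split => [p2|p2].
  rewrite -En00; apply: (exponential_decay c0 En0 dEn) => //; last exact: ltW.
  by rewrite /q p2 subrr mul0r.
have qp : 0 < q by rewrite divr_gt0// subr_gt0.
have -> : 2 / (p - 2) = q^-1 by rewrite /q invf_div.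
rewrite gt_eqF//; apply: (polynomial_decay c0 q0 En0 dEn) => //; exact: ltW.
Qed.
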